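(* Let $A=\mathbb{F}_q[t]$, $F=\mathbb{F}_q(t)$, $n\ge1$ and $r\ge1$. Then: (a) The ideal $I_n$ is a free module over $R_n^U$ with basis $E_1\cdots E_r$. (b) The ideal $I_n$ is a free module over the group ring $F[U]$.
   Context: $\mathbb{F}_q$ is a finite field with $q$ elements, $A=\mathbb{F}_q[t]$, $F=\mathbb{F}_q(t)$. For $s\ge1$ and $0\le\nu\le n$ put $V^s_\nu=(t^{-\nu}A/A)^{\oplus s}$, so $V^s_0=0$ and $V^s_\nu\subset V^s_n$ is the $t^\nu$-torsion submodule. Put $V_\nu=V_\nu^r$. For a finite dimensional $\mathbb{F}_q$-vector space $V$ let $K_V$ be the field of quotients of the symmetric algebra of $V$ over $\mathbb{F}_q$, and $R_V\subset K_V$ the $\mathbb{F}_q$-subalgebra generated by the elements $\frac1v$ for all $v\in V\setminus\{0\}$, graded so that each $\frac1v$ has degree $1$. For $s\ge1$ let $R^{(s)}_n$ be the graded factor ring of $R_{V^s_n}\otimes_{\mathbb{F}_q}F$ by the ideal generated by the elements $\frac{1}{av}\otimes a-\sum_{v'\in V^s_\nu}\frac{1}{v-v'}\otimes1$ for all $a=\alpha t^\nu$ with $\alpha\in\mathbb{F}_q^\times$, $0\le\nu\le n$, and all $v\in V^s_n\setminus V^s_\nu$. $[f]$ denotes the image of $f$. Let $RS^{(s)}_n$ be the localization of $R^{(s)}_n$ obtained by inverting $[\frac1v\otimes1]$ for all $v\in V^s_n\setminus\{0\}$. Put $R_n=R_n^{(r)}$. For $1\le s<r$ and an injective $A$-linear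 map $i\colon V^s_n\hookrightarrow V^r_n$ let $\tilde\pi_i\colon R_n\to RS^{(s)}_n$ be the $F$-algebra homomorphism sending $[\frac{1}{i(v')}\otimes1]$ to $[\frac1{v'}\otimes1]$ for $v'\in V^s_n\setminus\{0\}$ and $[\frac1v\otimes1]$ to $0$ for $v\in V^r_n\setminus i(V^s_n)$. Put $I_n=R_{n,+}\cap\bigcap_{s,i}\mathrm{Ker}(\tilde\pi_i)\subset R_n$, where $R_{n,+}$ is the ideal of elements of positive degree and the intersection is over all $1\le s<r$ and all such $i$. Let $b_1,\dots,b_r$ be the standard basis and $X_{k,n}\in V_n$ the class of $t^{-n}b_k$. Let $V'_{k,n}\subset V_n$ be the direct sum of $V_{n-1}$ and the $\mathbb{F}_q$-span of $X_{1,n},\dots,X_{k-1,n}$. For $1\le k\le r$ let $E_k=\{[\frac{1}{X_{k,n}+w}\otimes1]\mid w\in V'_{k,n}\}\subset R_n$, and $E_1\cdots E_r=\{e_1\cdots e_r\mid e_k\in E_k\}$. $U<\mathrm{GL}_r(\mathbb{F}_q[t]/(t^n))$ is the subgroup of matrices congruent modulo $(t)$ to an upper triangular matrix with all diagonal entries $1$. $\mathrm{GL}_r(\mathbb{F}_q[t]/(t^n))$ acts on $V_n$ (viewed as a space of column vectors) by left multiplication and hence on $R_n$ (preserving $I_n$) by $F$-algebra automorphisms $[\frac1v\otimes1]\mapsto[\frac1{gv}\otimes1]$; $R_n^U$ is the ring of $U$-invariants. *)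

(* Defs.v *)
From HB Require Import structures.
From mathcomp Require Import all_boot all_order all_algebra.
From mathcomp Require Import boolp.
From mathcomp Require Import mpoly.
From mathcomp Require Import ring.
From mathcomp Require monalg.

Set Implicit Arguments.
Unset Strict Implicit.
Unset Printing Implicit Defensive.

Import GRing.Theory.
Local Open Scope ring_scope.
Local Open Scope quotient_scope.

Section Ideal.
Context {R : comPzRingType} (G : R -> Prop).

Definition ideal_gen (x : R) : Prop :=
  exists2 s : seq (R * R), {in s, forall p, G p.2} &
    x = \sum_(p <- s) p.1 * p.2.

Lemma ideal_gen0 : ideal_gen 0.
Proof. by exists [::]; rewrite ?big_nil. Qed.

Lemma ideal_genD x y : ideal_gen x -> ideal_gen y -> ideal_gen (x + y).
Proof.
move=> [s Gs ->] [t Gt ->]; exists (s ++ t); rewrite ?big_cat //.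
by move=> p; rewrite mem_cat => /orP[/Gs|/Gt].
Qed.

Lemma ideal_genM a x : ideal_gen x -> ideal_gen (a * x).
Proof.
move=> [s Gs ->]; exists [seq (a * p.1, p.2) | p <- s].
  by move=> _ /mapP[p ps ->]; exact: Gs ps.
by rewrite big_map mulr_sumr; apply: eq_bigr => p _; rewrite mulrA.
Qed.

Lemma ideal_genN x : ideal_gen x -> ideal_gen (- x).
Proof. by move=> /(ideal_genM (- 1)); rewrite mulN1r. Qed.

Lemma ideal_gen_mem x : G x -> ideal_gen x.
Proof.
move=> Gx; exists [:: (1, x)]; last by rewrite big_seq1 mul1r.
by move=> p; rewrite inE => /eqP->.
Qed.

Definition ideal_equiv : rel R := fun x y => `[< ideal_gen (x - y) >].

Lemma ideal_equiv_class : equiv_class_of ideal_equiv.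
Proof.
split=> [x|x y|y x z]; first by apply/asboolP; rewrite subrr; exact: ideal_gen0.
  by apply/asboolP/asboolP => /ideal_genN; rewrite opprB.
move=> /asboolP h1 /asboolP h2; apply/asboolP.
by rewrite -(subrKA y); exact: ideal_genD.
Qed.

Canonical ideal_equiv_equiv := EquivRelPack ideal_equiv_class.
Canonical ideal_equiv_encModRel := defaultEncModRel ideal_equiv.

(* The quotient of R by the ideal generated by G. The quotients in
   mathcomp's ring_quotient require the ideal to be proper; here it is
   arbitrary, and the quotient may be the zero ring. *)
Definition quot_gen := {eq_quot ideal_equiv}.

HB.instance Definition _ : EqQuotient R ideal_equiv quot_gen :=
  EqQuotient.on quot_gen.
HB.instance Definition _ := Choice.on quot_gen.

Lemma quot_genE x y : (x == y %[mod quot_gen]) = `[< ideal_gen (x - y) >].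
Proof. by rewrite piE. Qed.

Let zero := \pi_quot_gen (0 : R).
Let one := \pi_quot_gen (1 : R).
Let opp (x : quot_gen) := \pi_quot_gen (- repr x : R).
Let add (x y : quot_gen) := \pi_quot_gen (repr x + repr y : R).
Let mul (x y : quot_gen) := \pi_quot_gen (repr x * repr y : R).

Let repr_pi x : ideal_gen (repr (\pi_quot_gen x) - x).
Proof. by apply/asboolP; rewrite -quot_genE reprK. Qed.

Let pi_opp x : opp (\pi x) = \pi_quot_gen (- x : R).
Proof.
apply/eqP; rewrite quot_genE; apply/asboolP.
by rewrite -opprD; apply: ideal_genN; exact: repr_pi.
Qed.

Let pi_add x y : add (\pi x) (\pi y) = \pi_quot_gen (x + y : R).
Proof.
apply/eqP; rewrite quot_genE; apply/asboolP; rewrite opprD addrACA.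
by apply: ideal_genD; exact: repr_pi.
Qed.

Let pi_mul x y : mul (\pi x) (\pi y) = \pi_quot_gen (x * y : R).
Proof.
apply/eqP; rewrite quot_genE; apply/asboolP.
set x' := repr _; set y' := repr _.
have -> : x' * y' - x * y = x' * (y' - y) + y * (x' - x).
  by rewrite !mulrBr [y * x']mulrC [y * x]mulrC addrA subrK.
by apply: ideal_genD; apply: ideal_genM; exact: repr_pi.
Qed.

Let addA : associative add.
Proof. by do 3!elim/quotW => ?; rewrite !pi_add addrA. Qed.
Let addC : commutative add.
Proof. by do 2!elim/quotW => ?; rewrite !pi_add addrC. Qed.
Let add0 : left_id zero add.
Proof. by elim/quotW => ?; rewrite !pi_add add0r. Qed.
Let addN : left_inverse zero opp add.
Proof. by elim/quotW => ?; rewrite pi_opp pi_add addNr. Qed.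

HB.instance Definition _ := GRing.isZmodule.Build quot_gen addA addC add0 addN.

Let mulA : associative mul.
Proof. by do 3!elim/quotW => ?; rewrite !pi_mul mulrA. Qed.
Let mulC : commutative mul.
Proof. by do 2!elim/quotW => ?; rewrite !pi_mul mulrC. Qed.
Let mul1 : left_id one mul.
Proof. by elim/quotW => ?; rewrite !pi_mul mul1r. Qed.
Let mulDl : left_distributive mul add.
Proof. by do 3!elim/quotW => ?; rewrite !(pi_add, pi_mul) mulrDl. Qed.

HB.instance Definition _ :=
  GRing.Zmodule_isComPzRing.Build quot_gen mulA mulC mul1 mulDl.

Lemma quot_pi_add x y : \pi_quot_gen (x + y : R) = \pi_quot_gen x + \pi_quot_gen y.
Proof. exact/esym/pi_add. Qed.
Lemma quot_pi_opp x : \pi_quot_gen (- x : R) = - \pi_quot_gen x.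
Proof. exact/esym/pi_opp. Qed.
Lemma quot_pi_mul x y : \pi_quot_gen (x * y : R) = \pi_quot_gen x * \pi_quot_gen y.
Proof. exact/esym/pi_mul. Qed.

End Ideal.

(* Here and below, definitions are locked only to keep the conversion test from
   unfolding them. *)
HB.lock Definition quot_proj {R : comPzRingType} (G : R -> Prop) (x : R) :
  quot_gen G := \pi_(quot_gen G) x.

Section QuotProj.
Context {R : comPzRingType} (G : R -> Prop).
Local Notation quot_proj := (quot_proj G).
Local Notation quot_gen := (quot_gen G).
Local Notation ideal_gen := (ideal_gen G).

Lemma quot_proj_zmod : zmod_morphism quot_proj.
Proof. by move=> x y; rewrite !quot_proj.unlock quot_pi_add quot_pi_opp. Qed.
Lemma quot_proj_monoid : monoid_morphism quot_proj.
Proof. by split=> [|x y]; rewrite !quot_proj.unlock // quot_pi_mul. Qed.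
HB.instance Definition _ :=
  GRing.isZmodMorphism.Build R quot_gen quot_proj quot_proj_zmod.
HB.instance Definition _ :=
  GRing.isMonoidMorphism.Build R quot_gen quot_proj quot_proj_monoid.

Lemma quot_proj_eq x y : quot_proj x = quot_proj y <-> ideal_gen (x - y).
Proof.
rewrite !quot_proj.unlock.
split=> [/eqP|h]; first by rewrite quot_genE => /asboolP.
by apply/eqP; rewrite quot_genE; exact/asboolP.
Qed.

Lemma quot_projW (P : quot_gen -> Prop) :
  (forall x, P (quot_proj x)) -> forall x, P x.
Proof. by move=> h; elim/quotW => x; move: (h x); rewrite quot_proj.unlock. Qed.

End QuotProj.

Section Localization.
Context {R : comPzRingType} (S : R -> Prop).

Definition loc_den (m : R) : Prop :=
  exists2 s : seq R, {in s, forall x, S x} & m = \prod_(x <- s) x.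

Lemma loc_den1 : loc_den 1.
Proof. by exists [::]; rewrite ?big_nil. Qed.

Lemma loc_denM x y : loc_den x -> loc_den y -> loc_den (x * y).
Proof.
move=> [s Ss ->] [t St ->]; exists (s ++ t); rewrite ?big_cat //.
by move=> z; rewrite mem_cat => /orP[/Ss|/St].
Qed.

Lemma loc_den_mem x : S x -> loc_den x.
Proof.
move=> Sx; exists [:: x]; last by rewrite big_seq1.
by move=> y; rewrite inE => /eqP->.
Qed.

Definition prefrac := {p : R * R | `[< loc_den p.2 >]}.

Definition mk_prefrac a m (hm : loc_den m) : prefrac :=
  exist _ (a, m) (introT (asboolP _) hm).

Let num (x : prefrac) : R := (val x).1.
Let den (x : prefrac) : R := (val x).2.
Let denP x : loc_den (den x). Proof. exact/asboolP/(valP x). Qed.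

Definition loc_equiv : rel prefrac := fun x y =>
  `[< exists2 u, loc_den u &
      u * ((val x).1 * (val y).2) = u * ((val y).1 * (val x).2) >].

Lemma loc_equiv_class : equiv_class_of loc_equiv.
Proof.
split=> [x|x y|y x z]; first by apply/asboolP; exists 1; first exact: loc_den1.
  by apply/asboolP/asboolP => -[u hu e]; exists u.
move=> /asboolP[u hu]; rewrite -/(num x) -/(num y) -/(den x) -/(den y) => e.
move=> /asboolP[w hw]; rewrite -/(num z) -/(num y) -/(den z) -/(den y) => f.
apply/asboolP; exists (u * w * den y).
  by do !apply: loc_denM.
rewrite -/(num x) -/(num z) -/(den x) -/(den z).
transitivity (u * (num x * den y) * (w * den z)); first by ring.
by rewrite e; transitivity (w * (num y * den z) * (u * den x));
  [ring | rewrite f; ring].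
Qed.

Canonical loc_equiv_equiv := EquivRelPack loc_equiv_class.
Canonical loc_equiv_encModRel := defaultEncModRel loc_equiv.

(* The ring of fractions obtained from R by inverting all elements of S. Since
   R may have zero divisors, a/m and b/l are identified when
   u (a l - b m) = 0 for some denominator u. *)
Definition localization := {eq_quot loc_equiv}.

HB.instance Definition _ : EqQuotient prefrac loc_equiv localization :=
  EqQuotient.on localization.
HB.instance Definition _ := Choice.on localization.

Definition loc_frac a m (hm : loc_den m) : localization :=
  \pi_localization (mk_prefrac a hm).

Lemma loc_frac_eq a m (hm : loc_den m) b l (hl : loc_den l) :
  loc_frac a hm = loc_frac b hl <->
  exists2 u, loc_den u & u * (a * l) = u * (b * m).
Proof.
split=> [/eqP|h]; first by rewrite piE => /asboolP.
by apply/eqP; rewrite piE; exact/asboolP.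
Qed.

Lemma loc_fracW (P : localization -> Prop) :
  (forall a m (hm : loc_den m), P (loc_frac a hm)) -> forall x, P x.
Proof.
move=> h; elim/quotW => x.
have -> : x = mk_prefrac (num x) (denP x).
  by apply: val_inj; rewrite /= -surjective_pairing.
exact: h.
Qed.

Let zero := loc_frac 0 loc_den1.
Let one := loc_frac 1 loc_den1.
Let opp (x : localization) := loc_frac (- num (repr x)) (denP (repr x)).
Let add (x y : localization) :=
  loc_frac (num (repr x) * den (repr y) + num (repr y) * den (repr x))
           (loc_denM (denP (repr x)) (denP (repr y))).
Let mul (x y : localization) :=
  loc_frac (num (repr x) * num (repr y))
           (loc_denM (denP (repr x)) (denP (repr y))).

Let repr_frac a m (hm : loc_den m) : exists2 u, loc_den u &
  u * (num (repr (loc_frac a hm)) * m) = u * (a * den (repr (loc_frac a hm))).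
Proof.
apply/(loc_frac_eq _ (denP _) _ hm).
rewrite -[RHS]reprK /loc_frac; congr (\pi_localization _).
by apply: val_inj; rewrite /= -surjective_pairing.
Qed.

Let fracN a m (hm : loc_den m) : opp (loc_frac a hm) = loc_frac (- a) hm.
Proof.
rewrite /opp; have [u hu] := repr_frac a hm.
set n := num _; set d := den _ => e; apply/loc_frac_eq; exists u => //.
by rewrite !mulNr !mulrN e.
Qed.

Let fracD a m (hm : loc_den m) b l (hl : loc_den l) :
  add (loc_frac a hm) (loc_frac b hl) = loc_frac (a * l + b * m) (loc_denM hm hl).
Proof.
rewrite /add; have [u hu] := repr_frac a hm; have [w hw] := repr_frac b hl.
set n' := num (repr (loc_frac b _)); set d' := den (repr (loc_frac b _)) => e'.
set n := num _; set d := den _ => e; apply/loc_frac_eq.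
exists (u * w); first exact: loc_denM.
transitivity (u * (n * m) * (w * d' * l) + w * (n' * l) * (u * d * m)).
  by ring.
by rewrite e e'; ring.
Qed.

Let fracM a m (hm : loc_den m) b l (hl : loc_den l) :
  mul (loc_frac a hm) (loc_frac b hl) = loc_frac (a * b) (loc_denM hm hl).
Proof.
rewrite /mul; have [u hu] := repr_frac a hm; have [w hw] := repr_frac b hl.
set n' := num (repr (loc_frac b _)); set d' := den (repr (loc_frac b _)) => e'.
set n := num _; set d := den _ => e; apply/loc_frac_eq.
exists (u * w); first exact: loc_denM.
transitivity (u * (n * m) * (w * (n' * l))); first by ring.
by rewrite e e'; ring.
Qed.

Let frac_eq a m (hm : loc_den m) b l (hl : loc_den l) :
  a * l = b * m -> loc_frac a hm = loc_frac b hl.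
Proof.
by move=> e; apply/loc_frac_eq; exists 1; [exact: loc_den1 | rewrite e].
Qed.

Let addA : associative add.
Proof.
by do 3!elim/loc_fracW => ? ? ?; rewrite !fracD; apply: frac_eq; ring.
Qed.
Let addC : commutative add.
Proof.
by do 2!elim/loc_fracW => ? ? ?; rewrite !fracD; apply: frac_eq; ring.
Qed.
Let add0 : left_id zero add.
Proof. by elim/loc_fracW => ? ? ?; rewrite !fracD; apply: frac_eq; ring. Qed.
Let addN : left_inverse zero opp add.
Proof.
by elim/loc_fracW => ? ? ?; rewrite fracN !fracD; apply: frac_eq; ring.
Qed.

HB.instance Definition _ :=
  GRing.isZmodule.Build localization addA addC add0 addN.

Let mulA : associative mul.
Proof.
by do 3!elim/loc_fracW => ? ? ?; rewrite !fracM; apply: frac_eq; ring.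
Qed.
Let mulC : commutative mul.
Proof.
by do 2!elim/loc_fracW => ? ? ?; rewrite !fracM; apply: frac_eq; ring.
Qed.
Let mul1 : left_id one mul.
Proof. by elim/loc_fracW => ? ? ?; rewrite !fracM; apply: frac_eq; ring. Qed.
Let mulDl : left_distributive mul add.
Proof.
by do 3!elim/loc_fracW => ? ? ?; rewrite !(fracM, fracD); apply: frac_eq; ring.
Qed.

HB.instance Definition _ :=
  GRing.Zmodule_isComPzRing.Build localization mulA mulC mul1 mulDl.

Definition loc_inj (x : R) : localization := loc_frac x loc_den1.

Let loc_inj_zmod : zmod_morphism loc_inj.
Proof.
move=> x y; transitivity (add (loc_inj x) (opp (loc_inj y))) => //.
by rewrite /loc_inj fracN fracD; apply: frac_eq; ring.
Qed.
Let loc_inj_monoid : monoid_morphism loc_inj.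
Proof.
split=> // x y; transitivity (mul (loc_inj x) (loc_inj y)) => //.
by rewrite /loc_inj fracM; apply: frac_eq; ring.
Qed.
HB.instance Definition _ :=
  GRing.isZmodMorphism.Build R localization loc_inj loc_inj_zmod.
HB.instance Definition _ :=
  GRing.isMonoidMorphism.Build R localization loc_inj loc_inj_monoid.

Lemma loc_injV x (hx : loc_den x) : loc_inj x * loc_frac 1 hx = 1.
Proof.
transitivity (mul (loc_inj x) (loc_frac 1 hx)) => //.
by rewrite /loc_inj fracM; apply: frac_eq; ring.
Qed.
End Localization.

Section TensFree.
Import monalg.
Context {B C : comNzRingType}.

Definition tens_free := malg (cmonom (B * C)%type) int.
HB.instance Definition _ := GRing.ComNzRing.on tens_free.

Definition tens_indet (b : B) (c : C) : tens_free := mkmalgU (ucm (b, c)) 1.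

End TensFree.

HB.lock Definition tens_sym {B C : comNzRingType} (b : B) (c : C) :
  @tens_free B C := tens_indet b c.

Section Tensor.
Context {k B C : comNzRingType}.
Variables (phi : {rmorphism k -> B}) (psi : {rmorphism k -> C}).

Inductive tens_rel : tens_free -> Prop :=
| TensDl b b' c : tens_rel (tens_sym (b + b') c - (tens_sym b c + tens_sym b' c))
| TensDr b c c' : tens_rel (tens_sym b (c + c') - (tens_sym b c + tens_sym b c'))
| TensZ z b c : tens_rel (tens_sym (phi z * b) c - tens_sym b (psi z * c))
| TensM b c b' c' :
    tens_rel (tens_sym (b * b') (c * c') - tens_sym b c * tens_sym b' c')
| Tens1 : tens_rel (tens_sym 1 1 - 1).

(* The tensor product of the commutative k-algebras B and C, as the polynomial
   ring over the integers in symbols (b, c) modulo k-bilinearity and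
   multiplicativity. *)
Definition tensor := quot_gen tens_rel.
HB.instance Definition _ := GRing.ComPzRing.on tensor.

Definition tens (b : B) (c : C) : tensor := quot_proj tens_rel (tens_sym b c).

End Tensor.

Section FreeModule.
Context {S M : nmodType}.
Variables (scal : S -> Prop) (act : S -> M -> M) (I : M -> Prop).

(* B is a basis of the module I, the scalars being the elements of S which
   satisfy scal, acting through act. *)
Definition is_basis (B : M -> Prop) : Prop :=
  [/\ forall b, B b -> I b,
      forall x, I x -> exists (s : seq M) (c : M -> S),
        [/\ {in s, forall b, B b}, forall b, scal (c b) &
            x = \sum_(b <- s) act (c b) b]
    & forall (s : seq M) (c : M -> S),
        uniq s -> {in s, forall b, B b} -> (forall b, scal (c b)) ->
        \sum_(b <- s) act (c b) b = 0 -> {in s, forall b, c b = 0}].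

Definition is_free : Prop := exists B : M -> Prop, is_basis B.

End FreeModule.

Local Notation "x %:F" := (tofrac x).

(* Multiplication by t^n identifies t^-n A / A with A / t^n A, the class of
   t^-n f corresponding to the class of f. This needs 0 < n: for n = 0 the
   library type {poly %/ 'X^n} is F_q[t]/(t). *)
Local Notation "''V[' k ]_ ( n , s )" := 'cV[{poly %/ ('X^n : {poly k})}]_s
  (at level 8, k at level 2, n at level 2).

(* The symmetric algebra of V is the polynomial ring in the F_q-basis of V
   formed by the t^j b_i for i < s and j < n; linform is the inclusion of V. *)
HB.lock Definition linform {k : finFieldType} {n s : nat} (v : 'V[k]_(n, s)) :
    {mpoly k[s * n]} :=
  \sum_(i < s) \sum_(j < n) (v i 0 : {poly k})`_j *: 'X_(mxvec_index i j).

Definition KV (k : finFieldType) (n s : nat) := {fraction {mpoly k[s * n]}}.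
HB.instance Definition _ (k : finFieldType) (n s : nat) :=
  GRing.Field.on (KV k n s).

HB.lock Definition KV_inv {k : finFieldType} {n s : nat} (v : 'V[k]_(n, s)) :
  KV k n s := (linform v)%:F^-1.

Section Rings.
Variables (k : finFieldType) (n : nat).

Local Notation An := {poly %/ ('X^n : {poly k})}.
Local Notation F := {fraction {poly k}}.

Section OneSpace.
Variable s : nat.
Local Notation V := 'cV[An]_s.
Local Notation KV := (KV k n s).

Definition amul (a : {poly k}) (v : V) : V := in_qpoly 'X^n a *: v.

Definition tors (nu : nat) : {set V} := [set v | amul 'X^nu v == 0].

Definition KV_const (c : k) : KV := (c%:MP)%:F.

Inductive RV_gen : KV -> Prop :=
| RVgenC c : RV_gen (KV_const c)
| RVgenV v : v != 0 -> RV_gen (KV_inv (v : V))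
| RVgenD x y : RV_gen x -> RV_gen y -> RV_gen (x + y)
| RVgenM x y : RV_gen x -> RV_gen y -> RV_gen (x * y).

Definition RV_pred : {pred KV} := fun x => `[< RV_gen x >].

Lemma RV_predP x : reflect (RV_gen x) (x \in RV_pred).
Proof. exact: asboolP. Qed.

Lemma KV_const_zmod : zmod_morphism KV_const.
Proof. by move=> x y; rewrite /KV_const mpolyCB rmorphB. Qed.
Lemma KV_const_monoid : monoid_morphism KV_const.
Proof.
by split=> [|x y]; rewrite /KV_const ?mpolyC1 ?rmorph1 // mpolyCM rmorphM.
Qed.
HB.instance Definition _ := GRing.isZmodMorphism.Build k KV KV_const KV_const_zmod.
HB.instance Definition _ :=
  GRing.isMonoidMorphism.Build k KV KV_const KV_const_monoid.

Lemma RV_subring : subring_closed RV_pred.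
Proof.
split=> [|x y /RV_predP hx /RV_predP hy|x y /RV_predP hx /RV_predP hy].
- by apply/RV_predP; rewrite -(rmorph1 KV_const); exact: RVgenC.
- apply/RV_predP; apply: RVgenD => //; rewrite -mulN1r.
  by rewrite -(rmorph1 KV_const) -rmorphN; apply: RVgenM => //; exact: RVgenC.
- by apply/RV_predP; exact: RVgenM.
Qed.
HB.instance Definition _ := GRing.isSubringClosed.Build KV RV_pred RV_subring.

Record RV := mkRV { RV_val : KV; _ : RV_val \in RV_pred }.
HB.instance Definition _ := [isSub for RV_val].
HB.instance Definition _ := [Choice of RV by <:].
HB.instance Definition _ := [SubChoice_isSubComNzRing of RV by <:].

Lemma RV_constP c : KV_const c \in RV_pred.
Proof. by apply/RV_predP; exact: RVgenC. Qed.
Definition RV_const (c : k) : RV := mkRV (RV_constP c).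

Lemma RV_invP v : KV_inv v \in RV_pred.
Proof.
apply/RV_predP; have [->|v0] := eqVneq v 0; last exact: RVgenV.
suff -> : KV_inv 0 = KV_const 0 by exact: RVgenC.
rewrite rmorph0 KV_inv.unlock linform.unlock big1 ?rmorph0 ?invr0 // => i _.
by rewrite big1 // => j _; rewrite mxE coef0 scale0r.
Qed.
(* 1/v in R_V; by the convention 1/0 = 0 it is 0 for v = 0. *)
Definition RV_inv (v : V) : RV := mkRV (RV_invP v).

Lemma RV_const_zmod : zmod_morphism RV_const.
Proof. by move=> x y; apply: val_inj; rewrite /= rmorphB. Qed.
Lemma RV_const_monoid : monoid_morphism RV_const.
Proof. by split=> [|x y]; apply: val_inj; rewrite /= ?rmorph1 ?rmorphM. Qed.
HB.instance Definition _ := GRing.isZmodMorphism.Build k RV RV_const RV_const_zmod.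
HB.instance Definition _ :=
  GRing.isMonoidMorphism.Build k RV RV_const RV_const_monoid.

Definition RV_homog (d : nat) (x : RV) : Prop :=
  exists c : d.-tuple V -> k,
    x = \sum_(w : d.-tuple V | all (fun v => v != 0) w)
          RV_const (c w) * \prod_(v <- w) RV_inv v.

Definition RVF := tensor (RV_const : {rmorphism k -> RV})
                         (@tofrac _ \o polyC : {rmorphism k -> F}).
HB.instance Definition _ := GRing.ComPzRing.on RVF.

Definition RVF_tens (x : RV) (a : F) : RVF := tens _ _ x a.

Definition Rn_rel (x : RVF) : Prop :=
  exists (alpha : k) (nu : nat) (v : V),
    let a := alpha *: 'X^nu in
    [/\ alpha != 0, (nu <= n)%N, v \notin tors nu &
        x = RVF_tens (RV_inv (amul a v)) a%:F
            - \sum_(v' in tors nu) RVF_tens (RV_inv (v - v')) 1].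

Definition Rn := quot_gen Rn_rel.
HB.instance Definition _ := GRing.ComPzRing.on Rn.

Definition Rn_cls : RVF -> Rn := quot_proj Rn_rel.

(* The structure map of the F-algebra Rn. *)
Definition Rn_scal (a : F) : Rn := Rn_cls (RVF_tens 1 a).

Definition Rn_inv (v : V) : Rn := Rn_cls (RVF_tens (RV_inv v) 1).

(* The elements of positive degree are the sums of images of r (x) a with r
   homogeneous of positive degree in R_V. *)
Definition Rn_plus (x : Rn) : Prop :=
  exists2 l : seq (RV * F),
    {in l, forall p, exists2 d, (0 < d)%N & RV_homog d p.1} &
    x = \sum_(p <- l) Rn_cls (RVF_tens p.1 p.2).

Definition RSn_inverted (x : Rn) : Prop := exists2 v : V, v != 0 & x = Rn_inv v.

Definition RSn := localization RSn_inverted.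
HB.instance Definition _ := GRing.ComPzRing.on RSn.

Definition RSn_inj : Rn -> RSn := loc_inj RSn_inverted.

End OneSpace.

(* The A-linear maps between the V's are the An-linear ones, as A acts through
   its quotient An. Since the F-algebra Rn r is generated by the Rn_inv v, at
   most one f satisfies this for a given i. *)
Definition is_tilde_pi (s r : nat) (i : {linear 'cV[An]_s -> 'cV[An]_r})
    (f : {rmorphism Rn r -> RSn s}) : Prop :=
  [/\ forall a, f (Rn_scal r a) = RSn_inj (Rn_scal s a),
      forall v', v' != 0 -> f (Rn_inv (i v')) = RSn_inj (Rn_inv v')
    & forall v, v \notin codom i -> f (Rn_inv v) = 0].

Section Level.
Variable r : nat.
Local Notation V := 'cV[An]_r.

Definition idealI (x : Rn r) : Prop :=
  Rn_plus x /\
  forall (s : nat) (i : {linear 'cV[An]_s -> V}),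
    (1 <= s < r)%N -> injective i ->
    exists2 f, is_tilde_pi i f & f x = 0.

Definition Xvec (j : 'I_r) : V := delta_mx j 0.

Definition Vprime (l : 'I_r) (w : V) : Prop :=
  exists2 u, u \in tors r n.-1 &
  exists c : 'I_r -> k, w = u + \sum_(j < r | (j < l)%N) amul (c j)%:P (Xvec j).

Definition Eset (l : 'I_r) (x : Rn r) : Prop :=
  exists2 w, Vprime l w & x = Rn_inv (Xvec l + w).

Definition Eprod (x : Rn r) : Prop :=
  exists2 e : 'I_r -> Rn r, forall l, Eset l (e l) & x = \prod_(l < r) e l.

Definition Ugrp : {set 'M[An]_r} :=
  [set g : 'M[An]_r | (g \in unitmx) &&
     [forall i : 'I_r, forall j : 'I_r, (j <= i)%N ==>
        ('X %| (g i j : {poly k}) - (i == j)%:R)]].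

Definition is_GL_act (g : 'M[An]_r) (f : {rmorphism Rn r -> Rn r}) : Prop :=
  (forall a, f (Rn_scal r a) = Rn_scal r a) /\
  (forall v, v != 0 -> f (Rn_inv v) = Rn_inv (g *m v)).

(* The F-algebra endomorphism given by is_GL_act, which determines it; it exists
   for every g in GL_r by GL_actP below, and the default value is not used. *)
Definition GL_act (g : 'M[An]_r) : {rmorphism Rn r -> Rn r} :=
  if pselect (exists f, is_GL_act g f) is left h then projT1 (cid h)
  else idfun.

Definition invU (x : Rn r) : Prop := forall g, g \in Ugrp -> GL_act g x = x.

(* F[U], its element sum_g c(g) g being represented by the function c on U. *)
Definition FU := {ffun {g | g \in Ugrp} -> F}.

Definition FU_act (c : FU) (x : Rn r) : Rn r :=
  \sum_g Rn_scal r (c g) * GL_act (val g) x.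

End Level.
End Rings.

Section QuotLift.
Context {R S : comPzRingType} (G : R -> Prop) (f : {rmorphism R -> S}).
Hypothesis fG : forall x, G x -> f x = 0.

Definition quot_lift (x : quot_gen G) : S := f (repr x).

Lemma quot_liftE x : quot_lift (quot_proj G x) = f x.
Proof.
have : quot_proj G (repr (quot_proj G x)) = quot_proj G x.
  by rewrite quot_proj.unlock reprK.
move=> /quot_proj_eq[s Gs].
move/(canRL (subrK _)); rewrite /quot_lift => ->.
rewrite rmorphD rmorph_sum big_seq big1 ?add0r // => p ps.
by rewrite rmorphM (fG (Gs _ ps)) mulr0.
Qed.

Lemma quot_lift_zmod : zmod_morphism quot_lift.
Proof.
move=> u v; elim/(@quot_projW R G): u => x; elim/(@quot_projW R G): v => y.
by rewrite -rmorphB !quot_liftE rmorphB.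
Qed.
Lemma quot_lift_monoid : monoid_morphism quot_lift.
Proof.
split; first by rewrite -(rmorph1 (quot_proj G)) quot_liftE rmorph1.
move=> u v; elim/(@quot_projW R G): u => x; elim/(@quot_projW R G): v => y.
by rewrite -rmorphM !quot_liftE rmorphM.
Qed.
HB.instance Definition _ :=
  GRing.isZmodMorphism.Build (quot_gen G) S quot_lift quot_lift_zmod.
HB.instance Definition _ :=
  GRing.isMonoidMorphism.Build (quot_gen G) S quot_lift quot_lift_monoid.

Lemma quot_lift_ex : exists h : {rmorphism quot_gen G -> S},
  forall x, h (quot_proj G x) = f x.
Proof. by exists quot_lift => x; exact: quot_liftE. Qed.
End QuotLift.

Section TensMap.
Import finmap monalg.
Context {k B C : comNzRingType}.
Variables (phi : {rmorphism k -> B}) (psi : {rmorphism k -> C}).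
Variable f : {rmorphism B -> B}.
Hypothesis f_phi : forall z, f (phi z) = phi z.

Let sym (p : (B * C)%type) : @tens_free B C := tens_sym (f p.1) p.2.

Let mon (m : cmonom (B * C)%type) : @tens_free B C :=
  \prod_(p <- finsupp m) sym p ^+ (m p).

Let monE (m : cmonom (B * C)%type) (d : {fset (B * C)%type}) :
  (finsupp m `<=` d)%fset -> mon m = \prod_(p <- d) sym p ^+ (m p).
Proof.
move=> le; rewrite /mon (big_fset_incl _ le) //.
by move=> p _; rewrite -cmE_neq0 negbK => /eqP->; rewrite expr0.
Qed.

Let mon_morph : mmorphism mon.
Proof.
split=> [m1 m2|]; last by rewrite /mon mdom1 big_seq_fset0.
rewrite (monE (d := (finsupp m1 `|` finsupp m2)%fset)) ?mdomD //.
rewrite (monE (fsubsetUl _ (finsupp m2))) (monE (fsubsetUr (finsupp m1) _)).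
by rewrite -big_split /=; apply: eq_bigr => p _; rewrite cmM exprD.
Qed.
HB.instance Definition _ := isMultiplicative.Build _ _ mon mon_morph.

Let free_map_ex : exists h : {rmorphism @tens_free B C -> @tens_free B C},
  forall b c, h (tens_sym b c) = tens_sym (f b) c.
Proof.
exists (mmap intr mon) => b c.
by rewrite /= !tens_sym.unlock mmapU mul1r /= /mon mdomU big_seq_fset1 cmUU expr1 /sym tens_sym.unlock.
Qed.

Lemma tens_map_ex : exists h : {rmorphism tensor phi psi -> tensor phi psi},
  forall b c, h (tens phi psi b c) = tens phi psi (f b) c.
Proof.
have [free_map free_mapE] := free_map_ex.
have [x rx|h hE] := @quot_lift_ex _ _ (tens_rel phi psi)
    (quot_proj (tens_rel phi psi) \o free_map : {rmorphism _ -> _}); last first.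
  by exists h => b c; rewrite hE [LHS]/= free_mapE.
transitivity (quot_proj (tens_rel phi psi) 0); last exact: rmorph0.
apply/quot_proj_eq; rewrite subr0; apply: ideal_gen_mem.
have [g gE] : {g : @tens_free B C -> @tens_free B C | g =1 free_map}.
  by exists free_map.
suff : tens_rel phi psi (g x) by rewrite gE.
have gB u v : g (u - v) = g u - g v by rewrite !gE rmorphB.
have gD u v : g (u + v) = g u + g v by rewrite !gE rmorphD.
have gM u v : g (u * v) = g u * g v by rewrite !gE rmorphM.
have g1 : g 1 = 1 by rewrite gE rmorph1.
have gS b c : g (tens_sym b c) = tens_sym (f b) c.
  by rewrite gE free_mapE.
case: rx => [b b' c|b c c'|z b c|b c b' c'|].
- by rewrite gB gD !gS rmorphD; exact: TensDl.
- by rewrite gB gD !gS; exact: TensDr.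
- by rewrite gB !gS rmorphM f_phi; exact: TensZ.
- by rewrite gB gM !gS rmorphM; exact: TensM.
- by rewrite gB g1 gS rmorph1; exact: Tens1.
Qed.
End TensMap.

Section FracMap.
Context {R S : idomainType} (f : {rmorphism R -> S}).
Hypothesis f_inj : injective f.

Let fracP (x : {fraction R}) : exists p : R * R, p.2 != 0 /\ x * p.2%:F = p.1%:F.
Proof.
elim/quotW: x => x; exists (frac x); split; first exact: denom_ratioP.
rewrite /tofrac; unlock FracField.tofrac.
rewrite -[LHS]FracField.pi_mul; apply/eqP; rewrite FracField.equivf_def.
rewrite /FracField.mulf !numden_Ratio ?oner_neq0 ?mulr1 ?denom_ratioP //.
by rewrite mulrC.
Qed.

Let nd x : {p : R * R | p.2 != 0 /\ x * p.2%:F = p.1%:F} := cid (fracP x).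
Let h x : {fraction S} := (f (projT1 (nd x)).1)%:F / (f (projT1 (nd x)).2)%:F.

Let f_neq0 d : d != 0 -> (f d)%:F != 0 :> {fraction S}.
Proof. by rewrite tofrac_eq0 -(rmorph0 f) (inj_eq f_inj). Qed.

Let hE x n d : d != 0 -> x * d%:F = n%:F -> h x = (f n)%:F / (f d)%:F.
Proof.
move=> d0 xd; rewrite /h; case: (nd x) => -[n' d'] /= [d'0 xd'].
apply/eqP; rewrite eqr_div ?f_neq0 // -!tofracM -!(rmorphM f) tofrac_eq (inj_eq f_inj).
by rewrite -tofrac_eq !tofracM -xd -xd' mulrAC.
Qed.

Let h_zmod : zmod_morphism h.
Proof.
move=> x y.
have [[a b] [/= b0 xb]] := fracP x; have [[c d] [/= d0 yd]] := fracP y.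
rewrite (hE b0 xb) (hE d0 yd) (@hE _ (a * d - c * b) (b * d)).
- rewrite -[in RHS]mulNr [RHS]addf_div ?f_neq0 // mulNr.
  by rewrite rmorphB !(rmorphM f) tofracB !tofracM.
- by rewrite mulf_neq0.
- by rewrite tofracB !tofracM -xb -yd; ring.
Qed.

Let h_monoid : monoid_morphism h.
Proof.
split=> [|x y].
  by rewrite (@hE _ 1 1) ?oner_neq0 ?rmorph1 ?mulr1 ?divr1.
have [[a b] [/= b0 xb]] := fracP x; have [[c d] [/= d0 yd]] := fracP y.
rewrite (hE b0 xb) (hE d0 yd) (@hE _ (a * c) (b * d)).
- by rewrite mulf_div !(rmorphM f) !tofracM.
- by rewrite mulf_neq0.
- by rewrite !tofracM -xb -yd; ring.
Qed.
HB.instance Definition _ :=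
  GRing.isZmodMorphism.Build {fraction R} {fraction S} h h_zmod.
HB.instance Definition _ :=
  GRing.isMonoidMorphism.Build {fraction R} {fraction S} h h_monoid.

Lemma frac_map_ex : exists g : {rmorphism {fraction R} -> {fraction S}},
  forall x, g x%:F = (f x)%:F.
Proof.
exists h => x; transitivity (h x%:F) => //.
by rewrite (@hE _ x 1) ?oner_neq0 ?rmorph1 ?mulr1 ?divr1.
Qed.
End FracMap.

Section GLAct.
Variables (k : finFieldType) (n : nat).
Hypothesis n_gt0 : (0 < n)%N.
Local Notation An := {poly %/ ('X^n : {poly k})}.

Section LinForm.
Variable s : nat.
Local Notation V := 'cV[An]_s.

Let linformD (v w : V) : linform (v + w) = linform v + linform w.
Proof.
rewrite !linform.unlock -big_split; apply: eq_bigr => i _ /=.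
by rewrite -big_split; apply: eq_bigr => j _ /=; rewrite mxE coefD scalerDl.
Qed.

Let scal (c : k) : V -> V := fun v => \col_i (c *: v i 0).

Let linformZ c (v : V) : linform (scal c v) = c *: linform v.
Proof.
rewrite !linform.unlock scaler_sumr; apply: eq_bigr => i _ /=.
by rewrite scaler_sumr; apply: eq_bigr => j _ /=; rewrite mxE coefZ scalerA.
Qed.

Let linform0 : linform (0 : V) = 0.
Proof. by apply: (addrI (linform (0 : V))); rewrite -linformD !addr0. Qed.

Let linform_sum (I : finType) (w : I -> V) :
  linform (\sum_i w i) = \sum_i linform (w i).
Proof. exact: (big_morph _ linformD linform0). Qed.

Let e (i : 'I_s) (j : 'I_n) : V := \col_i' ((i' == i)%:R * in_qpoly 'X^n 'X^j).

Let size_mk : size (mk_monic ('X^n : {poly k})) = n.+1.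
Proof. by rewrite /mk_monic size_polyXn ltnS n_gt0 monicXn /= size_polyXn. Qed.

Let eE i j i' (j' : nat) : (e i j i' 0 : {poly k})`_j' = ((i' == i) && (j' == j))%:R.
Proof.
rewrite mxE; case: eqP => _; last by rewrite mul0r andFb; exact: coef0.
rewrite mul1r andTb in_qpoly_small ?coefXn //.
by rewrite size_mk size_polyXn ltnS.
Qed.

Let linform_e i j : linform (e i j) = 'X_(mxvec_index i j).
Proof.
rewrite !linform.unlock (bigD1 i) //= (bigD1 j) //= eE !eqxx scale1r.
rewrite big1 ?addr0 => [|j' j'j]; last first.
  by rewrite eE eqxx /= (negPf (_ : (j' : nat) != j)) // scale0r.
rewrite big1 ?addr0 // => i' i'i; rewrite big1 // => j' _.
by rewrite eE (negPf i'i) scale0r.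
Qed.

Let eP (v : V) : v = \sum_(p : 'I_s * 'I_n) scal (v p.1 0 : {poly k})`_p.2 (e p.1 p.2).
Proof.
apply/colP => i; apply/npolyP => m; rewrite summxE.
rewrite poly_of_qpoly_sum coef_sum (bigID (fun p => p.1 == i)) /=.
rewrite [X in _ = _ + X]big1 ?addr0 => [|p pi]; last first.
  by rewrite mxE coefZ eE eq_sym (negPf pi) mulr0.
have [mn|nm] := ltnP m n; last first.
  rewrite nth_default ?big1 // => [p _|].
    by rewrite mxE coefZ eE (gtn_eqF (leq_trans (ltn_ord p.2) nm)) andbF mulr0.
  have : (size ((v i 0)%R : {poly k}) < n.+1)%N.
    exact: leq_trans (size_mk_monic _) (eq_leq size_mk).
  by rewrite ltnS => /leq_trans; apply.
rewrite (bigD1 (i, Ordinal mn)) //= mxE coefZ eE !eqxx mulr1.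
rewrite big1 ?addr0 // => -[i' j'] /= /andP[/eqP-> ne].
rewrite mxE coefZ eE eqxx /= (_ : m == j' = false) ?mulr0 //.
by apply: contraNF ne => /eqP mj; apply/eqP; congr (_, _); apply: val_inj.
Qed.

Variables (g g' : 'M[An]_s).
Hypothesis gg' : g' *m g = 1%:M.

Let gscal h c (v : V) : h *m scal c v = scal c (h *m v).
Proof.
apply/colP => i; rewrite !mxE scaler_sumr; apply: eq_bigr => j _.
by rewrite mxE scalerAr.
Qed.

Let vecof (l : 'I_(s * n)) : V :=
  \sum_(p : 'I_s * 'I_n | mxvec_index p.1 p.2 == l) e p.1 p.2.

Let vecofE i j : vecof (mxvec_index i j) = e i j.
Proof.
rewrite /vecof (big_pred1 (i, j)) // => -[i' j'] /=.
have [m mK _] := curry_mxvec_bij s n.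
apply/eqP/eqP => [eq|[-> ->] //].
have := congr1 m eq.
by rewrite -[mxvec_index i' j']/(uncurry (@mxvec_index s n) (i', j'))
  -[mxvec_index i j]/(uncurry (@mxvec_index s n) (i, j)) !mK.
Qed.

Let sub (h : 'M[An]_s) : {rmorphism {mpoly k[s * n]} -> {mpoly k[s * n]}} :=
  comp_mpoly [tuple linform (h *m vecof l) | l < s * n].

Let subC h c : sub h c%:MP = c%:MP.
Proof. exact: comp_mpolyC. Qed.

Let subE h v : sub h (linform v) = linform (h *m v).
Proof.
rewrite [in RHS](eP v) mulmx_sumr linform_sum.
rewrite {1}linform.unlock pair_big /= raddf_sum; apply: eq_bigr => -[i j] _ /=.
rewrite gscal linformZ comp_mpolyZ comp_mpolyXU -tnth_nth tnth_mktuple.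
by rewrite vecofE.
Qed.

Let mpoly_fix (f : {rmorphism {mpoly k[s * n]} -> {mpoly k[s * n]}}) :
  (forall c, f c%:MP = c%:MP) -> (forall l, f 'X_l = 'X_l) -> forall p, f p = p.
Proof.
move=> fC fX p; rewrite [p]mpolyE rmorph_sum; apply: eq_bigr => m _.
rewrite -mul_mpolyC rmorphM fC mpolyXE_id rmorph_prod; congr (_ * _).
by apply: eq_bigr => l _; rewrite rmorphXn fX.
Qed.

Let sub_inj : injective (sub g).
Proof.
apply: (can_inj (g := sub g')) => p.
apply: (mpoly_fix (f := sub g' \o sub g)) p => [c|l].
  by rewrite -[RHS](subC g') -[in RHS](subC g).
case/mxvec_indexP: l => i j; rewrite -(linform_e i j).
apply: (etrans (congr1 (sub g') (subE g _)) (etrans (subE g' _) _)).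
by rewrite mulmxA gg' mul1mx.
Qed.

Lemma KV_map_ex : exists h : {rmorphism KV k n s -> KV k n s},
  (forall c, h (KV_const n s c) = KV_const n s c) /\
  (forall v : V, h (KV_inv v) = KV_inv (g *m v)).
Proof.
have [h hE] := frac_map_ex sub_inj; exists h; split=> [c|v].
  by rewrite /KV_const hE subC.
by rewrite !KV_inv.unlock fmorphV hE subE.
Qed.

Lemma RV_map_ex : exists h : {rmorphism RV k n s -> RV k n s},
  (forall c, h (RV_const n s c) = RV_const n s c) /\
  (forall v : V, h (RV_inv v) = RV_inv (g *m v)).
Proof.
have [f [fC fV]] := KV_map_ex.
have fP x : f (RV_val x) \in @RV_pred k n s.
  case: x => x /= /RV_predP; elim=> {x} [c|v v0|x y _ hx _ hy|x y _ hx _ hy].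
  - by rewrite fC; exact: RV_constP.
  - by rewrite fV; exact: RV_invP.
  - by rewrite rmorphD; exact: rpredD.
  - by rewrite rmorphM; exact: rpredM.
pose h x := mkRV (fP x).
have h_zmod : zmod_morphism h.
  by move=> x y; apply: val_inj; rewrite /= rmorphB.
have h_monoid : monoid_morphism h.
  by split=> [|x y]; apply: val_inj; rewrite /= ?rmorph1 ?rmorphM.
pose hA := GRing.isZmodMorphism.Build _ _ h h_zmod.
pose hM := GRing.isMonoidMorphism.Build _ _ h h_monoid.
pose hR : {rmorphism RV k n s -> RV k n s} := HB.pack h hA hM.
exists hR; split=> [c|v]; apply: val_inj; [exact: fC | exact: fV].
Qed.

End LinForm.

Lemma GL_act_ex (r : nat) (g : 'M[An]_r) : g \in unitmx ->
  exists f : {rmorphism Rn k n r -> Rn k n r}, is_GL_act g f.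
Proof.
move=> gU; have [f [fC fV]] := RV_map_ex (mulVmx gU).
have [T TE] := tens_map_ex (@tofrac _ \o polyC) fC.
have [x rx|h hE] := @quot_lift_ex _ _ (@Rn_rel k n r)
    (quot_proj (@Rn_rel k n r) \o T : {rmorphism _ -> _}); last first.
  exists h; split=> [a|v v0]; rewrite /Rn_scal /Rn_inv /Rn_cls hE [LHS]/=.
    by rewrite TE rmorph1.
  by rewrite TE fV.
transitivity (quot_proj (@Rn_rel k n r) 0); last exact: rmorph0.
apply/quot_proj_eq; rewrite subr0; apply: ideal_gen_mem.
have gA a (v : 'cV[An]_r) : g *m amul a v = amul a (g *m v).
  by rewrite /amul scalemxAr.
have gtors nu (v : 'cV[An]_r) : (g *m v \in tors k n r nu) = (v \in tors k n r nu).
  rewrite !inE -gA; apply/eqP/eqP => [|->]; last exact: mulmx0.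
  by move=> /(congr1 (mulmx (invmx g))); rewrite mulKmx // mulmx0.
case: rx => alpha [nu [v [alpha0 nun vN ->]]].
exists alpha, nu, (g *m v); split; rewrite ?gtors //.
rewrite rmorphB rmorph_sum TE fV gA; congr (_ - _).
rewrite [RHS](reindex_inj (can_inj (mulKmx gU))) /=.
by apply: eq_big => [v'|v' _]; rewrite ?gtors // TE fV mulmxBr.
Qed.

Lemma GL_actP (r : nat) (g : 'M[An]_r) :
  g \in unitmx -> is_GL_act g (GL_act g).
Proof.
by move=> /GL_act_ex ex; rewrite /GL_act; case: pselect => // e; case: (cid e).
Qed.

End GLAct.

(* Main.v *)
(** Let [f_l] be the sum of the elements of [E_l]. Over [F], the ring [R_n] has
    the basis of all [prod_(l in S) f_l ^ a_l * e_l], for subsets [S] of the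
    indices, [a_l >= 0] and [e_l] in [E_l].

    Spanning: for distinct [v], [w] in the translate [X_l + V'_l], the product
    [1/v 1/w] is rewritten through [1/(v - w)], which lowers the level; a square
    [1/v^2] is rewritten through [f_l / v]; and the isogeny relation for [t] removes
    the vectors of [t V_n] from [t] times a product. So, modulo the span, [t] maps
    the products of degree [d] to combinations of such products with coefficients
    in [F_q]. The characteristic polynomial of a matrix over [F_q] does not vanish
    at [t], so these products lie in the span.

    Independence: [1/v] is sent to the Eisenstein series of weight one at [v] of a
    lattice of rank [s] over [F_q((1/tau))], [t] acting as [tau ^ M]. When the
    basis vectors of the lattice are powers of [tau] of widely separated
    valuations, distinct monomials have distinct leading exponents. Composing with
    [pi_i] for the embeddings [i] onto the coordinate subspaces [S], translated by
    [U], gives the same for the monomials supported in [S].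

    Hence [I_n] is spanned by the monomials with [S] the set of all indices. The
    group [U] fixes the [f_l] and permutes the products [e_1 ... e_r] simply
    transitively, so [R_n^U = F[f_1, ..., f_r]] and both freeness statements
    follow. *)

From HB Require Import structures.
Require Import Defs.
From mathcomp Require Import all_boot all_order all_algebra.
From mathcomp Require Import boolp mpoly ring zify.
From mathcomp Require monalg.

Set Implicit Arguments.
Unset Strict Implicit.
Unset Printing Implicit Defensive.

Import GRing.Theory.
Local Open Scope ring_scope.

Local Notation "x %:F" := (tofrac x).

(** * Truncated polynomials and the vectors of V_n *)

(** Truncating the Eisenstein series avoids completing the field k(tau). The truncated lattice is
    still a group, so the additive relations stay exact; the relations for the powers of t hold up
    to an error that tends to 0. A relation in R_n thus becomes a sequence tending to 0, which a
    leading term independent of the truncation contradicts.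

    Exponents alone do not separate monomials with the same S and a_l but different e_l. For the
    lattice translated by h in U, only the vector h X_l of X_l + V'_l reaches the leading exponent;
    h is therefore chosen according to the monomial to be detected.

    Summing over U describes an invariant only after multiplication by f_1 ... f_r, so this product
    must be shown not to be a zero divisor before the invariants are known. *)

Lemma dvdX_coef0 (k : fieldType) (p : {poly k}) : ('X %| p) = (p`_0 == 0).
Proof. by rewrite -['X]subr0 -polyC0 dvdp_XsubCl rootE horner_coef0. Qed.

Lemma ord_gt_eqF m (i j : 'I_m) : (j < i)%N -> (i == j) = false.
Proof. by move=> ji; rewrite -val_eqE gtn_eqF. Qed.

Section TruncatedPolynomials.
Variables (k : finFieldType) (n : nat).
Local Notation An := {poly %/ ('X^n : {poly k})}.
Local Notation inA := (in_qpoly ('X^n : {poly k})).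

Lemma in_qpoly_val (q : An) : inA (q : {poly k}) = q.
Proof. by apply: val_inj; apply: in_qpoly_small; exact: size_mk_monic. Qed.

Lemma scale_inA (c : k) (q : An) : c *: q = inA c%:P * q.
Proof. by rewrite -[in LHS](in_qpoly_val q) -linearZ /= -mul_polyC rmorphM /= in_qpoly_val. Qed.

(** The residue map of the local ring A/(t^n). Levels, the sets [Delta l] and membership in [U]
    depend on residues only. *)
Definition cst (q : An) : k := (q : {poly k})`_0.

Lemma cst_in (p : {poly k}) : cst (inA p) = p`_0.
Proof.
rewrite /cst /= mk_monic_Xn.
rewrite -(Pdiv.IdomainMonic.modpE (monicXn _ _)).
by rewrite [in RHS](divp_eq p 'X^(n.-1.+1)) coefD coefMXn add0r.
Qed.

Lemma cst_zmod : zmod_morphism cst.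
Proof. by move=> p q; rewrite /cst /= coefB. Qed.
Lemma cst_monoid : monoid_morphism cst.
Proof.
split; first by rewrite -(rmorph1 inA) cst_in coef1.
move=> p q; rewrite -(in_qpoly_val p) -(in_qpoly_val q) -rmorphM /= !cst_in.
by rewrite coef0M.
Qed.
HB.instance Definition _ := GRing.isZmodMorphism.Build An k cst cst_zmod.
HB.instance Definition _ := GRing.isMonoidMorphism.Build An k cst cst_monoid.

Hypothesis n_gt0 : (0 < n)%N.

Lemma mk_monic_Xn_gt0 : mk_monic ('X^n : {poly k}) = 'X^n.
Proof. by rewrite mk_monic_Xn prednK. Qed.

Lemma size_mk_monic_Xn : size (mk_monic ('X^n : {poly k})) = n.+1.
Proof. by rewrite mk_monic_Xn_gt0 size_polyXn. Qed.

Lemma size_An (q : An) : (size (q : {poly k}) <= n)%N.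
Proof. by rewrite -ltnS (leq_trans (size_mk_monic q)) // size_mk_monic_Xn. Qed.

Lemma in_qpolyE (p : {poly k}) : inA p = p %% 'X^n :> {poly k}.
Proof.
rewrite /= mk_monic_Xn_gt0; apply/esym.
exact: (Pdiv.IdomainMonic.modpE (monicXn _ _)).
Qed.

Lemma in_qpoly_eq0 (p : {poly k}) : (inA p == 0) = ('X^n %| p).
Proof. by rewrite -val_eqE [val _]in_qpolyE. Qed.

Lemma inA_small (p : {poly k}) : (size p <= n)%N -> inA p = p :> {poly k}.
Proof. by move=> sp; rewrite in_qpoly_small // size_mk_monic_Xn ltnS. Qed.

Lemma cst_unit (q : An) : cst q != 0 -> q \is a GRing.unit.
Proof.
suff H (p : {poly k}) : p`_0 != 0 -> coprimep (mk_monic ('X^n : {poly k})) p.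
  exact: H.
move=> p0; rewrite mk_monic_Xn_gt0 coprimep_expl //.
by rewrite coprimep_sym coprimepX rootE horner_coef0.
Qed.

Lemma torsion_divisible nu (q : An) : (nu <= n)%N ->
  inA 'X^(n - nu) * q = 0 -> exists q', q = inA 'X^nu * q'.
Proof.
move=> nun; rewrite -(in_qpoly_val q) -rmorphM => /eqP.
rewrite in_qpoly_eq0 -{1}(subnK nun) exprD dvdp_mul2l ?expf_neq0 ?polyX_eq0 //.
move=> /dvdpP[p ->]; exists (inA p); by rewrite mulrC rmorphM.
Qed.
End TruncatedPolynomials.

Section Vectors.
Variables (k : finFieldType) (n r : nat).
Local Notation An := {poly %/ ('X^n : {poly k})}.
Local Notation inA := (in_qpoly ('X^n : {poly k})).
Local Notation V := 'cV[An]_r.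
Hypothesis n_gt0 : (0 < n)%N.
Local Notation cst := (@cst k n).
Implicit Types (l : 'I_r) (v w u : V) (g h : 'M[An]_r).

Lemma amulA (a b : {poly k}) (v : V) : amul a (amul b v) = amul (a * b) v.
Proof. by rewrite /amul scalerA rmorphM. Qed.
Lemma amulDr (a : {poly k}) (v w : V) : amul a (v + w) = amul a v + amul a w.
Proof. by rewrite /amul scalerDr. Qed.
Lemma amulBr (a : {poly k}) (v w : V) : amul a (v - w) = amul a v - amul a w.
Proof. by rewrite /amul scalerBr. Qed.
Lemma amul1 (v : V) : amul 1 v = v.
Proof. by rewrite /amul rmorph1 scale1r. Qed.
Lemma amul0 (a : {poly k}) : amul a (0 : V) = 0.
Proof. by rewrite /amul scaler0. Qed.
Lemma amulKC (c : k) (v : V) : c != 0 -> amul c^-1%:P (amul c%:P v) = v.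
Proof. by move=> c0; rewrite amulA -polyCM mulVf // amul1. Qed.
Lemma cst_amul (a : {poly k}) (v : V) i : cst (amul a v i 0) = a`_0 * cst (v i 0).
Proof. by rewrite /amul mxE rmorphM /= cst_in. Qed.

Lemma amul_torsion nu (v : V) : (nu <= n)%N ->
  amul 'X^(n - nu) v = 0 -> exists u, v = amul 'X^nu u.
Proof.
move=> nun /colP v0.
have /fin_all_exists[u uE] i : exists q, v i 0 = inA 'X^nu * q.
  by apply: torsion_divisible => //; have := v0 i; rewrite !mxE.
by exists (\col_i u i); apply/colP => i; rewrite !mxE uE.
Qed.

Lemma amul_Xn nu (u : V) : (n <= nu)%N -> amul 'X^nu u = 0.
Proof.
move=> le; rewrite /amul (_ : inA _ = 0) ?scale0r //.
by apply/eqP; rewrite in_qpoly_eq0 // dvdp_exp2l.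
Qed.

(** Multiplication by t^n identifies V_n with (A/t^n)^r and V_(n-1) with t (A/t^n)^r, where all
    residues vanish. *)
Lemma cst_tors (v : V) : reflect (forall i, cst (v i 0) = 0) (v \in tors k n r n.-1).
Proof.
rewrite inE; apply: (iffP eqP) => [|v0].
  rewrite -subn1 => /(amul_torsion n_gt0)[u ->] i.
  by rewrite cst_amul coefX mul0r.
have /fin_all_exists[u uE] i : exists q, v i 0 = inA ('X * q).
  exists (v i 0 %/ 'X : {poly k}).
  rewrite mulrC divpK ?in_qpoly_val // dvdX_coef0.
  by apply/eqP/v0.
have -> : v = amul 'X (\col_i inA (u i)).
  by apply/colP => i; rewrite !mxE uE rmorphM.
by rewrite amulA -exprSr prednK // amul_Xn.
Qed.

(* The translate X_l + V'_l, so that E_l consists of the 1/v with v in Delta l. *)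
Definition Delta (l : 'I_r) : {set V} :=
  [set v : V | (cst (v l 0) == 1) && [forall i : 'I_r, (l < i)%N ==> (cst (v i 0) == 0)]].

Lemma DeltaP l v : reflect (cst (v l 0) = 1 /\ forall i : 'I_r, (l < i)%N -> cst (v i 0) = 0)
  (v \in Delta l).
Proof.
rewrite inE; apply: (iffP andP) => -[/eqP v1 H]; split; rewrite ?v1 //.
  by move=> i li; move/forallP/(_ i)/implyP/(_ li)/eqP: H.
by apply/forallP => i; apply/implyP => li; rewrite H.
Qed.

Lemma cst_Xvec (l i : 'I_r) : cst (Xvec k n l i 0) = (i == l)%:R.
Proof. by rewrite mxE eqxx andbT rmorph_nat. Qed.

Lemma VprimeP (l : 'I_r) (w : V) : Vprime l w <-> Xvec k n l + w \in Delta l.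
Proof.
split=> [[u /cst_tors u0 [c ->]]|/DeltaP[v1 v0]].
  have cE i : cst ((Xvec k n l + (u + \sum_(j < r | (j < l)%N) amul (c j)%:P (Xvec k n j))) i 0)
     = (i == l)%:R + if (i < l)%N then c i else 0.
    rewrite mxE rmorphD /= cst_Xvec mxE rmorphD /= u0 add0r summxE rmorph_sum /=; congr (_ + _).
    rewrite (eq_bigr (fun j => c j * (i == j)%:R)) => [|j _]; last first.
      by rewrite cst_amul coefC cst_Xvec.
    case: ifP => il; last first.
      rewrite big1 // => j jl; rewrite ord_gt_eqF ?mulr0 //.
      by rewrite (leq_trans jl) // leqNgt il.
    rewrite (bigD1 i) //= eqxx mulr1 big1 ?addr0 // => j /andP[_ /negPf].
    by rewrite eq_sym => ->; rewrite mulr0.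
  apply/DeltaP; split=> [|i li]; rewrite cE.
    by rewrite eqxx ltnn addr0.
  by rewrite ord_gt_eqF // ltnNge ltnW ?addr0.
(* The component of w along the X_j with j < l is read off the residues; what remains has zero
   residues. *)
pose s := \sum_(j < r | (j < l)%N) amul (cst (w j 0))%:P (Xvec k n j).
exists (w - s); last by exists (fun j => cst (w j 0)); rewrite subrK.
apply/cst_tors => i; rewrite mxE [(- s) i 0]mxE rmorphB /= summxE rmorph_sum /=.
rewrite (eq_bigr (fun j : 'I_r => cst (w j 0) * (i == j)%:R)) => [|j _]; last first.
  by rewrite cst_amul coefC cst_Xvec.
have [il|li] := ltnP i l.
  rewrite (bigD1 i) //= eqxx mulr1 big1 ?addr0 ?subrr // => j /andP[_ /negPf].
  by rewrite eq_sym => ->; rewrite mulr0.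
rewrite big1 ?subr0; last first.
  by move=> j jl; rewrite ord_gt_eqF ?mulr0 // (leq_trans jl).
move: li; rewrite leq_eqVlt => /orP[/eqP/val_inj li|li].
  move: v1; rewrite -li mxE rmorphD /= cst_Xvec eqxx.
  by rewrite -[RHS]addr0 => /addrI.
move: (v0 i li); rewrite mxE rmorphD /= cst_Xvec.
by rewrite ord_gt_eqF // add0r.
Qed.

(** The level: 0 on t V_n (an empty maximum), and l + 1 on the nonzero scalar multiples of the
    vectors of [Delta l]. It measures progress in the rewriting of products. *)
Definition lev (v : V) : nat := \max_(i < r | cst (v i 0) != 0) i.+1.

Lemma lev_le v m : (forall i : 'I_r, (m <= i)%N -> cst (v i 0) = 0) -> (lev v <= m)%N.
Proof.
move=> v0; apply/bigmax_leqP => i vi.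
by rewrite ltnNge; apply: contra vi => /v0->.
Qed.

Lemma lev0 v : lev v = 0%N -> forall i, cst (v i 0) = 0.
Proof.
move=> v0 i; apply/eqP/negPn/negP => vi.
by have := @leq_bigmax_cond _ (fun i => cst (v i 0) != 0) (fun i : 'I_r => i.+1) i vi;
  rewrite -/(lev v) v0.
Qed.

Lemma lev_Delta l v : v \in Delta l -> lev v = l.+1.
Proof.
move=> /DeltaP[v1 v0]; apply/eqP; rewrite eqn_leq lev_le //=.
by apply: (@leq_bigmax_cond _ _ (fun i : 'I_r => i.+1) l); rewrite v1 oner_neq0.
Qed.

(** The residues at l are both 1 and cancel; this is why passing to v - w lowers the level. *)
Lemma lev_subDelta l v w : v \in Delta l -> w \in Delta l -> (lev (v - w) <= l)%N.
Proof.
move=> /DeltaP[v1 v0] /DeltaP[w1 w0]; apply: lev_le => i.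
rewrite leq_eqVlt => /orP[/eqP/val_inj<-|li].
  by rewrite !mxE rmorphB /= v1 w1 subrr.
by rewrite !mxE rmorphB /= v0 // w0 // subrr.
Qed.

Lemma lev_normalize v : lev v != 0%N ->
  exists l c, [/\ c != 0, lev v = l.+1 & amul c%:P v \in Delta l].
Proof.
move=> v0; have [l vl E] : exists2 l : 'I_r, cst (v l 0) != 0 & lev v = l.+1.
  have card0 : (0 < #|[pred i | cst (v i ord0) != 0%R]|)%N.
    rewrite lt0n; apply: contra v0 => /eqP/card0_eq c0; apply/eqP.
    by apply: big_pred0 => i; have := c0 i.
  by have [l vl lmax] := eq_bigmax_cond (fun i : 'I_r => i.+1) card0; exists l.
exists l, (cst (v l 0))^-1; split; rewrite ?invr_neq0 //.
apply/DeltaP; split=> [|i li]; rewrite cst_amul coefC /= ?mulVf //.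
rewrite (_ : cst (v i 0) = 0) ?mulr0 //; apply/eqP/negPn/negP => vi.
have := @leq_bigmax_cond _ (fun i => cst (v i 0) != 0) (fun i : 'I_r => i.+1) i vi.
by rewrite -/(lev v) E ltnS leqNgt li.
Qed.

Lemma tors_div_X v : lev v = 0%N -> exists u, v = amul 'X u.
Proof.
move=> /lev0 /cst_tors; rewrite inE -subn1 => /eqP /(amul_torsion n_gt0).
by [].
Qed.

Lemma Delta_neq0 l v : v \in Delta l -> v != 0.
Proof.
move=> /DeltaP[v1 _]; apply/eqP => v0; move: v1.
by rewrite v0 mxE rmorph0 => /esym/eqP; rewrite oner_eq0.
Qed.

Lemma Xvec_Delta l : Xvec k n l \in Delta l.
Proof.
apply/DeltaP; split=> [|i li]; rewrite cst_Xvec ?eqxx //.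
by rewrite ord_gt_eqF.
Qed.

Definition mxcols (e : 'I_r -> V) : 'M[An]_r := \matrix_(i, j) e j i 0.

Lemma mxcols_Xvec e l : mxcols e *m Xvec k n l = e l.
Proof. by rewrite -colE; apply/colP => i; rewrite !mxE. Qed.

(** The g X_l are the columns of g, so elements of [U] correspond to families with one vector in
    each [Delta l]. Such a matrix is invertible because its residue matrix is unitriangular. *)
Lemma UgrpP (g : 'M[An]_r) : reflect (forall l, g *m Xvec k n l \in Delta l) (g \in Ugrp k n r).
Proof.
have cE i j : cst ((g *m Xvec k n j) i 0) = cst (g i j).
  by rewrite -colE mxE.
have dE i (j : 'I_r) : ('X %| (g i j : {poly k}) - (i == j)%:R) =
    (cst (g i j) == (i == j)%:R).
  by rewrite dvdX_coef0 coefB -polyC_natr coefC eqxx subr_eq0.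
rewrite inE; apply: (iffP andP) => [[_ /forallP H] l|H].
  apply/DeltaP; rewrite cE; split=> [|i li].
    by have /forallP/(_ l)/implyP/(_ (leqnn _)) := H l; rewrite dE eqxx => /eqP.
  have /forallP/(_ l)/implyP/(_ (ltnW li)) := H i; rewrite dE cE => /eqP->.
  by rewrite ord_gt_eqF.
have gE (i j : 'I_r) : (j <= i)%N -> cst (g i j) = (i == j)%:R.
  have /DeltaP[g1 g0] := H j; rewrite leq_eqVlt => /orP[/eqP/val_inj<-|ji].
    by rewrite eqxx -cE.
  by rewrite -cE g0 // ord_gt_eqF.
split; last first.
  apply/forallP => i; apply/forallP => j; apply/implyP => ji.
  by rewrite dE gE.
rewrite unitmxE; apply: cst_unit => //.
have -> : cst (\det g) = \det (map_mx cst g)^T by rewrite det_tr det_map_mx.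
rewrite det_trig; last first.
  apply/is_trig_mxP => i j ij; rewrite !mxE gE ?(ltnW ij) //.
  by rewrite ord_gt_eqF.
by rewrite big1 ?oner_neq0 // => i _; rewrite !mxE gE ?eqxx.
Qed.

Lemma Ugrp_unit g : g \in Ugrp k n r -> g \in unitmx.
Proof. by rewrite inE => /andP[]. Qed.

Lemma Ugrp_Delta g l v : g \in Ugrp k n r -> (g *m v \in Delta l) = (v \in Delta l).
Proof.
move=> gU; have ginj : injective (mulmx g : V -> V).
  exact: can_inj (mulKmx (Ugrp_unit gU)).
(* One inclusion is computed; equality follows since g is injective and the set is finite. *)
have gD : [set g *m v | v in Delta l] = Delta l.
  apply/eqP; rewrite eqEcard card_imset // leqnn andbT.
  apply/subsetP => _ /imsetP[u /DeltaP[u1 u0] ->].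
  have /UgrpP gU' := gU.
  have gE (i j : 'I_r) : (j <= i)%N -> cst (g i j) = (i == j)%:R.
    have /DeltaP[g1 g0] := gU' j; rewrite leq_eqVlt => /orP[/eqP/val_inj<-|ji].
      by rewrite eqxx -g1 -colE mxE.
    have := g0 _ ji; rewrite -colE mxE => ->.
    by rewrite ord_gt_eqF.
  have E (i : 'I_r) : (l <= i)%N -> cst ((g *m u) i 0) = (i == l)%:R.
    move=> li; rewrite mxE rmorph_sum (bigD1 l) //= rmorphM /= u1 mulr1 gE //.
    rewrite big1 ?addr0 // => j jl; rewrite rmorphM /=.
    have [lj|] := ltnP l j; first by rewrite u0 // mulr0.
    rewrite leq_eqVlt val_eqE (negPf jl) /= => jl'.
    by rewrite gE ?(ltnW (leq_trans jl' li)) // ord_gt_eqF ?mul0r // (leq_trans jl').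
  apply/DeltaP; split=> [|i li]; first by rewrite E ?eqxx.
  by rewrite E ?(ltnW li) // ord_gt_eqF.
by rewrite -{1}gD (mem_imset _ _ ginj).
Qed.

Lemma UgrpM g h : g \in Ugrp k n r -> h \in Ugrp k n r -> g *m h \in Ugrp k n r.
Proof.
by move=> gU /UgrpP hU; apply/UgrpP => l; rewrite -mulmxA Ugrp_Delta.
Qed.

Lemma mxcols_Ugrp e : (forall l, e l \in Delta l) -> mxcols e \in Ugrp k n r.
Proof. by move=> eD; apply/UgrpP => l; rewrite mxcols_Xvec. Qed.

Lemma mx_Xvec_inj (g h : 'M[An]_r) : (forall l, g *m Xvec k n l = h *m Xvec k n l) -> g = h.
Proof.
move=> gh; apply/matrixP => i j.
by have /colP/(_ i) := gh j; rewrite -!colE !mxE.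
Qed.

End Vectors.

(** * Universal property of the tensor product *)

Section TensorLift.
Import finmap monalg.
Context {B C : comNzRingType} {S : comNzRingType}.
Variable G : B * C -> S.

Let mon (m : cmonom (B * C)%type) : S := \prod_(p <- finsupp m) G p ^+ (m p).

Let monE (m : cmonom (B * C)%type) (d : {fset (B * C)%type}) :
  (finsupp m `<=` d)%fset -> mon m = \prod_(p <- d) G p ^+ (m p).
Proof.
move=> le; rewrite /mon (big_fset_incl _ le) // => p _.
by rewrite -cmE_neq0 negbK => /eqP->; rewrite expr0.
Qed.

Let mon_morph : mmorphism mon.
Proof.
split=> [m1 m2|]; last by rewrite /mon mdom1 big_seq_fset0.
rewrite (monE (d := (finsupp m1 `|` finsupp m2)%fset)) ?mdomD //.
rewrite (monE (fsubsetUl _ (finsupp m2))) (monE (fsubsetUr (finsupp m1) _)).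
by rewrite -big_split /=; apply: eq_bigr => p _; rewrite cmM exprD.
Qed.
HB.instance Definition _ := isMultiplicative.Build _ _ mon mon_morph.

Lemma tens_free_lift : exists h : {rmorphism @tens_free B C -> S},
  forall b c, h (tens_sym b c) = G (b, c).
Proof.
exists (mmap intr mon) => b c.
by rewrite /= !tens_sym.unlock mmapU mul1r /= /mon mdomU big_seq_fset1 cmUU expr1.
Qed.
End TensorLift.

Section TensorInduction.
Import finmap monalg.
Context {B C : comNzRingType}.

Lemma tens_free_ind (P : @tens_free B C -> Prop) :
  (forall b c, P (tens_sym b c)) -> P 0 -> P 1 ->
  (forall x y, P x -> P y -> P (x - y)) -> (forall x y, P x -> P y -> P (x * y)) ->
  forall x, P x.
Proof.
move=> PS P0 P1 PB PM.
have PD x y : P x -> P y -> P (x + y).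
  by move=> Px Py; rewrite -[y]opprK -[- y]sub0r; apply/PB/PB.
have PNeg x : P x -> P (- x) by rewrite -[- x]sub0r; exact: PB.
have PU (d : nat) : forall m : cmonom (B * C)%type, (mdeg m <= d)%N -> P (mkmalgU m 1).
  elim: d => [|d IH] m md.
    rewrite (_ : m = onecm _) //; apply: mdeg_eq0I; apply/eqP; by rewrite -leqn0.
  have [m1|m1] := eqVneq m (onecm _); first by rewrite m1.
  have [p pm] : exists p, p \in finsupp m.
    apply: contrapT => H; move/eqP: m1; apply; apply/eqP/cmP => p.
    rewrite cm1; apply/eqP; rewrite cmE_eq0; apply/negP => pm.
    by apply: H; exists p.
  have mE : m = mulcm (ucm p) (divcm m (ucm p)).
    apply/eqP/cmP => q; rewrite mulcmE divcmE ucmE.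
    case: eqP => [<-|_]; last by rewrite add0n subn0.
    by rewrite add1n subn1 prednK // lt0n cmE_neq0.
  have -> : mkmalgU m (1 : int) = mkmalgU (ucm p) 1 * mkmalgU (divcm m (ucm p)) 1.
    by rewrite malgM_def fgmulUU mulr1 {1}mE.
  apply: PM; last first.
    by apply: IH; move: md; rewrite {1}mE (mdegM (ucm p)) (mdegU p) add1n ltnS.
  by case: p {pm mE} => b c; have := PS b c; rewrite tens_sym.unlock.
have PN (m : cmonom (B * C)%type) (c : nat) : P (mkmalgU m c%:Z).
  elim: c => [|c IH]; first by rewrite monalgU0.
  by rewrite intS monalgUD; apply: PD; [exact: PU (leqnn _) | exact: IH].
have PZ (c : int) (m : cmonom (B * C)%type) : P (mkmalgU m c).
  case: c => c; first exact: PN.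
  by rewrite NegzE monalgUN; apply: PNeg; exact: PN.
have PS' (s : seq (cmonom (B * C)%type)) (c : cmonom (B * C)%type -> int) :
    P (\sum_(m <- s) mkmalgU m (c m)).
  elim: s => [|m s IH].
    rewrite big_nil.
    exact: P0.
  rewrite big_cons.
  apply: PD.
    exact: PZ.
  exact: IH.
move=> x; rewrite (monalgE (x : malg (cmonom (B * C)%type) int)).
exact: PS'.
Qed.
End TensorInduction.

Section TensorTheory.
Context {k B C : comNzRingType}.
Variables (phi : {rmorphism k -> B}) (psi : {rmorphism k -> C}).
Local Notation tens := (tens phi psi).

Let proj_rel x y : tens_rel phi psi (x - y) ->
  quot_proj (tens_rel phi psi) x = quot_proj (tens_rel phi psi) y.
Proof. by move=> h; apply/quot_proj_eq; exact: ideal_gen_mem. Qed.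

Lemma tensDl b b' c : tens (b + b') c = tens b c + tens b' c.
Proof. by rewrite /Defs.tens -rmorphD; apply: proj_rel; exact: TensDl. Qed.
Lemma tensDr b c c' : tens b (c + c') = tens b c + tens b c'.
Proof. by rewrite /Defs.tens -rmorphD; apply: proj_rel; exact: TensDr. Qed.
Lemma tensM b c b' c' : tens (b * b') (c * c') = tens b c * tens b' c'.
Proof. by rewrite /Defs.tens -rmorphM; apply: proj_rel; exact: TensM. Qed.
Lemma tens1 : tens 1 1 = 1.
Proof. by rewrite /Defs.tens -[1 in RHS](rmorph1 (quot_proj (tens_rel phi psi))); apply: proj_rel; exact: Tens1. Qed.
Lemma tensZ z b c : tens (phi z * b) c = tens b (psi z * c).
Proof. by apply: proj_rel; exact: TensZ. Qed.
Lemma tens_split b c : tens b c = tens b 1 * tens 1 c.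
Proof. by rewrite -tensM mulr1 mul1r. Qed.

Lemma tensor_ind (P : tensor phi psi -> Prop) :
  (forall b c, P (tens b c)) ->
  (forall x y, P x -> P y -> P (x - y)) -> (forall x y, P x -> P y -> P (x * y)) ->
  forall x, P x.
Proof.
move=> PS PB PM; have P1 : P 1 by rewrite -tens1.
have P0 : P 0 by rewrite -(subrr 1); exact: PB.
apply: quot_projW; apply: tens_free_ind => // [||x y Px Py|x y Px Py].
- by rewrite rmorph0.
- by rewrite rmorph1.
- by rewrite rmorphB; exact: PB.
- by rewrite rmorphM; exact: PM.
Qed.

Lemma tensor_lift (S : comNzRingType) (f : {rmorphism B -> S}) (g : {rmorphism C -> S}) :
  (forall z, f (phi z) = g (psi z)) ->
  exists h : {rmorphism tensor phi psi -> S}, forall b c, h (tens b c) = f b * g c.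
Proof.
move=> fg; have [h hE] := tens_free_lift (fun p => f p.1 * g p.2).
have [x|h' h'E] := @quot_lift_ex _ _ (tens_rel phi psi) h; last first.
  by exists h' => b c; rewrite h'E hE.
by case=> [b b' c|b c c'|z b c|b c b' c'|];
  rewrite rmorphB ?rmorphD ?rmorphM ?rmorph1 /= !hE /= ?rmorphD ?rmorphM ?rmorph1 ?fg; ring.
Qed.
End TensorTheory.

Section TensorMap.
Context {k B B' C : comNzRingType}.
Variables (phi : {rmorphism k -> B}) (phi' : {rmorphism k -> B'}) (psi : {rmorphism k -> C}).

Lemma tensor_map (f : {rmorphism B -> B'}) :
  (forall z, f (phi z) = phi' z) ->
  exists h : {rmorphism tensor phi psi -> tensor phi' psi},
    forall b c, h (tens phi psi b c) = tens phi' psi (f b) c.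
Proof.
move=> fphi.
have [h hE] := tens_free_lift (fun p : B * C => tens_sym (f p.1) p.2 : @tens_free B' C).
have [x rx|h' h'E] := @quot_lift_ex _ _ (tens_rel phi psi)
    (quot_proj (tens_rel phi' psi) \o h : {rmorphism _ -> _}); last first.
  by exists h' => b c; rewrite h'E [LHS]/= hE.
rewrite [LHS]/=.
have tE b c : quot_proj (tens_rel phi' psi) (h (tens_sym b c)) = tens phi' psi (f b) c.
  by rewrite hE.
case: rx => [b b' c|b c c'|z b c|b c b' c'|].
- by rewrite !(rmorphB, rmorphD) /= !tE rmorphD tensDl subrr.
- by rewrite !(rmorphB, rmorphD) /= !tE tensDr subrr.
- by rewrite !(rmorphB, rmorphD) /= !tE rmorphM fphi tensZ subrr.
- by rewrite !(rmorphB, rmorphM) /= !tE rmorphM tensM subrr.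
- by rewrite !(rmorphB, rmorph1) /= !tE rmorph1 tens1 subrr.
Qed.
End TensorMap.

(** * Evaluating inverses of linear forms at a place *)

Section Coordinates.
Variables (k : finFieldType) (n s : nat).
Local Notation An := {poly %/ ('X^n : {poly k})}.
Local Notation inA := (in_qpoly ('X^n : {poly k})).
Local Notation V := 'cV[An]_s.
Hypothesis n_gt0 : (0 < n)%N.
Implicit Types (v w : V) (x y : 'rV[k]_(s * n)) (c : k).

(** Coordinates in the k-basis t^j b_i whose elements are the variables of the symmetric algebra;
    they give access to linear algebra over k on V. *)
Definition flat (v : V) : 'rV[k]_(s * n) :=
  mxvec (\matrix_(i, j) (v i 0 : {poly k})`_j).
Definition unflat (x : 'rV[k]_(s * n)) : V :=
  \col_i inA (rVpoly (row i (vec_mx x))).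

Lemma flatK : cancel flat unflat.
Proof.
move=> v; apply/colP => i; rewrite mxE mxvecK.
rewrite (_ : row i _ = poly_rV (v i 0 : {poly k})); last first.
  by apply/rowP => j; rewrite !mxE.
by rewrite poly_rV_K ?size_An // in_qpoly_val.
Qed.

Lemma unflatK : cancel unflat flat.
Proof.
move=> x; apply: (canLR vec_mxK); apply/matrixP => i j; rewrite !mxE.
by rewrite inA_small ?size_poly // coef_rVpoly_ord !mxE.
Qed.

Lemma flatD v w : flat (v + w) = flat v + flat w.
Proof.
rewrite /flat -linearD; congr mxvec; apply/matrixP => i j.
by rewrite !mxE coefD.
Qed.
Lemma flat0 : flat 0 = 0.
Proof. by apply: (addrI (flat 0)); rewrite -flatD !addr0. Qed.
Lemma flatZ c v : flat (amul c%:P v) = c *: flat v.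
Proof.
rewrite /flat -linearZ; congr mxvec; apply/matrixP => i j.
by rewrite !mxE -scale_inA coefZ.
Qed.
Lemma unflatD x y : unflat (x + y) = unflat x + unflat y.
Proof. by apply: (can_inj flatK); rewrite flatD !unflatK. Qed.
Lemma unflatZ c x : unflat (c *: x) = amul c%:P (unflat x).
Proof. by apply: (can_inj flatK); rewrite flatZ !unflatK. Qed.
Lemma unflat0 : unflat 0 = 0.
Proof. by apply: (addrI (unflat 0)); rewrite -unflatD !addr0. Qed.

Lemma linform_flat v : linform v = \sum_l flat v 0 l *: 'X_l.
Proof.
rewrite linform.unlock (reindex _ (curry_mxvec_bij _ _)) /= pair_bigA /=.
by apply: eq_bigr => -[i j] _; rewrite mxvecE mxE.
Qed.

Lemma linform_eq0 v : (linform v == 0) = (v == 0).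
Proof.
apply/eqP/eqP => [|->]; last first.
  rewrite linform.unlock big1 // => i _; rewrite big1 // => j _.
  by rewrite mxE coef0 scale0r.
rewrite linform_flat => v0; rewrite -[v]flatK -[RHS]unflat0; congr unflat.
apply/rowP => l; rewrite mxE; have /(congr1 (mcoeff U_(l)%MM)) := v0.
rewrite mcoeff0 raddf_sum (bigD1 l) //= mcoeffZ mcoeffX eqxx mulr1 big1 ?addr0 // => l' ll'.
by rewrite mcoeffZ mcoeffX eq_mnm1 (negPf ll') mulr0.
Qed.

Lemma unflat_sum x : unflat x = \sum_l amul (x 0 l)%:P (unflat (delta_mx 0 l)).
Proof.
rewrite [in LHS](row_sum_delta x) (big_morph _ unflatD unflat0).
by apply: eq_bigr => l _; rewrite unflatZ.
Qed.
End Coordinates.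

Lemma coefM_top (R : nzRingType) (p q : {poly R}) d e :
  (size p <= d.+1)%N -> (size q <= e.+1)%N -> (p * q)`_(d + e) = p`_d * q`_e.
Proof.
move=> sp sq; have dlt : (d < (d + e).+1)%N by rewrite ltnS leq_addr.
rewrite coefM (bigD1 (Ordinal dlt)) //= addKn big1 ?addr0 // => j jd.
have [jltd|] := ltnP j d.
  rewrite [q`__]nth_default ?mulr0 //; apply: leq_trans sq _.
  by rewrite ltn_subRL ltn_add2r.
rewrite leq_eqVlt => /orP[/eqP dj|dj].
  by rewrite -val_eqE /= -dj eqxx in jd.
by rewrite nth_default ?mul0r // (leq_trans sp).
Qed.

Section Place.
Context {D : idomainType} {K : fieldType}.
Variable theta : {rmorphism D -> {poly K}}.

(* [place x y]: the quotient x = p/q is finite at infinity, with value y, after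
   applying theta to p and q. *)
Definition place (x : {fraction D}) (y : K) : Prop :=
  exists p q, [/\ theta q != 0, x * q%:F = p%:F, (size (theta p) <= size (theta q))%N
    & (theta p)`_(size (theta q)).-1 = y * lead_coef (theta q)].

Let size_theta q : theta q != 0 -> size (theta q) = (size (theta q)).-1.+1.
Proof. by move=> q0; rewrite prednK // lt0n size_poly_eq0. Qed.

(** Compare, in p q' = p' q, the coefficients of degree deg theta(q) + deg theta(q'). *)
Lemma place_uniq x y y' : place x y -> place x y' -> y = y'.
Proof.
move=> [p [q [q0 xq sp e]]] [p' [q' [q'0 xq' sp' e']]].
have /(congr1 theta) : p * q' = p' * q.
  by apply/eqP; rewrite -tofrac_eq !tofracM -xq -xq'; apply/eqP; ring.
rewrite !rmorphM => /(congr1 (fun u : {poly K} => u`_((size (theta q)).-1 + (size (theta q')).-1))).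
rewrite coefM_top -?size_theta // addnC coefM_top -?size_theta // e e' -!lead_coefE.
set a := lead_coef _; set b := lead_coef _ => E.
have ab : a * b != 0 by rewrite mulf_neq0 // lead_coef_eq0.
by apply: (mulIf ab); rewrite mulrA E; ring.
Qed.

Let size_q q q' : theta q != 0 -> theta q' != 0 ->
  (size (theta (q * q'))).-1 = ((size (theta q)).-1 + (size (theta q')).-1)%N.
Proof.
move=> q0 q'0; rewrite rmorphM size_mul // (size_theta q0) (size_theta q'0) /=.
by rewrite addnS.
Qed.

Let lead_q q q' : lead_coef (theta (q * q')) = lead_coef (theta q) * lead_coef (theta q').
Proof. by rewrite rmorphM lead_coefM. Qed.

Let leS q (m : nat) : theta q != 0 -> (m <= size (theta q))%N -> (m <= (size (theta q)).-1.+1)%N.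
Proof. by move=> q0; rewrite -size_theta. Qed.

Let size_pq p q' (d : nat) : theta q' != 0 -> (size (theta p) <= d.+1)%N ->
  (size (theta p * theta q')%R <= (d + (size (theta q')).-1).+1)%N.
Proof.
move=> q'0 sp; apply: leq_trans (size_polyMleq _ _) _.
by rewrite [X in (_ + X)%N](size_theta q'0) addnS /= -addSn leq_add2r.
Qed.

Lemma placeB x y x' y' : place x y -> place x' y' -> place (x - x') (y - y').
Proof.
move=> [p [q [q0 xq sp e]]] [p' [q' [q'0 xq' sp' e']]].
have qq0 : theta (q * q') != 0 by rewrite rmorphM mulf_neq0.
exists (p * q' - p' * q), (q * q'); split=> //.
- by rewrite tofracB !tofracM -xq -xq'; ring.
- rewrite [X in (_ <= X)%N]size_theta // size_q // rmorphB !rmorphM.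
  rewrite (leq_trans (size_polyD _ _)) // size_polyN geq_max.
  rewrite size_pq ?leS //= addnC; by rewrite size_pq ?leS.
rewrite size_q // lead_q rmorphB !rmorphM coefB.
rewrite coefM_top -?size_theta // addnC coefM_top -?size_theta // e e' -!lead_coefE.
by ring.
Qed.

Lemma placeM x y x' y' : place x y -> place x' y' -> place (x * x') (y * y').
Proof.
move=> [p [q [q0 xq sp e]]] [p' [q' [q'0 xq' sp' e']]].
have qq0 : theta (q * q') != 0 by rewrite rmorphM mulf_neq0.
exists (p * p'), (q * q'); split=> //.
- by rewrite !tofracM -xq -xq'; ring.
- rewrite [X in (_ <= X)%N]size_theta // size_q // rmorphM.
  apply: leq_trans (size_polyMleq _ _) _.
  rewrite (size_theta q0) in sp; rewrite (size_theta q'0) in sp'.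
  have := leq_add sp sp'; case: (_ + _)%N => //= m; by rewrite addnS addSn.
rewrite size_q // lead_q rmorphM.
rewrite coefM_top -?size_theta // e e'.
by ring.
Qed.

Lemma place1 : place 1 1.
Proof.
exists 1, 1; rewrite rmorph1 oner_neq0 mulr1 leqnn size_poly1 lead_coef1 coef1 mulr1.
by split.
Qed.

Lemma place0 : place 0 0.
Proof. by have := placeB place1 place1; rewrite !subrr. Qed.

Lemma place_fin p c : theta p = c%:P -> place p%:F c.
Proof.
move=> pc; exists p, 1; rewrite !rmorph1 oner_neq0 mulr1 lead_coef1 size_poly1 pc.
by split; rewrite ?mulr1 ?coefC ?size_polyC ?leq_b1.
Qed.

(** A linear form sent to a constant keeps its inverse; one sent to positive degree has a pole, and
    its inverse becomes 0. *)
Lemma place_inv q : theta q != 0 ->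
  place (q%:F^-1) (if size (theta q) == 1 then ((theta q)`_0)^-1 else 0).
Proof.
move=> q0; exists 1, q; split=> //.
- rewrite mulVf ?rmorph1 // tofrac_eq0; apply: contra q0 => /eqP->.
  by rewrite rmorph0.
- by rewrite rmorph1 size_poly1 lt0n size_poly_eq0.
rewrite rmorph1 coef1; case: (size (theta q) =P 1) => sq.
  rewrite lead_coefE sq /= mulVf //.
  by apply: contra q0 => /eqP q00; rewrite -lead_coef_eq0 lead_coefE sq q00.
rewrite mul0r; case: (size (theta q)) sq (size_theta q0) => [|[|m]] //=.
Qed.
End Place.

Section RVval.
Variables (k : finFieldType) (n s : nat).
Implicit Types x y : RV k n s.
Lemma RV_valB x y : RV_val (x - y) = RV_val x - RV_val y.
Proof. by []. Qed.
Lemma RV_valM x y : RV_val (x * y) = RV_val x * RV_val y.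
Proof. by []. Qed.
Lemma RV_val1 : RV_val (1 : RV k n s) = 1.
Proof. by []. Qed.
End RVval.

Section EvalRV.
Variables (k : finFieldType) (n s : nat) (K : fieldType).
Local Notation An := {poly %/ ('X^n : {poly k})}.
Local Notation V := 'cV[An]_s.
Hypothesis n_gt0 : (0 < n)%N.
Variables (kappa : {rmorphism k -> K}) (mu : V -> {poly K}).
Hypothesis muD : forall v w, mu (v + w) = mu v + mu w.
Hypothesis muZ : forall c v, mu (amul c%:P v) = (kappa c)%:P * mu v.
Hypothesis mu_neq0 : forall v, v != 0 -> mu v != 0.

Let mu0 : mu 0 = 0.
Proof. by apply: (addrI (mu 0)); rewrite -muD !addr0. Qed.

Lemma linform_lift : exists theta : {rmorphism {mpoly k[s * n]} -> {poly K}},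
  (forall c, theta c%:MP = (kappa c)%:P) /\ (forall v : V, theta (linform v) = mu v).
Proof.
pose h l := mu (unflat (delta_mx 0 l)).
pose theta : {rmorphism {mpoly k[s * n]} -> {poly K}} := mmap (polyC \o kappa) h.
have thetaC c : theta c%:MP = (kappa c)%:P by exact: mmapC.
exists theta; split=> // v.
rewrite linform_flat rmorph_sum -[in RHS](flatK n_gt0 v) unflat_sum //.
rewrite (big_morph _ muD mu0); apply: eq_bigr => l _.
by rewrite -mul_mpolyC rmorphM thetaC muZ [theta 'X_l]mmapX mmap1U.
Qed.

(** The generators 1/v are finite at infinity, hence so is all of R_V, even where [mu] has positive
    degree. Constant values of [mu] give evaluation at a point; values with a pole give the
    degenerations tilde pi. *)
Lemma RV_eval : exists h : {rmorphism RV k n s -> K},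
  (forall c, h (RV_const n s c) = kappa c) /\
  (forall v : V, h (RV_inv v) = if size (mu v) == 1 then ((mu v)`_0)^-1 else 0).
Proof.
have [theta [thetaC thetaV]] := linform_lift.
have placeC c : place theta (KV_const n s c) (kappa c).
  by apply: place_fin; rewrite thetaC.
have placeV (v : V) : v != 0 ->
    place theta (KV_inv v) (if size (mu v) == 1 then ((mu v)`_0)^-1 else 0).
  by move=> v0; rewrite KV_inv.unlock -thetaV; apply: place_inv; rewrite thetaV mu_neq0.
(* Finiteness passes to sums and products of generators; uniqueness of the value then makes the
   chosen values a homomorphism. *)
have placeP (x : RV k n s) : {y | place theta (RV_val x) y}.
  apply: cid; case: x => x /= /RV_predP.
  elim=> {x} [c|v v0|x y _ [a ha] _ [b hb]|x y _ [a ha] _ [b hb]].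
  - by exists (kappa c).
  - by exists (if size (mu v) == 1 then ((mu v)`_0)^-1 else 0); exact: placeV.
  - exists (a - (0 - b)); rewrite -[y]opprK -[- y]sub0r; apply: placeB => //.
    exact: placeB (place0 _) hb.
  - by exists (a * b); exact: placeM.
have [h hP] : exists h : RV k n s -> K, forall x, place theta (RV_val x) (h x).
  by exists (fun x => projT1 (placeP x)) => x; case: (placeP x).
have hE x y : place theta (RV_val x) y -> h x = y by exact: place_uniq.
have h_zmod : zmod_morphism h.
  by move=> x y; apply: hE; rewrite RV_valB; exact: placeB (hP x) (hP y).
have h_monoid : monoid_morphism h.
  split; first by apply: hE; rewrite RV_val1; exact: place1.
  by move=> x y; apply: hE; rewrite RV_valM; exact: placeM (hP x) (hP y).
pose hA := GRing.isZmodMorphism.Build _ _ h h_zmod.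
pose hM := GRing.isMonoidMorphism.Build _ _ h h_monoid.
pose hR : {rmorphism RV k n s -> K} := HB.pack h hA hM.
exists hR; split=> [c|v]; apply: hE; first exact: placeC.
have [->|] := eqVneq v 0; last exact: placeV.
rewrite mu0 size_poly0 /= KV_inv.unlock (_ : linform 0 = 0); last first.
  by apply/eqP; rewrite linform_eq0.
by rewrite rmorph0 invr0; exact: place0.
Qed.
End EvalRV.

(** * Relations in R_n *)

Section Span.
Context {F : fieldType} {R : comPzRingType} (scal : {rmorphism F -> R}).

Definition fspan {I : eqType} (b : I -> R) (ok : I -> Prop) (x : R) : Prop :=
  exists2 s : seq (F * I), {in s, forall p, ok p.2} &
    x = \sum_(p <- s) scal p.1 * b p.2.

Section OneFamily.
Context {I : eqType} {b : I -> R} {ok : I -> Prop}.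
Local Notation fspan := (fspan b ok).

Lemma fspan0 : fspan 0.
Proof. by exists [::]; rewrite ?big_nil. Qed.

Lemma fspanD x y : fspan x -> fspan y -> fspan (x + y).
Proof.
move=> [s Gs ->] [t Gt ->]; exists (s ++ t); rewrite ?big_cat //.
by move=> p; rewrite mem_cat => /orP[/Gs|/Gt].
Qed.

Lemma fspanZ a x : fspan x -> fspan (scal a * x).
Proof.
move=> [s Gs ->]; exists [seq (a * p.1, p.2) | p <- s].
  by move=> _ /mapP[p ps ->]; exact: Gs ps.
by rewrite big_map mulr_sumr; apply: eq_bigr => p _; rewrite mulrA rmorphM.
Qed.

Lemma fspan_mem i : ok i -> fspan (b i).
Proof.
move=> oki; exists [:: (1, i)]; last by rewrite big_seq1 rmorph1 mul1r.
by move=> p; rewrite inE => /eqP->.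
Qed.

Lemma fspan_sum (J : eqType) (s : seq J) (P : pred J) (f : J -> R) :
  (forall j, j \in s -> P j -> fspan (f j)) -> fspan (\sum_(j <- s | P j) f j).
Proof.
move=> H; rewrite big_seq_cond; apply: (big_ind fspan) => //.
- exact: fspan0.
- exact: fspanD.
by move=> j /andP[]; exact: H.
Qed.

Lemma sum_collect (l : seq (F * I)) (s : seq I) : uniq s -> {in l, forall p, p.2 \in s} ->
  \sum_(p <- l) scal p.1 * b p.2 = \sum_(i <- s) scal (\sum_(p <- l | p.2 == i) p.1) * b i.
Proof.
move=> us ls; under [RHS]eq_bigr => i _ do rewrite rmorph_sum mulr_suml.
rewrite [RHS](exchange_big_dep xpredT) //=; apply: eq_big_seq => p pl.
rewrite (eq_bigl (pred1 p.2)) => [|i]; last by rewrite /= eq_sym.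
by rewrite -big_filter filter_pred1_uniq ?big_seq1 ?ls.
Qed.

Lemma fspan_uniq x : fspan x -> exists (s : seq I) (c : I -> F),
  [/\ uniq s, {in s, forall i, ok i} & x = \sum_(i <- s) scal (c i) * b i].
Proof.
move=> [s Gs ->]; exists (undup [seq p.2 | p <- s]).
exists (fun i => \sum_(p <- s | p.2 == i) p.1); split; first exact: undup_uniq.
  by move=> i; rewrite mem_undup => /mapP[p ps ->]; exact: Gs.
by apply: sum_collect => [|p ps]; rewrite ?undup_uniq ?mem_undup ?map_f.
Qed.
End OneFamily.

Lemma fspan_trans {I J : eqType} {b : I -> R} {ok : I -> Prop} {b' : J -> R}
    {ok' : J -> Prop} x :
  (forall i, ok i -> fspan b' ok' (b i)) -> fspan b ok x -> fspan b' ok' x.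
Proof.
move=> H [s Gs ->]; apply: fspan_sum => p ps _; apply: fspanZ.
exact/H/Gs.
Qed.
End Span.

Lemma reciprocal_add (K : fieldType) (x y : K) : x != 0 -> y != 0 -> x + y != 0 ->
  x^-1 * y^-1 = (x + y)^-1 * (x^-1 + y^-1).
Proof. by move=> x0 y0 xy0; field; rewrite x0 y0 xy0. Qed.

Section RingRelations.
Variables (k : finFieldType) (n s : nat).
Local Notation An := {poly %/ ('X^n : {poly k})}.
Local Notation V := 'cV[An]_s.
Local Notation F := {fraction {poly k}}.
Hypothesis n_gt0 : (0 < n)%N.
Implicit Types (v w : V) (c : k) (a : F).
Local Notation rho := (@Rn_inv k n s).
Local Notation scal := (@Rn_scal k n s).
Local Notation Rn_cls := (@Rn_cls k n s).

Lemma linformD v w : linform (v + w) = linform v + linform w.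
Proof.
rewrite !linform_flat flatD -big_split; apply: eq_bigr => l _.
by rewrite !mxE scalerDl.
Qed.
Lemma linformZ c v : linform (amul c%:P v) = c *: linform v.
Proof.
rewrite !linform_flat flatZ // scaler_sumr; apply: eq_bigr => l _.
by rewrite !mxE scalerA.
Qed.

Lemma KV_inv_neq0 v : v != 0 -> (linform v)%:F != 0 :> KV k n s.
Proof. by rewrite tofrac_eq0 linform_eq0. Qed.

Lemma RV_invM v w : v != 0 -> w != 0 -> v + w != 0 ->
  RV_inv v * RV_inv w = RV_inv (v + w) * (RV_inv v + RV_inv w).
Proof.
move=> v0 w0 vw0; apply: val_inj => /=; rewrite !KV_inv.unlock.
rewrite linformD tofracD; apply: reciprocal_add; try exact: KV_inv_neq0.
by rewrite -tofracD -linformD; exact: KV_inv_neq0.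
Qed.

Lemma RV_inv0 : RV_inv (0 : V) = 0.
Proof.
apply: val_inj; rewrite /= KV_inv.unlock (_ : linform 0 = 0) ?rmorph0 ?invr0 //.
by apply/eqP; rewrite linform_eq0.
Qed.

Lemma RV_invZ c v : c != 0 -> RV_inv (amul c%:P v) = RV_const n s c^-1 * RV_inv v.
Proof.
move=> c0; apply: val_inj; rewrite /= !KV_inv.unlock linformZ -mul_mpolyC tofracM invfM.
congr (_ * _); rewrite -[RHS]/(KV_const n s c^-1) fmorphV; by [].
Qed.

HB.instance Definition _ := GRing.RMorphism.copy Rn_cls (quot_proj (@Rn_rel k n s)).

Lemma Rn_scal_zmod : zmod_morphism scal.
Proof.
move=> a b; rewrite /Rn_scal -rmorphB; congr Defs.Rn_cls.
rewrite /RVF_tens; apply: (canRL (addrK _)).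
by rewrite -tensDr subrK.
Qed.
Lemma Rn_scal_monoid : monoid_morphism scal.
Proof.
split=> [|a b]; rewrite /Rn_scal /RVF_tens.
  by rewrite tens1 rmorph1.
by rewrite -rmorphM -tensM mulr1.
Qed.
HB.instance Definition _ := GRing.isZmodMorphism.Build F (Rn k n s) scal Rn_scal_zmod.
HB.instance Definition _ := GRing.isMonoidMorphism.Build F (Rn k n s) scal Rn_scal_monoid.

Lemma Rn_cls_tens (x : RV k n s) a : Rn_cls (RVF_tens x a) = Rn_cls (RVF_tens x 1) * scal a.
Proof. by rewrite /Rn_scal -rmorphM /RVF_tens -tensM mulr1 mul1r. Qed.

Lemma RVF_tensM (x y : RV k n s) : RVF_tens (x * y) 1 = RVF_tens x 1 * RVF_tens y 1 :> RVF k n s.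
Proof. by rewrite /RVF_tens -tensM mulr1. Qed.
Lemma RVF_tensD (x y : RV k n s) : RVF_tens (x + y) 1 = RVF_tens x 1 + RVF_tens y 1 :> RVF k n s.
Proof. by rewrite /RVF_tens tensDl. Qed.
Lemma Rn_cls_const c : Rn_cls (RVF_tens (RV_const n s c) 1) = scal (c%:P)%:F.
Proof.
rewrite /Rn_scal /RVF_tens -[RV_const n s c]mulr1.
by rewrite (tensZ (RV_const n s : {rmorphism _ -> _})) mulr1.
Qed.

Lemma rhoM v w : v != 0 -> w != 0 -> v + w != 0 ->
  rho v * rho w = rho (v + w) * (rho v + rho w).
Proof.
move=> v0 w0 vw0; rewrite /Rn_inv -rmorphM -RVF_tensM RV_invM //.
by rewrite RVF_tensM RVF_tensD rmorphM rmorphD.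
Qed.

Lemma rho0 : rho 0 = 0.
Proof.
rewrite /Rn_inv RV_inv0 -[RHS](rmorph0 Rn_cls).
by congr Defs.Rn_cls; apply: (addrI (RVF_tens 0 1)); rewrite -RVF_tensD !addr0.
Qed.

Lemma mul_rho0 x : rho 0 * x = 0.
Proof. by rewrite rho0; exact: mul0r. Qed.

Lemma rhoZ c v : c != 0 -> rho (amul c%:P v) = scal (c^-1%:P)%:F * rho v.
Proof.
move=> c0; rewrite -Rn_cls_const /Rn_inv -rmorphM -RVF_tensM RV_invZ //.
Qed.

Lemma rhoB v w : v != 0 -> w != 0 -> v != w ->
  rho v * rho w = rho (v - w) * (rho w - rho v).
Proof.
move=> v0 w0 vw; have w0' : - w != 0 by rewrite oppr_eq0.
have rN : rho (- w) = - rho w.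
  have -> : - w = amul (-1)%:P w by rewrite /amul polyCN rmorphN rmorph1 scaleN1r.
  rewrite rhoZ ?oppr_eq0 ?oner_neq0 // invrN invr1 polyCN rmorphN rmorph1.
  by rewrite rmorphN rmorph1 mulN1r.
have vw0 : v - w != 0 by rewrite subr_eq0.
have := rhoM v0 w0' vw0; rewrite rN mulrN => /(congr1 -%R).
by rewrite opprK -mulrN opprB.
Qed.

(** The defining relation for a = t. It expresses t times the inverse of a vector of t V_n by
    inverses with coefficients in k, as [nakayama] requires. *)
Lemma rho_tX v : amul 'X v != 0 ->
  scal ('X)%:F * rho (amul 'X v) = \sum_(v' in tors k n s 1) rho (v - v').
Proof.
move=> v0; have : Rn_rel (RVF_tens (RV_inv (amul 'X v)) ('X)%:F
            - \sum_(v' in tors k n s 1) RVF_tens (RV_inv (v - v')) 1).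
  exists 1, 1%N, v; split; rewrite ?oner_neq0 ?scale1r ?expr1 ?inE //.
move=> /ideal_gen_mem /quot_proj_eq.
rewrite -[LHS]/(Rn_cls _) Rn_cls_tens mulrC => ->.
by rewrite rmorph_sum.
Qed.

Definition mono (l : seq V) : Rn k n s := \prod_(v <- l) rho v.

Lemma monoM l l' : mono l * mono l' = mono (l ++ l').
Proof. by rewrite /mono big_cat. Qed.

Lemma fspan_mono_mul (ok : seq V -> Prop) x y :
  (forall l l', ok l -> ok (l ++ l')) ->
  fspan scal mono ok x -> fspan scal mono (fun _ => True) y -> fspan scal mono ok (x * y).
Proof.
move=> okC [sx ox ->] [sy _ ->]; rewrite mulr_suml; apply: fspan_sum => p ps _.
rewrite mulr_sumr; apply: fspan_sum => q qs _.
rewrite mulrACA -rmorphM monoM; apply/fspanZ/fspan_mem/okC; exact: ox.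
Qed.

Lemma Rn_cls_surj (P : Rn k n s -> Prop) : (forall z, P (Rn_cls z)) -> forall x, P x.
Proof. exact: quot_projW. Qed.

Lemma RVF_ind (P : RVF k n s -> Prop) :
  (forall a, P (RVF_tens 1 a)) -> (forall v, v != 0 -> P (RVF_tens (RV_inv v) 1)) ->
  (forall x y, P x -> P y -> P (x + y)) -> (forall x y, P x -> P y -> P (x * y)) ->
  forall x, P x.
Proof.
move=> Pa Pv PD PM.
have PN u : P u -> P (- u).
  move=> Pu; have -> : - u = RVF_tens 1 (- 1) * u; last exact: PM (Pa _) Pu.
  rewrite (_ : RVF_tens 1 (- 1) = - 1) ?mulN1r //; apply: (addrI 1).
  by rewrite subrr -{1}(tens1 (RV_const n s : {rmorphism _ -> _})) -tensDr subrr;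
    apply: (addrI (RVF_tens 1 0)); rewrite /RVF_tens -tensDr !addr0.
apply: tensor_ind => [x a|x y Px Py|x y Px Py].
- rewrite tens_split; apply: (PM _ _ _ (Pa a)).
  case: x => x xP; have /RV_predP := xP.
  move=> H; elim: H xP => {x} [c|v v0|x y hx IHx hy IHy|x y hx IHx hy IHy] xP.
  + rewrite (_ : mkRV _ = RV_const n s c); last exact: val_inj.
    by rewrite -[RV_const n s c]mulr1 (tensZ (RV_const n s : {rmorphism _ -> _})); exact: Pa.
  + by rewrite (_ : mkRV _ = RV_inv v); [exact: Pv | exact: val_inj].
  + have hx' : x \in @RV_pred k n s by apply/RV_predP.
    have hy' : y \in @RV_pred k n s by apply/RV_predP.
    rewrite (_ : mkRV _ = mkRV hx' + mkRV hy'); last exact: val_inj.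
    by rewrite tensDl; apply: PD; [exact: IHx | exact: IHy].
  + have hx' : x \in @RV_pred k n s by apply/RV_predP.
    have hy' : y \in @RV_pred k n s by apply/RV_predP.
    rewrite (_ : mkRV _ = mkRV hx' * mkRV hy'); last exact: val_inj.
    by rewrite -[X in tens _ _ _ X](mulr1 1) tensM; apply: PM; [exact: IHx | exact: IHy].
- by apply: PD => //; exact: PN.
- exact: PM.
Qed.

Lemma Rn_ind (P : Rn k n s -> Prop) :
  (forall a, P (scal a)) -> (forall v, v != 0 -> P (rho v)) ->
  (forall x y, P x -> P y -> P (x + y)) -> (forall x y, P x -> P y -> P (x * y)) ->
  forall x, P x.
Proof.
move=> Pa Pv PD PM; apply: Rn_cls_surj; apply: RVF_ind => // x y Px Py.
  by rewrite rmorphD; apply: PD.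
by rewrite rmorphM; apply: PM.
Qed.

Lemma Rn_span x : fspan scal mono (fun _ => True) x.
Proof.
apply: Rn_ind x => [a|v _|x y|x y hx hy].
- have -> : scal a = scal a * mono [::] by rewrite /mono big_nil mulr1.
  exact/fspanZ/fspan_mem.
- have -> : rho v = mono [:: v] by rewrite /mono big_seq1.
  exact: fspan_mem.
- exact: fspanD.
- exact: fspan_mono_mul.
Qed.

Lemma Rn_plus_span x : Rn_plus x <-> fspan scal mono (fun l => l <> [::]) x.
Proof.
split=> [[l lP ->]|].
  apply: fspan_sum => -[y a] /lP[d d_gt0 [c /= ->]] _.
  rewrite Rn_cls_tens mulrC; apply: fspanZ.
  have tE (J : finType) (P : pred J) (f : J -> RV k n s) :
    RVF_tens (\sum_(j | P j) f j) 1 = \sum_(j | P j) RVF_tens (f j) 1 :> RVF k n s.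
    apply: (big_morph (fun x => RVF_tens x 1)) => [u v|]; first exact: RVF_tensD.
    by apply: (addrI (RVF_tens 0 1)); rewrite -RVF_tensD !addr0.
  rewrite tE rmorph_sum; apply: fspan_sum => w _ _.
  rewrite RVF_tensM rmorphM /= Rn_cls_const; apply: fspanZ.
  have -> : Rn_cls (RVF_tens (\prod_(v <- w) RV_inv v) 1) = mono w.
    rewrite /mono /Rn_inv; elim: (w : seq V) => [|v l' IH].
      by rewrite !big_nil /RVF_tens tens1 rmorph1.
    by rewrite !big_cons RVF_tensM rmorphM /= IH.
  by apply: fspan_mem => w0; move: d_gt0; rewrite -(size_tuple w) w0.
move=> [l lP ->].
have tE (w : seq V) : mono w = Rn_cls (RVF_tens (\prod_(v <- w) RV_inv v) 1).
  rewrite /mono /Rn_inv; elim: w => [|v l' IH].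
    by rewrite !big_nil /RVF_tens tens1 rmorph1.
  by rewrite !big_cons RVF_tensM rmorphM /= IH.
exists [seq (\prod_(v <- p.2) RV_inv v, p.1) | p <- l].
  move=> _ /mapP[[a w] pl ->] /=; exists (size w).
    by have := lP _ pl; case: (w).
  have [w0|/negP w0] := boolP (all (fun v => v != 0) w).
    exists (fun w' : (size w).-tuple V => (tval w' == w)%:R).
    rewrite (bigD1 (in_tuple w)) //= eqxx [RV_const n s 1]rmorph1 mul1r [X in _ + X]big1 ?addr0 // => w' /andP[_ ww'].
    rewrite (_ : (tval w' == w) = false) ?[RV_const n s 0]rmorph0 ?mul0r //.
    by apply: contraNF ww' => /eqP E; apply/eqP/val_inj.
  (* A word containing the zero vector is 0 by the convention 1/0 = 0, and is not among the words
     allowed in [RV_homog]. *)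
  exists (fun=> 0); rewrite [RHS]big1 => [|w' _]; last by rewrite [RV_const n s 0]rmorph0 mul0r.
  have /hasP[v vw /negPn/eqP v0] : has (fun v => ~~ (v != 0)) w by rewrite has_predC; apply/negP.
  by rewrite (big_rem v) //= v0 RV_inv0 mul0r.
rewrite big_map; apply: eq_bigr => p _.
by rewrite Rn_cls_tens -tE mulrC.
Qed.

Lemma Rn_plusM (x y : Rn k n s) : Rn_plus x -> Rn_plus (x * y).
Proof.
move=> /Rn_plus_span hx; apply/Rn_plus_span; apply: fspan_mono_mul hx (Rn_span y).
by case.
Qed.

Lemma mono_plus l : l <> [::] -> Rn_plus (mono l).
Proof. by move=> l0; apply/Rn_plus_span/fspan_mem. Qed.
End RingRelations.

(** * Degeneration along an injective A-linear map *)

Section PartialSpecialization.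
Variables (k : finFieldType) (n s r : nat).
Local Notation An := {poly %/ ('X^n : {poly k})}.
Hypothesis n_gt0 : (0 < n)%N.
Variable i : {linear 'cV[An]_s -> 'cV[An]_r}.
Hypothesis i_inj : injective i.

Let i_amul a v : i (amul a v) = amul a (i v).
Proof. by rewrite /amul linearZ. Qed.

Let M : 'M[k]_(s * n, r * n) := \matrix_l flat (i (unflat (delta_mx 0 l))).

Let flat_i w : flat (i w) = flat w *m M.
Proof.
rewrite -{1}[w](flatK n_gt0) unflat_sum // mulmx_sum_row.
rewrite raddf_sum (big_morph _ (@flatD _ _ _) (flat0 _ _ _)).
by apply: eq_bigr => l _; rewrite rowK -flatZ //; congr flat; exact: i_amul.
Qed.

(** A retraction of i, linear over k but in general not over A, given by a one-sided inverse of the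
    matrix of i. *)
Let proj (v : 'cV[An]_r) : 'cV[An]_s := unflat (flat v *m pinvmx M).

Let projK w : proj (i w) = w.
Proof.
rewrite /proj flat_i mulmxKp ?flatK //.
apply: inj_row_free => x xM; rewrite -[x](unflatK n_gt0).
rewrite (_ : unflat x = 0); last first.
  apply: i_inj; rewrite raddf0; apply: (can_inj (flatK n_gt0)).
  by rewrite flat_i unflatK // xM flat0.
by rewrite flat0.
Qed.

Let projD v w : proj (v + w) = proj v + proj w.
Proof. by rewrite /proj flatD mulmxDl unflatD. Qed.
Let projZ c v : proj (amul c%:P v) = amul c%:P (proj v).
Proof. by rewrite /proj flatZ // -scalemxAl unflatZ. Qed.

Let kap : {rmorphism k -> KV k n s} := @KV_const k n s.
(** The coordinates of the part of v off the image, taken as coefficients: a k-linear map into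
    polynomials that vanishes exactly on the image of i. *)
Let Q v : {poly KV k n s} := map_poly kap (rVpoly (flat (v - i (proj v)))).
(* Vectors outside the image of i are given a pole at infinity, which makes their
   inverses specialize to 0 there. *)
Let mu v : {poly KV k n s} := Q v * 'X + ((linform (proj v))%:F)%:P.

Let QD v w : Q (v + w) = Q v + Q w.
Proof.
have E : v + w - i (proj (v + w)) = (v - i (proj v)) + (w - i (proj w)).
  by rewrite projD raddfD opprD addrACA.
by rewrite /Q E [flat _ in LHS]flatD linearD rmorphD.
Qed.
Let QZ c v : Q (amul c%:P v) = (kap c)%:P * Q v.
Proof.
rewrite /Q projZ i_amul -amulBr flatZ // linearZ /= -mul_polyC rmorphM /=.
by rewrite map_polyC.
Qed.

Let Q_eq0 v : (Q v == 0) = (v \in codom i).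
Proof.
rewrite /Q map_poly_eq0; apply/eqP/codomP => [E|[w ->]]; last first.
  by rewrite projK subrr flat0 linear0.
exists (proj v); apply/eqP; rewrite -subr_eq0; apply/eqP.
apply: (can_inj (flatK n_gt0)); apply: (can_inj (@rVpolyK _ _)).
by rewrite E flat0 linear0.
Qed.

Let muD v w : mu (v + w) = mu v + mu w.
Proof.
rewrite /mu QD projD linformD rmorphD /= polyCD mulrDl.
by rewrite addrACA.
Qed.
Let muZ c v : mu (amul c%:P v) = (kap c)%:P * mu v.
Proof.
rewrite /mu QZ projZ linformZ // mulrDr -mulrA -mul_mpolyC rmorphM /=.
by rewrite polyCM.
Qed.

Let size_mu v : size (mu v) = if (v == 0) then 0%N else (size (Q v)).+1.
Proof.
rewrite /mu size_MXaddC Q_eq0; have [->|v0] := eqVneq v 0.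
  have -> : 0 \in codom i by apply/codomP; exists 0; rewrite raddf0.
  rewrite (_ : proj 0 = 0) ?tofrac_eq0 ?linform_eq0 ?eqxx //.
  by rewrite -[0 in LHS](raddf0 i) projK.
case: codomP => //= -[w vw]; rewrite vw projK tofrac_eq0 linform_eq0 // (_ : w == 0 = false) //.
by apply: contraNF v0 => /eqP w0; rewrite vw w0 raddf0.
Qed.

Let KV_spec : exists h : {rmorphism RV k n r -> KV k n s},
  [/\ forall c, h (RV_const n r c) = KV_const n s c,
      forall w, h (RV_inv (i w)) = KV_inv w
    & forall v, v \notin codom i -> h (RV_inv v) = 0].
Proof.
have mu0 v : v != 0 -> mu v != 0.
  by rewrite -size_poly_eq0 size_mu => /negPf->.
have [h [hC hV]] := RV_eval n_gt0 muD muZ mu0.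
exists h; split=> // [w|v vi]; rewrite hV size_mu; last first.
  by have [//|_] := eqVneq v 0; rewrite eqSS size_poly_eq0 Q_eq0 (negPf vi).
have [w0|w0] := eqVneq (i w) 0.
  have -> : w = 0 by apply: i_inj; rewrite raddf0.
  rewrite KV_inv.unlock (_ : linform 0 = 0) ?rmorph0 ?invr0 //.
  by apply/eqP; rewrite linform_eq0.
rewrite eqSS size_poly_eq0 Q_eq0 codom_f /mu coefD coefMX coefC eqxx add0r /=.
by rewrite projK KV_inv.unlock.
Qed.

Let RV_spec : exists h : {rmorphism RV k n r -> RV k n s},
  [/\ forall c, h (RV_const n r c) = RV_const n s c,
      forall w, h (RV_inv (i w)) = RV_inv w
    & forall v, v \notin codom i -> h (RV_inv v) = 0].
Proof.
have [f [fC fV fN]] := KV_spec.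
have fP (x : RV k n r) : f x \in @RV_pred k n s.
  case: x => x xP; have /RV_predP H := xP.
  elim: H xP => {x} [c|v v0|x y hx IHx hy IHy|x y hx IHx hy IHy] xP.
  - by rewrite (_ : mkRV _ = RV_const n r c) ?fC ?RV_constP //; exact: val_inj.
  - rewrite (_ : mkRV _ = RV_inv v); last exact: val_inj.
    have [/codomP[w ->]|vi] := boolP (v \in codom i); first by rewrite fV; exact: RV_invP.
    by rewrite fN // rpred0.
  - have hx' : x \in @RV_pred k n r by apply/RV_predP.
    have hy' : y \in @RV_pred k n r by apply/RV_predP.
    rewrite (_ : mkRV _ = mkRV hx' + mkRV hy'); last exact: val_inj.
    by rewrite rmorphD; apply: rpredD; [exact: IHx | exact: IHy].
  - have hx' : x \in @RV_pred k n r by apply/RV_predP.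
    have hy' : y \in @RV_pred k n r by apply/RV_predP.
    rewrite (_ : mkRV _ = mkRV hx' * mkRV hy'); last exact: val_inj.
    by rewrite rmorphM; apply: rpredM; [exact: IHx | exact: IHy].
pose h x := mkRV (fP x).
have h_zmod : zmod_morphism h.
  by move=> x y; apply: val_inj; rewrite /= rmorphB.
have h_monoid : monoid_morphism h.
  by split=> [|x y]; apply: val_inj; rewrite /= ?rmorph1 ?rmorphM.
pose hA := GRing.isZmodMorphism.Build _ _ h h_zmod.
pose hM := GRing.isMonoidMorphism.Build _ _ h h_monoid.
pose hR : {rmorphism RV k n r -> RV k n s} := HB.pack h hA hM.
exists hR; split=> [c|w|v vi]; apply: val_inj; [exact: fC | exact: fV | exact: fN].
Qed.

Lemma i_tors nu w : (i w \in tors k n r nu) = (w \in tors k n s nu).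
Proof. by rewrite !inE -i_amul -(raddf0 i) (inj_eq i_inj). Qed.

(** A defining relation at v goes to one of the same kind when v + V_nu meets the image of i, and to
    0 = 0 otherwise. *)
Lemma tilde_pi_Rn : exists f : {rmorphism Rn k n r -> Rn k n s},
  [/\ forall a, f (Rn_scal n r a) = Rn_scal n s a,
      forall w, f (Rn_inv (i w)) = Rn_inv w
    & forall v, v \notin codom i -> f (Rn_inv v) = 0].
Proof.
have [h [hC hV hN]] := RV_spec.
have iB w w' : i (w - w') = i w - i w' by exact: raddfB.
have [T TE] := @tensor_map _ _ _ _ (RV_const n r : {rmorphism _ -> _})
  (RV_const n s : {rmorphism _ -> _}) (@tofrac _ \o polyC : {rmorphism _ -> _}) h hC.
have TE' x a : T (RVF_tens x a) = RVF_tens (h x) a by exact: TE.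
have tens0 a : RVF_tens 0 a = 0 :> RVF k n s.
  by rewrite /RVF_tens; apply: (addrI (tens _ _ 0 a)); rewrite -tensDl !addr0.
have [x rx|f fE] := @quot_lift_ex _ _ (@Rn_rel k n r)
    (quot_proj (@Rn_rel k n s) \o T : {rmorphism _ -> _}); last first.
  exists f; split=> [a|w|v vi]; rewrite /Rn_scal /Rn_inv /Rn_cls fE [LHS]/= TE'.
  - by rewrite rmorph1.
  - by rewrite hV.
  - by rewrite hN // tens0 rmorph0.
case: rx => alpha [nu [v [alpha0 nun vN ->]]].
rewrite [LHS]/= rmorphB rmorph_sum /= TE'.
under eq_bigr => v' _ do rewrite TE'.
have av w : amul (alpha *: 'X^nu) w = amul alpha%:P (amul 'X^nu w) :> 'cV[An]_r.
  by rewrite amulA mul_polyC.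
have [[v0 v0t /codomP[u vu]]|H] := pselect (exists2 v0, v0 \in tors k n r nu & v - v0 \in codom i).
  have vE : v = i u + v0 by rewrite -vu subrK.
  have uN : u \notin tors k n s nu.
    apply: contra vN; rewrite -i_tors !inE vE amulDr => /eqP->.
    by move: v0t; rewrite inE add0r.
  rewrite (_ : amul _ v = i (amul (alpha *: 'X^nu) u)); last first.
    rewrite vE amulDr i_amul [X in _ + X]av.
    by move: v0t; rewrite inE => /eqP->; rewrite amul0 addr0.
  rewrite hV -[RHS](rmorph0 (quot_proj (@Rn_rel k n s))).
  apply/quot_proj_eq; rewrite subr0; apply: ideal_gen_mem.
  exists alpha, nu, u; split=> //; congr (_ - _).
  (* The shift by v0 turns v - v' into i u - w. Terms with w off the image vanish; the others are
     indexed by the torsion of V^s. *)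
  rewrite (reindex_inj (addIr v0)) /=.
  rewrite (eq_bigl (fun w => w \in tors k n r nu)) => [|w]; last first.
    by move: v0t; rewrite !inE amulDr => /eqP->; rewrite addr0.
  rewrite (bigID (mem (i @: tors k n s nu))) /= [X in _ + X]big1 ?addr0; last first.
    move=> w /andP[wt wi]; rewrite hN ?tens0 //.
    apply: contra wi => /codomP[u' E].
    have wE : w = i (u - u') by rewrite iB -E vE [w + v0]addrC addrKA subKr.
    by rewrite wE; apply: imset_f; rewrite -i_tors -wE.
  rewrite (eq_bigl (mem (i @: tors k n s nu))) => [|w]; last first.
    rewrite andb_idl // => /imsetP[u' u't ->]; by rewrite i_tors.
  rewrite big_imset /=; last by move=> ? ? _ _ /i_inj.
  apply: eq_bigr => u' _; rewrite -hV iB; congr (RVF_tens (h (RV_inv _)) _).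
  by rewrite vE opprD addrACA subrr addr0.
rewrite big1 ?subr0; last first.
  by move=> v' v't; rewrite hN ?tens0 //; apply/negP => vi; apply: H; exists v'.
(* If a v were i u0, then u0 would be killed by t^(n - nu), hence divisible by t^nu, and v would
   differ from a point of the image by torsion. *)
rewrite hN ?tens0 ?rmorph0 //; apply/negP => /codomP[u0 E]; apply: H.
have [u1 u1E] : exists u1, u0 = amul 'X^nu u1.
  apply: amul_torsion => //; apply: i_inj; rewrite raddf0 i_amul -E av.
  by rewrite amulA mulrC -amulA [amul 'X^(n - nu) _]amulA -exprD subnK // amul_Xn // amul0.
exists (v - i (amul alpha^-1%:P u1)); last by rewrite subKr codom_f.
rewrite inE amulBr -i_amul amulA mulrC -amulA -u1E i_amul -E av amulKC // subrr //.
Qed.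
End PartialSpecialization.

(** * Eisenstein series *)

Lemma fraction_quot (R : idomainType) (x : {fraction R}) :
  exists p q, q != 0 /\ x * q%:F = p%:F.
Proof.
elim/quotW: x => x; exists (frac x).1, (frac x).2; split; first exact: denom_ratioP.
rewrite /tofrac; unlock FracField.tofrac.
rewrite -[LHS]FracField.pi_mul; apply/eqP; rewrite FracField.equivf_def.
rewrite /FracField.mulf !numden_Ratio ?oner_neq0 ?mulr1 ?denom_ratioP //.
by rewrite mulrC.
Qed.

Section Residue.
Variable k : fieldType.
Local Notation L := {fraction {poly k}}.
Implicit Types (u : L) (y : k) (p : {poly k}).

(* u is regular at tau = infinity, with value y. *)
Definition res u y : Prop := place (idfun : {rmorphism {poly k} -> {poly k}}) u y.
Definition tau : L := 'X%:F.

Lemma resB u u' y y' : res u y -> res u' y' -> res (u - u') (y - y').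
Proof. exact: placeB. Qed.
Lemma resM u u' y y' : res u y -> res u' y' -> res (u * u') (y * y').
Proof. exact: placeM. Qed.
Lemma res0 : res 0 0. Proof. exact: place0. Qed.
Lemma res1 : res 1 1. Proof. exact: place1. Qed.
Lemma res_uniq u y y' : res u y -> res u y' -> y = y'.
Proof. exact: place_uniq. Qed.
Lemma resD u u' y y' : res u y -> res u' y' -> res (u + u') (y + y').
Proof.
move=> h h'; rewrite -[u']opprK -[y']opprK -[- u']sub0r -[- y']sub0r.
by apply: resB => //; apply: resB => //; exact: res0.
Qed.
Lemma res_sum (I : Type) (s : seq I) (P : pred I) (u : I -> L) (y : I -> k) :
  (forall i, P i -> res (u i) (y i)) -> res (\sum_(i <- s | P i) u i) (\sum_(i <- s | P i) y i).
Proof.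
move=> H; elim: s => [|i s IH]; first by rewrite !big_nil; exact: res0.
by rewrite !big_cons; case: ifP => // Pi; apply: resD => //; exact: H.
Qed.

Lemma res_sum0 (I : Type) (s : seq I) (P : pred I) (u : I -> L) :
  (forall i, P i -> res (u i) 0) -> res (\sum_(i <- s | P i) u i) 0.
Proof. by move=> /res_sum H; have := H s; rewrite big1_eq. Qed.

Lemma res_prod (I : Type) (s : seq I) (P : pred I) (u : I -> L) (y : I -> k) :
  (forall i, P i -> res (u i) (y i)) -> res (\prod_(i <- s | P i) u i) (\prod_(i <- s | P i) y i).
Proof.
move=> H; elim: s => [|i s IH]; first by rewrite !big_nil; exact: res1.
by rewrite !big_cons; case: ifP => // Pi; apply: resM => //; exact: H.
Qed.

Lemma resX u y d : res u y -> res (u ^+ d) (y ^+ d).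
Proof.
move=> h; elim: d => [|d IH]; first exact: res1.
by rewrite !exprS; exact: resM.
Qed.

Lemma tau_neq0 : tau != 0.
Proof. by rewrite tofrac_eq0 polyX_eq0. Qed.

Lemma res_tauV : res tau^-1 0.
Proof. by have := place_inv (theta := idfun) (negbT (polyX_eq0 k)); rewrite /= size_polyX. Qed.

Lemma res_tau_quot d p : p != 0 -> (d < size p)%N ->
  res (tau ^+ d / p%:F) (if d == (size p).-1 then (lead_coef p)^-1 else 0).
Proof.
move=> p0 dp; exists 'X^d, p; split => //=.
- by rewrite -tofracXn divfK // tofrac_eq0.
- by rewrite size_polyXn.
rewrite coefXn eq_sym; case: eqP; rewrite ?mul0r // mulVf //.
by rewrite lead_coef_eq0.
Qed.

Lemma res_shift u y d e : res (tau ^+ d * u) y -> (e < d)%N -> res (tau ^+ e * u) 0.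
Proof.
move=> h ed; have -> : tau ^+ e * u = (tau^-1) ^+ (d - e) * (tau ^+ d * u).
  rewrite mulrA; congr (_ * _); rewrite -{2}(subnK (ltnW ed)) exprD mulrA.
  by rewrite -exprMn mulVf ?tau_neq0 // expr1n mul1r.
rewrite -(mul0r y); apply: resM => //.
rewrite -[X in res _ X](_ : 0 ^+ (d - e) = 0).
  exact/resX/res_tauV.
by rewrite expr0n subn_eq0 leqNgt ed.
Qed.

(* Boundedness and convergence to 0 in k((1/tau)) are expressed inside k(tau), the
   infinite Eisenstein series being replaced by the sequences of their truncations. *)
Definition bounded (u : nat -> L) : Prop :=
  exists d, forall N, exists y, res (u N / tau ^+ d) y.
Definition null (u : nat -> L) : Prop :=
  forall d, exists N0, forall N, (N0 <= N)%N -> res (tau ^+ d * u N) 0.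

Lemma boundedB (u v : nat -> L) : bounded u -> bounded v -> bounded (fun N => u N - v N).
Proof.
move=> [d hd] [e he]; exists (d + e)%N => N.
have [y hy] := hd N; have [z hz] := he N.
have tr c : exists y, res ((tau ^+ c)^-1) y.
  by exists (0 ^+ c); rewrite -exprVn; apply/resX/res_tauV.
have [a ha] := tr e; have [b hb] := tr d.
exists (y * a - z * b).
rewrite mulrBl exprD invfM mulrA [(tau ^+ d)^-1 * _]mulrC [v N * _]mulrA.
by apply: resB; exact: resM.
Qed.

Lemma boundedM (u v : nat -> L) : bounded u -> bounded v -> bounded (fun N => u N * v N).
Proof.
move=> [d hd] [e he]; exists (d + e)%N => N.
have [y hy] := hd N; have [z hz] := he N; exists (y * z).
by rewrite exprD invfM mulrACA; exact: resM.
Qed.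

Lemma bounded_cst (c : L) : bounded (fun => c).
Proof.
have [p [q [q0 E]]] := fraction_quot c; exists (size p) => N.
have q0' : q%:F != 0 by rewrite tofrac_eq0.
set r := q * 'X^(size p); have r0 : r != 0 by rewrite mulf_neq0 ?expf_neq0 ?polyX_eq0.
exists (p`_(size r).-1 / lead_coef r); exists p, r; split=> //=.
- rewrite /r tofracM tofracXn -E; rewrite [X in _ * X]mulrC mulrA divfK ?expf_neq0 ?tau_neq0 //.
- by rewrite /r size_mulXn // leq_addr.
by rewrite divfK // lead_coef_eq0.
Qed.

Lemma nullD (u v : nat -> L) : null u -> null v -> null (fun N => u N + v N).
Proof.
move=> hu hv d; have [N1 h1] := hu d; have [N2 h2] := hv d.
exists (maxn N1 N2) => N; rewrite geq_max => /andP[l1 l2].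
by rewrite mulrDr -[0]addr0; apply: resD; [exact: h1 | exact: h2].
Qed.

Lemma null0 : null (fun => 0).
Proof. by move=> d; exists 0%N => N _; rewrite mulr0; exact: res0. Qed.

Lemma null_bounded (u v : nat -> L) : bounded u -> null v -> null (fun N => u N * v N).
Proof.
move=> [d hd] hv e; have [N0 h] := hv (e + d)%N; exists N0 => N NN.
have [y hy] := hd N; rewrite -(mulr0 y).
have -> : tau ^+ e * (u N * v N) = (u N / tau ^+ d) * (tau ^+ (e + d) * v N).
  have t0 : tau ^+ d != 0 by rewrite expf_neq0 // tau_neq0.
  rewrite exprD; rewrite [tau ^+ e * tau ^+ d]mulrC -!mulrA mulKf //.
  by rewrite mulrCA.
by apply: resM => //; exact: h.
Qed.
End Residue.

Section Lattice.
Variables (k : finFieldType) (s M : nat) (m : 'I_s -> nat).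
Hypotheses (m_inj : injective m) (m_lt : forall j, (m j < M)%N).
Implicit Types f g : 'I_s -> {poly k}.

(* The point of the lattice with basis the tau^(m j), where t acts as tau^M; the
   basis is linearly independent as the exponents m j are distinct modulo M. *)
Definition zpoly f : {poly k} := \sum_j (f j \Po 'X^M) * 'X^(m j).

Lemma zpoly_eq f g : f =1 g -> zpoly f = zpoly g.
Proof. by move=> fg; apply: eq_bigr => j _; rewrite fg. Qed.

Lemma zpolyD f g : zpoly (fun j => f j + g j) = zpoly f + zpoly g.
Proof. by rewrite /zpoly -big_split; apply: eq_bigr => j _; rewrite rmorphD mulrDl. Qed.
Lemma zpolyM c f : zpoly (fun j => c * f j) = (c \Po 'X^M) * zpoly f.
Proof. by rewrite /zpoly mulr_sumr; apply: eq_bigr => j _; rewrite rmorphM mulrA. Qed.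

(** The exponents M a + m j are pairwise distinct because the m j are distinct modulo M, so the
    coefficients of the f j do not mix. *)
Lemma coef_zpoly f j a : (zpoly f)`_(M * a + m j) = (f j)`_a.
Proof.
have M_gt0 : (0 < M)%N := leq_ltn_trans (leq0n _) (m_lt j).
rewrite coef_sum (bigD1 j) //= coefMXn ltnNge leq_addl /= addnK.
rewrite coef_comp_poly_Xn // dvdn_mulr //= mulKn // big1 ?addr0 // => j' jj'.
rewrite coefMXn; case: ltnP => // le; rewrite coef_comp_poly_Xn // ifF //.
apply: contraNF jj' => dv; apply/eqP/m_inj; have : (M * a + m j = m j' %[mod M])%N.
  by apply/eqP; rewrite eqn_mod_dvd.
by rewrite mulnC modnMDl !modn_small.
Qed.

Lemma size_zpoly_gt f j a : (f j)`_a != 0 -> (M * a + m j < size (zpoly f))%N.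
Proof. by rewrite -coef_zpoly ltnNge; apply: contra => /(nth_default 0)->. Qed.

Lemma zpoly_eq0 f : zpoly f = 0 -> forall j, f j = 0.
Proof. by move=> f0 j; apply/polyP => a; rewrite -coef_zpoly f0 !coef0. Qed.

Lemma size_zpoly_le f d : (forall j, (size (f j) <= d)%N) -> (size (zpoly f) <= M * d)%N.
Proof.
move=> sf; apply: leq_trans (size_sum _ _ _) _; apply/bigmax_leqP => j _.
have M_gt0 : (0 < M)%N := leq_ltn_trans (leq0n _) (m_lt j).
have [->|fj0] := eqVneq (f j) 0; first by rewrite comp_poly0 mul0r size_poly0.
have A0 : f j \Po 'X^M != 0 by rewrite comp_poly_eq0 ?size_polyXn.
rewrite size_mulXn // -(prednK (_ : 0 < size (f j \Po 'X^M))%N) ?size_poly_gt0 //.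
rewrite size_comp_poly size_polyXn /=; have := sf j.
rewrite -(prednK (_ : 0 < size (f j))%N) ?size_poly_gt0 //; move: (size _).-1 => e le.
apply: leq_trans (leq_mul (leqnn M) le).
by rewrite addnS -addSn [(M * _.+1)%N]mulnC mulSn leq_add2r.
Qed.
End Lattice.

Section Eisenstein.
Variables (k : finFieldType) (n s M N : nat) (m : 'I_s -> nat).
Hypotheses (n_gt0 : (0 < n)%N) (M_gt0 : (0 < M)%N).
Hypotheses (m_inj : injective m) (m_lt : forall j, (m j < M)%N).
Local Notation D := (n + N)%N.
Local Notation V := 'cV[{poly %/ ('X^n : {poly k})}]_s.
Local Notation W := 'cV[{poly %/ ('X^D : {poly k})}]_s.
Local Notation L := {fraction {poly k}}.
Local Notation tau := (tau k).
Implicit Types (v w : V) (p q : W) (f g : {poly k}).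

Let D_gt0 : (0 < D)%N. Proof. by rewrite addn_gt0 n_gt0. Qed.

(** [W] stands for the lattice points with coordinates of degree less than D = n + N; [lifting]
    picks in each class modulo t^n the point of degree less than n. *)
Definition reduction p : V := \col_j in_qpoly 'X^n (p j 0 : {poly k}).
Definition lifting v : W := \col_j in_qpoly 'X^D (v j 0 : {poly k}).
Definition zvec (d : nat) (p : 'cV[{poly %/ ('X^d : {poly k})}]_s) : {poly k} :=
  zpoly M m (fun j => (p j 0 : {poly k})).
(* The Eisenstein series at v, restricted to the lattice points with coordinates of
   degree less than n + N. It satisfies the additive relations exactly, and the
   isogeny relation up to the error eisen_err. *)
Definition eisen v : L := \sum_(p : W | reduction p == v) (zvec p)%:F^-1.

Lemma in_in_qpoly f :
  in_qpoly ('X^n : {poly k}) (in_qpoly ('X^D : {poly k}) f : {poly k}) = in_qpoly 'X^n f.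
Proof.
apply: val_inj; rewrite [val _]in_qpolyE // [val _]in_qpolyE // in_qpolyE //.
have dv : (f %/ 'X^D * 'X^D) %% 'X^n = 0.
  by apply/modp_eq0P; rewrite dvdp_mull // dvdp_exp2l // leq_addr.
by rewrite [in RHS](divp_eq f 'X^D) modpD dv add0r.
Qed.

Lemma reductionD p q : reduction (p + q) = reduction p + reduction q.
Proof. by apply/colP => j; rewrite !mxE -raddfD. Qed.
Lemma reduction0 : reduction 0 = 0.
Proof. by apply/colP => j; rewrite !mxE raddf0. Qed.
Lemma reduction_amul f p : reduction (amul f p) = amul f (reduction p).
Proof.
apply/colP => j; rewrite !mxE.
transitivity (in_qpoly 'X^n (f * (p j 0 : {poly k}))); last by rewrite in_qpolyM.
by rewrite -(in_in_qpoly (f * _)) in_qpolyM in_qpoly_val.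
Qed.
Lemma reduction_lifting v : reduction (lifting v) = v.
Proof. by apply/colP => j; rewrite !mxE in_in_qpoly in_qpoly_val. Qed.

Lemma zvecD p q : zvec (p + q) = zvec p + zvec q.
Proof. by rewrite /zvec -zpolyD; apply: zpoly_eq => j; rewrite mxE. Qed.
Lemma zvecZ c p : zvec (amul c%:P p) = c%:P * zvec p.
Proof.
rewrite /zvec -[c%:P in RHS](comp_polyC _ 'X^M) -zpolyM; apply: zpoly_eq => j.
by rewrite mxE -scale_inA // mul_polyC.
Qed.
Lemma zvec_neq0 d (p : 'cV[{poly %/ ('X^d : {poly k})}]_s) : p != 0 -> zvec p != 0.
Proof.
apply: contra => /eqP p0; apply/eqP/colP => j; rewrite mxE; apply: val_inj.
exact: (zpoly_eq0 m_inj m_lt p0).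
Qed.
Lemma zvec_lifting v : zvec (lifting v) = zvec v.
Proof.
apply: zpoly_eq => j; rewrite mxE inA_small //.
by rewrite (leq_trans (size_An n_gt0 _)) // leq_addr.
Qed.

Lemma reduction_neq0 p : reduction p != 0 -> (zvec p)%:F != 0 :> L.
Proof.
move=> p0; rewrite tofrac_eq0; apply: zvec_neq0; apply: contra p0 => /eqP->.
by rewrite reduction0.
Qed.

(** Such a point has a coordinate of degree at least n, since only [lifting v] has all coordinates
    of smaller degree in its class. *)
Lemma size_zvec_lift p v : reduction p = v -> p != lifting v -> (M * n < size (zvec p))%N.
Proof.
move=> pv ne.
have [j pj] : exists j, (p j 0 : {poly k}) != v j 0.
  apply: contrapT => H; move/eqP: ne; apply; apply/colP => j; rewrite mxE.
  have [<-|/eqP ne] := eqVneq (p j 0 : {poly k}) (v j 0); first by rewrite in_qpoly_val.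
  by case: H; exists j; apply/eqP.
have [a na pa] : exists2 a, (n <= a)%N & (p j 0 : {poly k})`_a != 0.
  apply: contrapT => H; move/eqP: pj; apply.
  have sp : (size (p j 0 : {poly k})%R <= n)%N.
    apply/leq_sizeP => a na; apply/eqP/negPn/negP => pa; apply: H.
    by exists a.
  by rewrite -pv mxE inA_small.
apply: leq_ltn_trans _ (size_zpoly_gt m_inj m_lt pa).
by rewrite (leq_trans _ (leq_addr _ _)) // leq_mul2l na orbT.
Qed.

(** The term at [lifting v] dominates: its denominator has degree less than M n, all the others at
    least M n. *)
Lemma eisen_lead v : v != 0 ->
  res (tau ^+ (size (zvec v)).-1 * eisen v) (lead_coef (zvec v))^-1.
Proof.
move=> v0; have zv0 : zvec v != 0 by exact: zvec_neq0.
rewrite mulr_sumr -[X in res _ X](_ : \sum_(p : W | reduction p == v)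
  (if p == lifting v then (lead_coef (zvec v))^-1 else 0) = _).
  apply: res_sum => p /eqP pv.
  have [->|ne] := eqVneq p (lifting v).
    rewrite zvec_lifting -[X in res _ X]/(if true then _ else (0 : k)).
    rewrite -(eqxx (size (zvec v)).-1); apply: res_tau_quot => //.
    by rewrite prednK // size_poly_gt0.
  have szp := size_zvec_lift pv ne.
  have le : (size (zvec v) <= M * n)%N.
    by apply: size_zpoly_le => // j; exact: size_An.
  have sv : (0 < size (zvec v))%N by rewrite size_poly_gt0.
  have := @res_tau_quot _ (size (zvec v)).-1 (zvec p); rewrite ifF; last first.
    apply/negP => /eqP E; have Es : size (zvec v) = size (zvec p).
      by rewrite -(prednK sv) E (ltn_predK szp).
    by rewrite ltnNge -Es le in szp.
  apply; first by rewrite -size_poly_gt0 (leq_trans _ szp).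
  by rewrite (leq_ltn_trans (leq_pred _)) // (leq_ltn_trans le).
rewrite (bigD1 (lifting v)) ?reduction_lifting //= eqxx big1 ?addr0 //.
by move=> p /andP[_ /negPf->].
Qed.

Lemma eisen_neq0 v : v != 0 -> eisen v != 0.
Proof.
move=> v0; apply/eqP => E; have := eisen_lead v0; rewrite E mulr0.
move=> /(res_uniq (res0 _))/esym/eqP; rewrite invr_eq0 lead_coef_eq0.
by apply/negP; exact: zvec_neq0.
Qed.

(** Sum 1/x 1/y = 1/(x + y) (1/x + 1/y) over pairs of points. As [W] is a group, p and p + q can
    serve as independent variables, so truncation does not disturb the identity. *)
Lemma eisenM v w : v != 0 -> w != 0 -> v + w != 0 ->
  eisen v * eisen w = eisen (v + w) * (eisen v + eisen w).
Proof.
move=> v0 w0 vw0; rewrite /eisen big_distrlr /=.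
have sumE (v1 w1 : V) : \sum_(p : W | reduction p == v1) \sum_(q : W | reduction q == w1)
    (zvec (p + q))%:F^-1 * (zvec p)%:F^-1 = eisen (v1 + w1) * eisen v1 :> L.
  rewrite [RHS]mulr_sumr; apply: eq_bigr => p /eqP pv; rewrite -mulr_suml; congr (_ * _).
  rewrite [RHS](reindex_inj (addrI p)) /=; apply: eq_bigl => q.
  by rewrite reductionD pv (inj_eq (addrI _)).
have sumE' : \sum_(p : W | reduction p == v) \sum_(q : W | reduction q == w)
    (zvec (p + q))%:F^-1 * (zvec q)%:F^-1 = eisen (v + w) * eisen w :> L.
  rewrite [v + w]addrC -sumE exchange_big; apply: eq_bigr => p _; apply: eq_bigr => q _.
  by rewrite addrC.
rewrite mulrDr -[X in _ = X + _]sumE -[X in _ = _ + X]sumE' -big_split; apply: eq_bigr => p /eqP pv.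
rewrite -big_split; apply: eq_bigr => q /eqP qw /=.
rewrite zvecD tofracD -mulrDr.
apply: reciprocal_add; rewrite -?tofracD -?zvecD; apply: reduction_neq0;
  by rewrite ?reductionD ?pv ?qw.
Qed.

Lemma eisenZ c v : c != 0 -> eisen (amul c%:P v) = (c%:P%:F)^-1 * eisen v.
Proof.
move=> c0; rewrite mulr_sumr.
have inj : injective (amul c%:P : W -> W) by apply: can_inj => p; exact: amulKC.
have inj' : injective (amul c%:P : V -> V) by apply: can_inj => p; exact: amulKC.
rewrite /eisen (reindex_inj inj) /=; apply: eq_big => [p|p _].
  by rewrite reduction_amul (inj_eq inj').
by rewrite zvecZ tofracM invfM.
Qed.

Lemma eisenN v : eisen (- v) = - eisen v.
Proof.
have -> : - v = amul (-1)%:P v by rewrite /amul polyCN rmorphN rmorph1 scaleN1r.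
by rewrite eisenZ ?oppr_eq0 ?oner_neq0 // polyCN polyC1 rmorphN rmorph1 invrN1 mulN1r.
Qed.

(** The sum over those p with t^nu p in the class of t^nu v for which t^nu p is cut off modulo t^D,
    that is, with a coordinate of degree at least D - nu. *)
Definition eisen_err nu v : L := \sum_(p : W | (v - reduction p \in tors k n s nu) &&
   ((\col_j in_qpoly 'X^D ((amul 'X^nu p j 0 : {poly k}) %/ 'X^nu)) != p))
  ((zvec p)%:F^-1 : L).

(** Multiplication by t^nu maps the points of the left side of degree less than D - nu bijectively
    onto the class of t^nu v, whose points are divisible by t^nu since nu <= n. It multiplies [zvec]
    by tau^(M nu). *)
Lemma eisen_isogeny nu v : (nu <= n)%N ->
  \sum_(v' in tors k n s nu) eisen (v - v') =
  ('X^nu \Po 'X^M)%:F * eisen (amul 'X^nu v) + eisen_err nu v.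
Proof.
move=> nun.
have -> : \sum_(v' in tors k n s nu) eisen (v - v') =
    \sum_(p : W | v - reduction p \in tors k n s nu) (zvec p)%:F^-1.
  rewrite (partition_big (fun p => v - reduction p) (mem (tors k n s nu))) //=.
  apply: eq_bigr => v' v't; apply: eq_bigl => p.
  have -> : (reduction p == v - v') = (v - reduction p == v').
    by rewrite eq_sym !subr_eq addrC.
  by case: eqP => [->|]; rewrite ?v't ?andbF.
rewrite /eisen_err (bigID (fun p => (\col_j in_qpoly 'X^D ((amul 'X^nu p j 0 : {poly k}) %/ 'X^nu)) == p)) /=.
congr (_ + _); rewrite [in RHS]/eisen mulr_sumr.
pose h' (p : W) : W := \col_j in_qpoly 'X^D ((p j 0 : {poly k}) %/ 'X^nu).
have divnu p j : reduction p == amul 'X^nu v -> 'X^nu %| (p j 0 : {poly k}).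
  move=> /eqP/colP/(_ j); rewrite !mxE -[v j 0]in_qpoly_val -in_qpolyM => /eqP.
  rewrite -subr_eq0 -raddfB in_qpoly_eq0 // => dv.
  rewrite -(dvdp_subl _ (dvdp_mulr (v j 0 : {poly k}) (dvdpp 'X^nu))).
  by apply: dvdp_trans dv; rewrite dvdp_exp2l.
rewrite [RHS](reindex_onto (amul 'X^nu) h') => [|p pv]; last first.
  apply/colP => j; rewrite !mxE -in_qpolyM mulrC divpK ?in_qpoly_val //.
  exact: divnu.
apply: eq_big => [p|p /andP[pv /eqP hp]].
  rewrite reduction_amul; congr (_ && _); rewrite inE amulBr subr_eq0 eq_sym.
  by [].
have pE j : (p j 0 : {poly k}) = (amul 'X^nu p j 0 : {poly k}) %/ 'X^nu.
  rewrite -{1}hp mxE inA_small //; apply: leq_trans (leq_divp _ _) _.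
  exact: size_An.
have tE : zvec (amul 'X^nu p) = ('X^nu \Po 'X^M) * zvec p.
  rewrite /zvec -zpolyM; apply: zpoly_eq => j.
  have := divnu (amul 'X^nu p) j; rewrite reduction_amul.
  have -> : amul 'X^nu (reduction p) == amul 'X^nu v.
    by move: pv; rewrite inE amulBr subr_eq0 eq_sym.
  by move=> /(_ isT) dv; rewrite [X in _ * X]pE mulrC divpK.
rewrite tE tofracM invfM mulVKf // tofrac_eq0 comp_poly_eq0 ?size_polyXn //.
by rewrite expf_neq0 ?polyX_eq0.
Qed.

(** A point of the error has a coordinate of degree at least D - nu >= N, so its [zvec] has degree
    at least M N. *)
Lemma res_eisen_err nu v d : (nu <= n)%N -> (d < M * N)%N -> res (tau ^+ d * eisen_err nu v) 0.
Proof.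
move=> nun dM; rewrite mulr_sumr.
apply: res_sum0 => p /andP[_ hp].
have [j [a Na pa]] : exists j, exists2 a, (N <= a)%N & (p j 0 : {poly k})`_a != 0.
  apply: contrapT => H; move/eqP: hp; apply; apply/colP => j; rewrite !mxE.
  have sp : (size (p j 0 : {poly k})%R <= N)%N.
    apply/leq_sizeP => a na; apply/eqP/negPn/negP => pa; apply: H.
    by exists j, a.
  rewrite -{1}[p j 0]in_qpoly_val -in_qpolyM (inA_small D_gt0); last first.
    apply: leq_trans (size_polyMleq _ _) _; rewrite size_polyXn /=.
    exact: leq_add.
  by rewrite mulKp ?in_qpoly_val ?expf_neq0 ?polyX_eq0.
have lt : (M * a + m j < size (zvec p))%N.
  exact: (@size_zpoly_gt k s M m m_inj m_lt (fun j => p j 0 : {poly k})).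
have le : (M * N <= M * a + m j)%N.
  by rewrite (leq_trans _ (leq_addr _ _)) // leq_mul2l Na orbT.
have dlt : (d < (size (zvec p)).-1)%N.
  by rewrite -ltnS (ltn_predK lt) (leq_trans _ lt) // ltnS (leq_trans _ le).
have := @res_tau_quot _ d (zvec p); rewrite (ltn_eqF dlt); apply.
  by rewrite -size_poly_gt0 (leq_ltn_trans _ lt).
exact: leq_trans dlt (leq_pred _).
Qed.
End Eisenstein.

Lemma reciprocal_inv (K : fieldType) (a b c : K) : a != 0 -> b != 0 ->
  a * b = c * (a + b) -> c^-1 = a^-1 + b^-1.
Proof.
move=> a0 b0 E; have ab0 : a + b != 0.
  by apply: contraTneq (mulf_neq0 a0 b0) => ab; rewrite negbK E ab mulr0.
have -> : a^-1 + b^-1 = (a + b) / (a * b) by field; rewrite a0 b0.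
by rewrite E invfM mulrCA mulfV // mulr1.
Qed.

(** * Evaluation at truncated Eisenstein series *)

Section Evaluation.
Variables (k : finFieldType) (n s M : nat) (m : 'I_s -> nat).
Hypotheses (n_gt0 : (0 < n)%N) (M_gt0 : (0 < M)%N).
Hypotheses (m_inj : injective m) (m_lt : forall j, (m j < M)%N).
Local Notation V := 'cV[{poly %/ ('X^n : {poly k})}]_s.
Local Notation L := {fraction {poly k}}.
Local Notation F := {fraction {poly k}}.
Local Notation eisen N v := (@eisen k n s M N m v).
Implicit Types (v w : V).

Lemma sigma_ex : exists sigma : {rmorphism F -> L},
  forall p, sigma p%:F = (p \Po 'X^M)%:F.
Proof.
apply: (@frac_map_ex _ _ (comp_poly 'X^M : {rmorphism {poly k} -> {poly k}})).
move=> p q /= /eqP; rewrite -subr_eq0 -rmorphB /= comp_poly_eq0 ?size_polyXn //.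
by rewrite subr_eq0 => /eqP.
Qed.

Variable sigma : {rmorphism F -> L}.
Hypothesis sigmaE : forall p, sigma p%:F = (p \Po 'X^M)%:F.

Let kap : {rmorphism k -> L} := @tofrac _ \o polyC.

(** [eisenM] says that the inverse of [eisen] is additive. Extended by 0 it is k-linear and
    injective, and [RV_eval] applies to it with constant values. *)
Lemma eval_ex N : exists phi : {rmorphism RVF k n s -> L},
  [/\ forall v, v != 0 -> phi (RVF_tens (RV_inv v) 1) = eisen N v
    & forall a, phi (RVF_tens 1 a) = sigma a].
Proof.
pose lam v : L := if v == 0 then 0 else (eisen N v)^-1.
have lam0 v : v != 0 -> lam v != 0.
  by move=> v0; rewrite /lam (negPf v0) invr_eq0 eisen_neq0.
have lamD v w : lam (v + w) = lam v + lam w.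
  rewrite /lam; have [->|v0] := eqVneq v 0; first by rewrite !add0r.
  have [->|w0] := eqVneq w 0; first by rewrite !addr0 (negPf v0).
  have [vw0|vw0] := eqVneq (v + w) 0.
    have -> : w = - v by apply/eqP; rewrite -addr_eq0 addrC vw0.
    by rewrite eisenN // invrN subrr.
  apply: reciprocal_inv; [exact: eisen_neq0 | exact: eisen_neq0 | exact: eisenM].
have lamZ c v : lam (amul c%:P v) = kap c * lam v.
  have [->|c0] := eqVneq c 0.
    have -> : amul 0%:P v = 0 by rewrite /amul polyC0 rmorph0 scale0r.
    by rewrite (rmorph0 kap) mul0r /lam eqxx.
  rewrite /lam; have [->|v0] := eqVneq v 0; first by rewrite amul0 eqxx mulr0.
  rewrite ifF; last first.
    apply: contraNF v0 => /eqP E; have := amulKC v c0; rewrite E amul0 => <-.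
    by [].
  by rewrite eisenZ // invfM invrK.
have muD v w : (lam (v + w))%:P = (lam v)%:P + (lam w)%:P by rewrite lamD polyCD.
have muZ c v : (lam (amul c%:P v))%:P = (kap c)%:P * (lam v)%:P by rewrite lamZ polyCM.
have mu0 v : v != 0 -> (lam v)%:P != 0 by rewrite polyC_eq0; exact: lam0.
have [h [hC hV]] := RV_eval n_gt0 muD muZ mu0.
have hs c : h (RV_const n s c) = sigma (c%:P)%:F by rewrite hC sigmaE comp_polyC.
have [f fE] := @tensor_lift _ _ _ (RV_const n s : {rmorphism _ -> _})
  (@tofrac _ \o polyC : {rmorphism _ -> _}) L h sigma hs.
exists f; split=> [v v0|a]; rewrite [LHS]fE.
  rewrite rmorph1 mulr1 hV size_polyC lam0 //= coefC /=.
  by rewrite /lam (negPf v0) invrK.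
by rewrite rmorph1 mul1r.
Qed.

Variable phi : nat -> {rmorphism RVF k n s -> L}.
Hypothesis phiV : forall N v, v != 0 -> phi N (RVF_tens (RV_inv v) 1) = eisen N v.
Hypothesis phiC : forall N a, phi N (RVF_tens 1 a) = sigma a.

Lemma phi_bounded z : bounded (fun N => phi N z).
Proof.
move: z; apply: RVF_ind => // [a|v v0|x y hx hy|x y hx hy].
- have [d hd] := bounded_cst (sigma a); exists d => N; rewrite phiC; exact: hd.
- exists 0%N => N; rewrite phiV // expr0 divr1.
  set d := (size (zvec M m v)).-1.
  have h := eisen_lead N n_gt0 m_inj m_lt v0; rewrite -/d in h.
  exists (0 ^+ d * (lead_coef (zvec M m v))^-1).
  rewrite -[eisen N v](mulKf (expf_neq0 d (tau_neq0 k))); apply: resM h.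
  by rewrite -exprVn; apply/resX/res_tauV.
- have := boundedB hx (boundedB (bounded_cst 0) hy); congr bounded.
  by apply: funext => N; rewrite rmorphD sub0r opprK.
- have := boundedM hx hy; congr bounded.
  by apply: funext => N; rewrite rmorphM.
Qed.

(** [phi N] need not factor through R_n: it sends a defining relation to a scalar multiple -1 of
    [eisen_err]. This error tends to 0, and stays negligible after multiplication by the bounded
    values of [phi N]. *)
Lemma phi_null z : Rn_cls z = 0 -> null (fun N => phi N z).
Proof.
rewrite -(rmorph0 (@Rn_cls k n s)) => /quot_proj_eq; rewrite subr0 => -[l lP ->].
elim: l lP => [|p l IH] lP.
  have -> : (fun N => phi N (\sum_(p <- [::]) p.1 * p.2)) = fun=> 0.
    by apply: funext => N; rewrite big_nil rmorph0.
  exact: null0.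
have -> : (fun N => phi N (\sum_(q <- p :: l) q.1 * q.2)) =
   fun N => phi N p.1 * phi N p.2 + phi N (\sum_(q <- l) q.1 * q.2).
  by apply: funext => N; rewrite big_cons rmorphD rmorphM.
apply: nullD; last by apply: IH => q ql; apply: lP; rewrite inE ql orbT.
apply: null_bounded; first exact: phi_bounded.
have [alpha [nu [v [alpha0 nun vN ->]]]] := lP p (mem_head _ _).
have av0 : amul 'X^nu v != 0 by move: vN; rewrite inE.
have avE : amul (alpha *: 'X^nu) v = amul alpha%:P (amul 'X^nu v).
  by rewrite amulA mul_polyC.
have av1 : amul alpha%:P (amul 'X^nu v) != 0.
  apply: contra av0 => /eqP E; have := amulKC (amul 'X^nu v) alpha0.
  by rewrite E amul0 => <-.
have E N : phi N (RVF_tens (RV_inv (amul (alpha *: 'X^nu) v)) (alpha *: 'X^nu)%:F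
    - \sum_(v' in tors k n s nu) RVF_tens (RV_inv (v - v')) 1) = - eisen_err M N m nu v.
  rewrite rmorphB [RVF_tens _ (_)%:F]tens_split rmorphM /= phiC -/(RVF_tens _ 1) avE phiV //.
  rewrite rmorph_sum (eq_bigr (fun v' => eisen N (v - v'))) => [|v' v't]; last first.
    rewrite /= phiV // subr_eq0; apply: contraNneq vN => ->; exact: v't.
  rewrite eisen_isogeny // eisenZ // sigmaE -mul_polyC rmorphM /= comp_polyC tofracM.
  have a0 : (alpha%:P)%:F != 0 :> L by rewrite tofrac_eq0 polyC_eq0.
  by rewrite mulrACA mulVf // mul1r [X in X - _]mulrC opprD addrA subrr sub0r.
(* M is positive, so N > d gives M N > d, as the estimate of the error demands. *)
move=> d; exists d.+1 => N dN; rewrite /= E mulrN -[0]subr0 -[- _]sub0r.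
apply: resB; first exact: res0.
apply: res_eisen_err => //.
by rewrite (leq_trans dN) // leq_pmull.
Qed.
End Evaluation.

(** * The spanning monomials *)

Section Nakayama.
Context {k : fieldType} {R : comPzRingType} (scal : {rmorphism {fraction {poly k}} -> R}).
Context {I : eqType} {b : I -> R} {ok : I -> Prop}.
Local Notation N := (fspan scal b ok).

(* The matrix t - C over k[t], for C over k, is invertible over k(t), its
   determinant being the characteristic polynomial of C. *)
Lemma nakayama (J : finType) (P : J -> R) :
  (forall i, exists c : J -> k,
     N (scal 'X%:F * P i - \sum_j scal (c j)%:P%:F * P j)) ->
  forall i, N (P i).
Proof.
move=> /choice[c cN] i.
pose C : 'M[k]_#|J| := \matrix_(a, b) c (enum_val a) (enum_val b).
pose A := char_poly_mx C.
have AN a : N (\sum_b scal (A a b)%:F * P (enum_val b)).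
  have := cN (enum_val a); congr N.
  rewrite [in LHS](reindex (@enum_val J predT)) /=; last first.
    by apply: onW_bij; exact: enum_val_bij.
  rewrite [RHS](eq_bigr (fun b => (if a == b then scal 'X%:F * P (enum_val b) else 0)
    - scal (c (enum_val a) (enum_val b))%:P%:F * P (enum_val b))) => [|b' _]; last first.
    rewrite /A /char_poly_mx !mxE tofracB rmorphB mulrBl; congr (_ - _).
    by case: eqP => _; rewrite ?mulr1n // mulr0n !rmorph0 mul0r.
  rewrite sumrB; congr (_ - _).
  by rewrite -big_mkcond /= (eq_bigl (pred1 a)) ?big_pred1_eq // => b'; rewrite /= eq_sym.
have detN : N (scal (\det A)%:F * P i).
  have -> : scal (\det A)%:F * P i =
      \sum_a scal (\adj A (enum_rank i) a)%:F * (\sum_b scal (A a b)%:F * P (enum_val b)).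
    under [RHS]eq_bigr => a _ do rewrite mulr_sumr.
    rewrite exchange_big /=.
    transitivity (\sum_b' scal ((\adj A *m A) (enum_rank i) b')%:F * P (enum_val b')).
      rewrite mul_adj_mx (bigD1 (enum_rank i)) //= !mxE eqxx mulr1n enum_rankK.
      rewrite big1 ?addr0 // => b' /negPf b'i.
      by rewrite mxE eq_sym b'i mulr0n !rmorph0 mul0r.
    apply: eq_bigr => b' _; rewrite mxE !rmorph_sum mulr_suml; apply: eq_bigr => a _.
    by rewrite /= tofracM rmorphM mulrA.
  by apply: fspan_sum => a _ _; apply: fspanZ.
have det0 : (\det A)%:F != 0 by rewrite tofrac_eq0 monic_neq0 // char_poly_monic.
have -> : P i = scal ((\det A)%:F)^-1 * (scal (\det A)%:F * P i).
  by rewrite mulrA -rmorphM mulVf // rmorph1 mul1r.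
exact: fspanZ.
Qed.
End Nakayama.

Lemma not_uniq_map (T U : eqType) (f : T -> U) (l : seq T) : ~~ uniq (map f l) ->
  exists v w l', perm_eq l [:: v, w & l'] /\ f v = f w.
Proof.
elim: l => //= v l IH; rewrite negb_and negbK => /orP[/mapP[w wl vw]|/IH].
  by exists v, w, (rem w l); rewrite perm_cons perm_to_rem.
move=> [u [w [l' [pl uw]]]]; exists u, w, (v :: l'); split=> //.
rewrite (perm_trans (_ : perm_eq _ (v :: [:: u, w & l']))) ?perm_cons //.
by rewrite -[v :: _]/([:: v] ++ _) perm_catC /= !perm_cons -cat1s perm_catC.
Qed.

Lemma mulr_scale2 (R : comPzRingType) (a b c d e : R) :
  a * b * (c * d * e) = a * (c * (b * (d * e))).
Proof. by rewrite -!mulrA; congr (_ * _); rewrite mulrCA. Qed.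

Section Spanning.
Variables (k : finFieldType) (n r : nat).
Local Notation An := {poly %/ ('X^n : {poly k})}.
Local Notation V := 'cV[An]_r.
Local Notation F := {fraction {poly k}}.
Hypothesis n_gt0 : (0 < n)%N.
Implicit Types (v w : V) (l : 'I_r).
Local Notation rho := (@Rn_inv k n r).
Local Notation scal := (@Rn_scal k n r).
Local Notation mono := (@mono k n r).

Definition esum l : Rn k n r := \sum_(v in Delta k n l) rho v.

Definition factor l (o : option (nat * V)) : Rn k n r :=
  if o is Some (a, v) then esum l ^+ a * rho v else 1.

Definition bindex := {ffun 'I_r -> option (nat * V)}.

Implicit Types be : bindex.

(* The monomials prod_l f_l^(a_l) e_l, l ranging over an arbitrary set of
   indices, with f_l the sum of E_l and e_l in E_l. *)
Definition bmono (be : bindex) : Rn k n r := \prod_l factor l (be l).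

Definition admissible (be : bindex) : Prop :=
  forall l a v, be l = Some (a, v) -> v \in Delta k n l.
Definition nontrivial (be : bindex) : Prop := exists l, be l <> None.

Definition upd (be : bindex) l o : bindex := [ffun l' => if l' == l then o else be l'].

Lemma bmono_upd be l o :
  bmono (upd be l o) = factor l o * \prod_(l' | l' != l) factor l' (be l').
Proof.
rewrite /bmono.
rewrite (bigD1 l); last by [].
rewrite ffunE.
rewrite eqxx.
rewrite (eq_bigr (fun l' => factor l' (be l'))) // => l' /negPf l'l.
by rewrite ffunE l'l.
Qed.

Lemma bmonoD1 be l : bmono be = factor l (be l) * \prod_(l' | l' != l) factor l' (be l').
Proof. by rewrite /bmono (bigD1 l). Qed.

Lemma bmono_updN be l a v : be l = None ->
  bmono (upd be l (Some (a, v))) = esum l ^+ a * rho v * bmono be.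
Proof. by move=> E; rewrite bmono_upd (bmonoD1 be l) E [factor l None]/factor mul1r. Qed.

Lemma bmono_updS be l a v : be l = Some (a, v) ->
  bmono (upd be l (Some (a.+1, v))) = esum l * bmono be.
Proof. by move=> E; rewrite bmono_upd (bmonoD1 be l) E /factor exprS !mulrA. Qed.

Lemma admissible_upd be l a v :
  admissible be -> v \in Delta k n l -> admissible (upd be l (Some (a, v))).
Proof.
move=> ok vl l' a' v'; rewrite ffunE; case: eqP => [->|_]; last exact: ok.
by case=> _ <-.
Qed.

Definition good be := admissible be /\ nontrivial be.

Lemma good_upd be l a v : admissible be -> v \in Delta k n l -> good (upd be l (Some (a, v))).
Proof.
move=> ok vl; split; first exact: admissible_upd.
by exists l; rewrite ffunE eqxx.
Qed.

Local Notation N := (fspan scal bmono good).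

(** If l is in the support, f_l raises the exponent a_l; otherwise f_l is itself the sum of the
    possible factors e_l. *)
Lemma N_esum l x : N x -> N (esum l * x).
Proof.
move=> [s Gs ->]; rewrite mulr_sumr; apply: fspan_sum => -[a be] /Gs[/= ok _] _.
rewrite mulrCA; apply: fspanZ; case E : (be l) => [[d v]|].
  have vl := ok _ _ _ E.
  rewrite -(bmono_updS E).
  exact/fspan_mem/good_upd.
rewrite mulr_suml; apply: fspan_sum => v _ vl.
have -> : rho v * bmono be = bmono (upd be l (Some (0%N, v))).
  by rewrite (bmono_updN _ _ E) expr0 mul1r.
exact/fspan_mem/good_upd.
Qed.

Lemma rho_normalize v : lev v != 0%N -> exists l c v',
  [/\ lev v = l.+1, v' \in Delta k n l & rho v = scal (c%:P)%:F * rho v'].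
Proof.
move=> /lev_normalize[l [c [c0 vl cv]]].
exists l, c, (amul c%:P v); split=> //.
by rewrite rhoZ // mulrA -!rmorphM mulfV // !rmorph1 mul1r.
Qed.

Lemma mono_uniq_levels (t : seq V) : all (fun v => lev v != 0%N) t -> uniq (map (@lev k n r) t) ->
  exists c be, [/\ mono t = scal (c%:P)%:F * bmono be, admissible be
    & forall l : 'I_r, be l = None <-> l.+1 \notin map (@lev k n r) t].
Proof.
elim: t => [|v t IH] /= => [_ _|/andP[v0 t0] /andP[vt ut]].
  exists 1, [ffun=> None]; split=> [|l a v|l]; rewrite ?ffunE //.
  rewrite polyC1 !rmorph1 mul1r /mono big_nil /bmono big1 // => l _.
  by rewrite ffunE.
have [c [be [tE ok beE]]] := IH t0 ut.
have [l [d [v' [vl v'D vE]]]] := rho_normalize v0.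
have bel : be l = None by apply/beE; rewrite -vl.
exists (d * c), (upd be l (Some (0%N, v'))); split.
- rewrite /mono big_cons -/(mono t) tE vE (bmono_updN _ _ bel) expr0 mul1r.
  rewrite polyCM tofracM rmorphM; exact: mulrACA.
- exact: admissible_upd.
move=> l'; rewrite ffunE inE vl eqSS val_eqE; case: eqP => [->|_] /=.
  by split.
exact: beE.
Qed.

(** The hypothesis of [nakayama] for the words of length D; the coefficients have to lie in k, not
    merely in F. *)
Definition reduced (D : nat) (y : Rn k n r) : Prop := exists c : D.-tuple V -> k,
  N (scal 'X%:F * y - \sum_(t : D.-tuple V) scal (c t)%:P%:F * mono t).

Section Reduced.
Variable D : nat.
Implicit Types y z : Rn k n r.

Lemma reducedN y : N y -> reduced D y.
Proof.
move=> Ny; exists (fun=> 0); rewrite big1 ?subr0; first exact: fspanZ.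
by move=> j _; rewrite polyC0 !rmorph0 mul0r.
Qed.

Lemma reducedD y z : reduced D y -> reduced D z -> reduced D (y + z).
Proof.
move=> [c hc] [e he]; exists (fun t => c t + e t).
have -> : \sum_(t : D.-tuple V) scal (c t + e t)%:P%:F * mono t =
    \sum_(t : D.-tuple V) scal (c t)%:P%:F * mono t + \sum_(t : D.-tuple V) scal (e t)%:P%:F * mono t.
  rewrite -big_split; apply: eq_bigr => j _.
  by rewrite polyCD tofracD rmorphD mulrDl.
have := fspanD hc he.
by rewrite mulrDr opprD addrACA.
Qed.

Lemma reducedZ (a : k) y : reduced D y -> reduced D (scal (a%:P)%:F * y).
Proof.
move=> [c hc]; exists (fun t => a * c t).
have E : \sum_(t : D.-tuple V) scal (a * c t)%:P%:F * mono t =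
    scal (a%:P)%:F * \sum_(t : D.-tuple V) scal (c t)%:P%:F * mono t.
  rewrite mulr_sumr; apply: eq_bigr => j _.
  by rewrite polyCM tofracM rmorphM mulrA.
by rewrite E (mulrCA (scal 'X%:F)) -mulrBr; exact: fspanZ.
Qed.

Lemma reducedB y z : reduced D y -> reduced D z -> reduced D (y - z).
Proof.
move=> hy hz; apply: (reducedD hy); have -> : - z = scal ((-1)%:P)%:F * z.
  by rewrite polyCN polyC1 tofracN tofrac1 rmorphN rmorph1 mulN1r.
exact: reducedZ.
Qed.

Lemma reduced_sum (T : eqType) (s : seq T) (P : pred T) (f : T -> Rn k n r) :
  (forall i, P i -> reduced D (f i)) -> reduced D (\sum_(i <- s | P i) f i).
Proof.
move=> H; elim: s => [|i s IH].
  by rewrite big_nil; apply: reducedN; exact: fspan0.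
rewrite big_cons; case: ifP => Pi; last exact: IH.
by apply: reducedD IH; exact: H.
Qed.

Lemma reduced_tX y (c : D.-tuple V -> k) :
  scal 'X%:F * y = \sum_t scal (c t)%:P%:F * mono t -> reduced D y.
Proof. by move=> E; exists c; rewrite E subrr; exact: fspan0. Qed.
End Reduced.

(** Induction on the length of the word, then on the sum of the levels. The rewriting stops at words
    with a vector of level 0, which the relation for t reduces, and at words with distinct levels,
    which lie in the span. *)
Lemma mono_span (t : seq V) : t <> [::] -> N (mono t).
Proof.
have [d] := ubnP (size t); elim: d t => // d IHd t0 st0 t0N.
(* All words of length D are treated together, as [nakayama] needs a finite family that t maps,
   modulo the span, to its k-combinations. *)
set D := size t0; pose J := D.-tuple V.
suff H (t : J) : N (mono t) by exact: (H (in_tuple t0)).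
have D_gt0 : (0 < D)%N by rewrite /D; case: (t0) t0N.
have st : (D < d.+1)%N by exact: st0.
clear t0N st0; clearbody D; move: t.
apply: (nakayama (P := fun t : J => mono t)) => t.
have QN := @reducedN D; have QZ := @reducedZ D; have QB := @reducedB D.
have Qsum := @reduced_sum D; have Qt := @reduced_tX D.
have [m] := ubnP (\sum_(v <- (t : seq V)) lev v)%N; rewrite -/(reduced D _).
have monoP (t1 t2 : seq V) : perm_eq t1 t2 -> mono t1 = mono t2 by exact: perm_big.
suff H : forall t : seq V, (\sum_(v <- t) lev v < m)%N -> size t = D -> reduced D (mono t).
  by move=> tm; apply: H => //; rewrite size_tuple.
elim: m {t} => // m IH t tm sz.
have [z0|z0] := boolP (0 \in t).
  rewrite (monoP _ _ (perm_to_rem z0)) /mono big_cons mul_rho0 //.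
  by apply: QN; exact: fspan0.
have nz v : v \in t -> v != 0 by apply: contraTneq => ->.
have [/hasP[v vt /eqP v0]|noz] := boolP (has (fun v => lev v == 0%N) t).
  have [u vu] := tors_div_X n_gt0 v0.
  have tE := monoP _ _ (perm_to_rem vt).
  have sr : size (rem v t) = D.-1 by rewrite size_rem // sz.
  rewrite tE.
  pose tup (w : V) : J := tcast (prednK D_gt0) (cons_tuple w (tcast sr (in_tuple (rem v t)))).
  have tupE w : tval (tup w) = w :: rem v t by rewrite val_tcast /= val_tcast.
  (* The coefficient of a word counts the torsion vectors v' that produce it. *)
  apply: (Qt _ (fun j => \sum_(v' in tors k n r 1) (j == tup (u - v'))%:R)).
  rewrite /mono big_cons {1}vu mulrA rho_tX ?mulr_suml; last by rewrite -vu nz.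
  under [RHS]eq_bigr => j _ do rewrite !rmorph_sum mulr_suml.
  rewrite exchange_big; apply: eq_bigr => v' _ /=.
  rewrite (bigD1 (tup (u - v'))) //= eqxx polyC1 !rmorph1 mul1r [X in _ = _ + X]big1 ?addr0.
    by rewrite /mono tupE big_cons.
  by move=> j /negPf->; rewrite polyC0 !rmorph0 mul0r.
  exact: n_gt0.
have lev0 : all (fun v => lev v != 0%N) t.
  by apply/allP => v vt; apply: contra noz => v0; apply/hasP; exists v.
(* For two distinct vectors of equal level, both resulting words have v - w in place of one of them,
   so the sum of the levels drops. *)
have pair l v w (t' : seq V) : v \in Delta k n l -> w \in Delta k n l -> v != w ->
    size [:: v, w & t'] = D -> (\sum_(v <- [:: v, w & t']) lev v < m.+1)%N ->
    reduced D (mono [:: v, w & t']).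
  move=> vl wl vw st' mt'.
  have -> : mono [:: v, w & t'] = mono [:: v - w, w & t'] - mono [:: v - w, v & t'].
    rewrite /mono !big_cons mulrA rhoB ?(Delta_neq0 vl) ?(Delta_neq0 wl) //.
    by rewrite -mulrA -mulrBr mulrBl.
  have lt := lev_subDelta vl wl.
  rewrite !big_cons (lev_Delta vl) (lev_Delta wl) ltnS in mt'.
  apply: QB; apply: IH; rewrite // !big_cons ?(lev_Delta vl) ?(lev_Delta wl);
    apply: leq_trans mt'; by rewrite ltn_add2r.
have [ut|/not_uniq_map[v [w [t' [pt vw]]]]] := boolP (uniq (map (@lev k n r) t)).
  have [c [be [tE ok beE]]] := mono_uniq_levels lev0 ut.
  rewrite tE; apply/QZ/QN/fspan_mem; split=> //.
  have [v vt] : exists v, v \in t.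
    by move: sz D_gt0; case: (t) => [<-//|v t' _ _]; exists v; exact: mem_head.
  have [l [_ [_ [vl _ _]]]] := rho_normalize (allP lev0 _ vt).
  exists l => /beE; rewrite -vl; apply/negP; rewrite negbK; exact: map_f.
have vt : v \in t by rewrite (perm_mem pt) mem_head.
have wt : w \in t by rewrite (perm_mem pt) !inE eqxx orbT.
have [l [c [v' [vl v'D vE]]]] := rho_normalize (allP lev0 _ vt).
have [l' [c' [w' [wl w'D wE]]]] := rho_normalize (allP lev0 _ wt).
have ll' : l' = l by apply/val_inj/eqP; rewrite -eqSS -vl vw wl.
rewrite ll' {ll'} in w'D wl.
rewrite (monoP _ _ pt).
have -> : mono [:: v, w & t'] = scal (c%:P)%:F * (scal (c'%:P)%:F * mono [:: v', w' & t']).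
  rewrite /mono !big_cons.
  rewrite vE.
  rewrite wE.
  exact: mulr_scale2.
do 2 apply: reducedZ.
have mt' : (\sum_(v <- [:: v', w' & t']) lev v < m.+1)%N.
  move: tm; rewrite (perm_big _ pt) /= !big_cons vl wl.
  by rewrite (lev_Delta v'D) (lev_Delta w'D).
have st' : size [:: v', w' & t'] = D by rewrite -sz (perm_size pt).
have [E|ne] := eqVneq v' w'; last exact: (pair _ _ _ _ v'D w'D ne st' mt').
rewrite -E in mt' st' *.
(* A square: the term with f_l involves a word of length D - 1, handled by the outer induction; in
   the other terms the two vectors are distinct and [pair] applies. *)
have -> : mono [:: v', v' & t'] = esum l * mono (v' :: t')
   - \sum_(u in Delta k n l | u != v') mono [:: u, v' & t'].
  have E1 u : rho u * mono (v' :: t') = mono [:: u, v' & t'].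
    by symmetry; exact: big_cons.
  rewrite /esum mulr_suml (bigD1 v') //= E1 (eq_bigr _ (fun u _ => E1 u)).
  exact/esym/addrK.
apply: reducedB; first apply/reducedN/N_esum/IHd => //.
  by move: st; rewrite -st'.
apply: Qsum => u /andP[ul uv]; apply: (pair _ _ _ _ ul v'D uv st').
by move: mt'; rewrite !big_cons (lev_Delta ul) (lev_Delta v'D).
Qed.
End Spanning.

(** * Linear independence *)

Lemma digits_lt B r (x : 'I_r -> nat) : (forall l, x l < B)%N ->
  (\sum_l x l * B ^ (r - l.+1) < B ^ r)%N.
Proof.
elim: r x => [|r IH] x xB; first by rewrite big_ord0.
rewrite big_ord_recl subn1 /= expnS.
have lt := IH (fun l => x (lift ord0 l)) (fun l => xB _).
have B_gt0 : (0 < B)%N := leq_ltn_trans (leq0n _) (xB ord0).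
apply: leq_trans (leq_mul (xB ord0) (leqnn (B ^ r)%N)).
rewrite mulSn [(B ^ r + _)%N]addnC -addnS leq_add2l; apply: leq_ltn_trans lt.
by apply: leq_sum => l _; rewrite subSS.
Qed.

Lemma digits_inj B r (x y : 'I_r -> nat) : (forall l, x l < B)%N -> (forall l, y l < B)%N ->
  (\sum_l x l * B ^ (r - l.+1) = \sum_l y l * B ^ (r - l.+1))%N -> x =1 y.
Proof.
elim: r x y => [|r IH] x y xB yB; first by move=> _ [].
have B_gt0 : (0 < B)%N := leq_ltn_trans (leq0n _) (xB ord0).
have E (u : 'I_r.+1 -> nat) : (\sum_l u l * B ^ (r.+1 - l.+1) =
    u ord0 * B ^ r + \sum_(l < r) u (lift ord0 l) * B ^ (r - l.+1))%N.
  by rewrite big_ord_recl subn1; congr (_ + _)%N; apply: eq_bigr => l _; rewrite subSS.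
rewrite !E => H.
have lx := @digits_lt B r (fun l => x (lift ord0 l)) (fun l => xB _).
have ly := @digits_lt B r (fun l => y (lift ord0 l)) (fun l => yB _).
have Br : (0 < B ^ r)%N by rewrite expn_gt0 B_gt0.
have H0 : x ord0 = y ord0.
  have := congr1 (fun a => a %/ B ^ r)%N H.
  by rewrite !divnMDl // !divn_small // !addn0.
have H1 := IH (fun l => x (lift ord0 l)) (fun l => y (lift ord0 l)) (fun l => xB _) (fun l => yB _).
move=> l; have [l'|] := unliftP ord0 l; last by move->.
move=> ->; apply: H1; move: H; rewrite H0; exact: addnI.
Qed.

Lemma seq_argmax (T : eqType) (t : seq T) (key : T -> nat) x0 : x0 \in t ->
  exists2 x, x \in t & forall y, y \in t -> (key y <= key x)%N.
Proof.
elim: t x0 => // x t IH _ _; case: t IH => [_|y t IH].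
  by exists x; [exact: mem_head | move=> z; rewrite inE => /eqP->].
have [z zt zmax] := IH y (mem_head _ _).
have [le|le] := leqP (key z) (key x).
  exists x => [|u]; first exact: mem_head.
  by rewrite inE => /orP[/eqP->//|/zmax ut]; exact: leq_trans ut le.
exists z => [|u]; first by rewrite inE zt orbT.
by rewrite inE => /orP[/eqP->|/zmax //]; exact: ltnW.
Qed.

Lemma common_denominator (R : idomainType) (T : eqType) (t : seq T) (c : T -> {fraction R}) :
  exists2 D : R, D != 0 & exists p : T -> R, {in t, forall x, c x * D%:F = (p x)%:F}.
Proof.
suff [D D0 H] : exists2 D : R, D != 0 & forall x, exists p, x \in t -> c x * D%:F = p%:F.
  by exists D => //; have [p pE] := choice H; exists p => x; exact: pE.
elim: t => [|x t [D D0 IH]]; first by exists 1; [exact: oner_neq0 | exists 0].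
have [p [q [q0 E]]] := fraction_quot (c x).
exists (D * q); first exact: mulf_neq0.
move=> y; have [->|yx] := eqVneq y x.
  by exists (p * D) => _; rewrite !tofracM -E; ring.
have [u uE] := IH y; exists (u * q); rewrite inE (negPf yx) => /= /uE.
by rewrite !tofracM => <-; rewrite mulrA.
Qed.

Section Embedding.
Variables (k : finFieldType) (n r : nat).
Local Notation An := {poly %/ ('X^n : {poly k})}.
Hypothesis n_gt0 : (0 < n)%N.
Variable S : {set 'I_r}.
Local Notation s := #|S|.
Local Notation V := 'cV[An]_r.
Local Notation W := 'cV[An]_s.
Implicit Types (h : 'M[An]_r) (v : V) (w : W) (l : 'I_r).

Definition embed_mx : 'M[An]_(r, s) := \matrix_(i, j) (i == enum_val j)%:R.
Definition embedding h : {linear W -> V} := mulmx (h *m embed_mx).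

Lemma embed_mxE w j : (embed_mx *m w) (enum_val j) 0 = w j 0.
Proof.
rewrite mxE (bigD1 j) //= mxE eqxx mul1r big1 ?addr0 // => j' jj'.
by rewrite mxE (inj_eq enum_val_inj) eq_sym (negPf jj') mul0r.
Qed.

Lemma embed_mx_out w l : l \notin S -> (embed_mx *m w) l 0 = 0.
Proof.
move=> lS; rewrite mxE big1 // => j _; rewrite mxE.
rewrite (_ : l == enum_val j = false) ?mul0r //.
by apply: contraNF lS => /eqP->; exact: enum_valP.
Qed.

Lemma embeddingE h w : embedding h w = h *m (embed_mx *m w).
Proof. by rewrite /= mulmxA. Qed.

Lemma embedding_inj h : h \in unitmx -> injective (embedding h).
Proof.
move=> hU w w'; rewrite !embeddingE => /(can_inj (mulKmx hU)) E.
by apply/colP => j; rewrite -!embed_mxE E.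
Qed.

Lemma embed_mx_Xvec j : embed_mx *m Xvec k n j = Xvec k n (enum_val j).
Proof.
rewrite /Xvec -colE; apply/colP => i; rewrite !mxE eqxx andbT.
by [].
Qed.
End Embedding.

(** * Leading exponents on translated coordinate subspaces *)

Section Leading.
Variables (k : finFieldType) (n r B : nat).
Local Notation An := {poly %/ ('X^n : {poly k})}.
Hypotheses (n_gt0 : (0 < n)%N) (B_gt1 : (1 < B)%N).
Variable S : {set 'I_r}.
Local Notation s := #|S|.
Local Notation V := 'cV[An]_r.
Local Notation W := 'cV[An]_s.
Local Notation L := {fraction {poly k}}.
Local Notation tau := (tau k).
Implicit Types (v : V) (w : W) (l : 'I_r).

(* Exponents less than B are the digits in base B of the weight of a monomial, which
   therefore determines them. *)
Definition wt (l : 'I_r) : nat := B ^ (r - l.+1).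
Local Notation M := (B ^ r)%N.
Definition wtS (j : 'I_s) : nat := wt (enum_val j).

Lemma wt_lt (l l' : 'I_r) : (l < l')%N -> (wt l' < wt l)%N.
Proof.
move=> ll'; rewrite ltn_exp2l //; apply: ltn_sub2l; last by rewrite ltnS.
exact: leq_ltn_trans ll' (ltn_ord l').
Qed.

Lemma wtS_inj : injective wtS.
Proof.
move=> j j' E; apply: enum_val_inj; apply: val_inj.
by case: (ltngtP (enum_val j) (enum_val j')) => // /wt_lt; rewrite -!/(wtS _) E ltnn.
Qed.
Lemma wtS_lt j : (wtS j < M)%N.
Proof.
have lr := ltn_ord (enum_val j).
by rewrite ltn_exp2l // ltn_subrL /= (leq_ltn_trans _ lr).
Qed.
Lemma M_gt0 : (0 < M)%N. Proof. by rewrite expn_gt0 ltnW. Qed.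

Local Notation eisen N w := (@eisen k n s M N wtS w).
Local Notation zval w := (@zvec k s M wtS n w).

Lemma zvec_Xvec j : zval (Xvec k n j) = 'X^(wtS j).
Proof.
rewrite /zvec /zpoly (bigD1 j) //= !mxE !eqxx /= big1 ?addr0 => [|j' jj'].
  by rewrite rmorph1 mul1r.
by rewrite !mxE (negPf jj') /= rmorph0 mul0r.
Qed.

(** X_j has the smallest degree. Any other w has either a nonzero coefficient at t^a with a > 0,
    giving degree at least M, or a nonzero residue at an earlier index, where the weight is
    larger. *)
Lemma size_zvec_Delta j w : embed_mx k n S *m w \in Delta k n (enum_val j) ->
  w != Xvec k n j -> (wtS j < (size (zval w)).-1)%N.
Proof.
move=> /DeltaP[w1 w0] ne.
have [j' wj'] : exists j', w j' 0 != Xvec k n j j' 0.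
  apply: contrapT => H; move/eqP: ne; apply; apply/colP => j'.
  by apply/eqP/negPn/negP => ne; apply: H; exists j'.
have [a wa] : exists a, (w j' 0 : {poly k})`_a != (Xvec k n j j' 0 : {poly k})`_a.
  apply: contrapT => H; move/eqP: wj'; apply; apply/val_inj/polyP => a.
  by apply/eqP/negPn/negP => ne'; apply: H; exists a.
have lt_pred b : (b < size (zval w))%N -> (wtS j < b)%N -> (wtS j < (size (zval w)).-1)%N.
  by move=> bz jb; rewrite (leq_trans jb) // -ltnS (ltn_predK bz).
have big_coef : (w j' 0 : {poly k})`_a != 0 -> (M * a + wtS j' < size (zval w))%N.
  exact: (@size_zpoly_gt k s M wtS wtS_inj wtS_lt (fun j => w j 0 : {poly k})).
case: a wa big_coef => [|a] wa big_coef; last first.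
  have {}wa : (w j' 0 : {poly k})`_a.+1 != 0.
    apply: contraNneq wa => ->; rewrite mxE eqxx andbT.
    by case: (j' == j); rewrite ?coef0 //= ?coef1 // -polyC1 coefC.
  apply: lt_pred (big_coef wa) _.
  by rewrite (leq_trans (wtS_lt j)) // mulnS -addnA leq_addr.
have cE : cst ((embed_mx k n S *m w) (enum_val j') 0) != (j' == j)%:R.
  by rewrite embed_mxE -(cst_Xvec k n j j').
have [lt|] := ltnP (enum_val j') (enum_val j).
  have jj' : (j' == j) = false by apply: contraTF lt => /eqP->; rewrite ltnn.
  move: cE; rewrite jj' embed_mxE => cE.
  apply: lt_pred (big_coef cE) _; rewrite muln0 add0n; exact: wt_lt.
rewrite leq_eqVlt => /orP[/eqP/val_inj/enum_val_inj E|lt].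
  by move: cE; rewrite -E w1 eqxx eqxx.
by move: cE; rewrite w0 // (_ : j' == j = false) ?eqxx //; apply: contraTF lt => /eqP->; rewrite ltnn.
Qed.

Variable h : 'M[An]_r.
Hypothesis hU : h \in Ugrp k n r.
Local Notation i := (embedding S h).

Definition preimage v : option W := [pick w | i w == v].

Lemma preimageP v : if preimage v is Some w then i w = v else v \notin codom i.
Proof.
rewrite /preimage; case: pickP => [w /eqP //|H].
by apply/negP => /codomP[w E]; have := H w; rewrite E eqxx.
Qed.

Definition ev N v : L := if preimage v is Some w then eisen N w else 0.

(** As h preserves [Delta l], the preimage of v is subject to [size_zvec_Delta], and h X_l is the
    only vector whose preimage has the smallest degree. *)
Lemma ev_res N l v : l \in S -> v \in Delta k n l ->
  res (tau ^+ wt l * ev N v) (v == h *m Xvec k n l)%:R.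
Proof.
move=> lS vD; pose j := enum_rank_in lS l.
have lj : enum_val j = l by rewrite enum_rankK_in.
rewrite /ev; have := preimageP v; case: (preimage v) => [w iw|vi]; last first.
  rewrite mulr0 (_ : v == _ = false); first exact: res0.
  apply: contraNF vi => /eqP->; apply/codomP; exists (Xvec k n j).
  by rewrite embeddingE embed_mx_Xvec lj.
have wD : embed_mx k n S *m w \in Delta k n l.
  by rewrite -(Ugrp_Delta n_gt0 _ _ hU) -embeddingE iw.
have w0 : w != 0.
  apply/eqP => E; move: (Delta_neq0 wD); by rewrite E mulmx0 eqxx.
have H := eisen_lead N n_gt0 wtS_inj wtS_lt w0.
have vE : (v == h *m Xvec k n l) = (w == Xvec k n j).
  rewrite -iw -lj -embed_mx_Xvec -embeddingE (inj_eq (embedding_inj (Ugrp_unit hU))) //.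
rewrite vE -lj -/(wtS j); have [E|ne] := eqVneq w (Xvec k n j).
  by move: H; rewrite E zvec_Xvec size_polyXn lead_coefXn invr1.
apply: res_shift H _; apply: size_zvec_Delta ne; by rewrite lj.
Qed.

(** A preimage of v would lie, after the coordinate inclusion, in [Delta l], with residue 1 at l;
    but the coordinate subspace of S vanishes at l. *)
Lemma ev_out N l v : l \notin S -> v \in Delta k n l -> ev N v = 0.
Proof.
move=> lS vD; rewrite /ev; have := preimageP v; case: (preimage v) => // w iw.
have : embed_mx k n S *m w \in Delta k n l.
  by rewrite -(Ugrp_Delta n_gt0 _ _ hU) -embeddingE iw.
case/DeltaP; rewrite embed_mx_out // rmorph0 => /esym/eqP.
by rewrite oner_eq0.
Qed.
End Leading.

Lemma res_sigma (k : fieldType) M (p : {poly k}) : (0 < M)%N -> p != 0 ->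
  res ((p \Po 'X^M)%:F / tau k ^+ (M * (size p).-1)) (lead_coef p).
Proof.
move=> M0 p0; have X0 m : ('X^m : {poly k}) != 0 by rewrite expf_neq0 ?polyX_eq0.
exists (p \Po 'X^M), 'X^(M * (size p).-1); split=> //=.
- by rewrite -tofracXn divfK // tofrac_eq0.
- have := size_comp_poly p 'X^M; rewrite !size_polyXn /= mulnC => <-.
  by rewrite leqSpred.
by rewrite size_polyXn lead_coefXn mulr1 /= coef_comp_poly_Xn // dvdn_mulr // mulKn.
Qed.

Lemma base_shift_inj M a b w w0 : (w < M)%N -> (w0 < M)%N ->
  (M * a + (M - w) = M * b + (M - w0))%N -> w = w0.
Proof.
move=> lw lw0 E; have {}E : (M * a.+1 + w0 = M * b.+1 + w)%N by rewrite !mulnS; lia.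
have := congr1 (modn^~ M) E.
by rewrite /= ![(M * _.+1)%N]mulnC !modnMDl !modn_small.
Qed.

Lemma shift_term (K : fieldType) (a b c d e : K) : a != 0 -> d != 0 ->
  c / d * (b * e) = (a * b) / (d * a) * (c * e).
Proof. by move=> a0 d0; field; rewrite a0 d0. Qed.

Lemma shift_product (K : fieldType) (a b c d e x y : K) :
  a * x * (b / c * y * (d * e)) = c^-1 * (a * (b * d) * (x * (y * e))).
Proof. by rewrite [b / c]mulrC; ring. Qed.

Section Independence.
Variables (k : finFieldType) (n r : nat).
Local Notation An := {poly %/ ('X^n : {poly k})}.
Local Notation V := 'cV[An]_r.
Local Notation F := {fraction {poly k}}.
Local Notation L := {fraction {poly k}}.
Hypothesis n_gt0 : (0 < n)%N.
Local Notation rho := (@Rn_inv k n r).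
Local Notation scal := (@Rn_scal k n r).
Local Notation esum := (@esum k n r).
Local Notation bmono := (@bmono k n r).
Local Notation bindex := (bindex k n r).
Local Notation tau := (tau k).
Implicit Types (v : V) (l : 'I_r) (be : bindex).

Definition support be : {set 'I_r} := [set l | be l != None].
Definition esums (S : {set 'I_r}) : Rn k n r := \prod_(l in S) esum l.
Definition digit (o : option (nat * V)) : nat := if o is Some (a, _) then a.+1 else 0.

Section Leading.
Variable S : {set 'I_r}.
Local Notation s := #|S|.
Local Notation W := 'cV[An]_s.
Variable h : 'M[An]_r.
Hypothesis hU : h \in Ugrp k n r.
Local Notation i := (embedding S h).

(** This and the next definitions lift the images under tilde pi to the tensor product of R_V with
    F, the only place where the evaluations [phi N] are defined. *)
Definition pre_tens v : RVF k n s :=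
  if preimage S h v is Some w then RVF_tens (RV_inv w) 1 else 0.
Definition pre_esum l : RVF k n s := \sum_(v in Delta k n l) pre_tens v.
Definition pre_factor l (o : option (nat * V)) : RVF k n s :=
  if o is Some (a, v) then pre_esum l ^+ a * pre_tens v else 1.
Definition pre_mono be : RVF k n s := \prod_l pre_factor l (be l).

Section Specialization.
Variable f : {rmorphism Rn k n r -> RSn k n s}.
Hypothesis fP : is_tilde_pi i f.
Let g (z : RVF k n s) : RSn k n s := RSn_inj (Rn_cls z).

Let gD z z' : g (z + z') = g z + g z'.
Proof. by rewrite /g rmorphD [LHS]rmorphD. Qed.
Let gM z z' : g (z * z') = g z * g z'.
Proof. by rewrite /g rmorphM [LHS]rmorphM. Qed.
Let g1 : g 1 = 1.
Proof. by rewrite /g rmorph1 [LHS]rmorph1. Qed.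
Let g0 : g 0 = 0.
Proof. by apply: (addrI (g 0)); rewrite -gD !addr0. Qed.

Lemma spec_rho v : v != 0 -> f (rho v) = g (pre_tens v).
Proof.
have [fC fV fN] := fP; move=> v0; rewrite /pre_tens.
have := preimageP S h v; case: (preimage S h v) => [w iw|vi].
  rewrite -iw.
  apply: fV.
  apply: contra v0 => /eqP E.
  by rewrite -iw E raddf0.
rewrite g0.
exact: fN.
Qed.

Lemma spec_esum l : f (esum l) = g (pre_esum l).
Proof.
rewrite rmorph_sum (big_morph g gD g0); apply: eq_bigr => v vD.
exact: spec_rho (Delta_neq0 vD).
Qed.

Lemma spec_mono be : admissible be -> f (bmono be) = g (pre_mono be).
Proof.
move=> ok; rewrite rmorph_prod (big_morph g gM g1); apply: eq_bigr => l _.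
rewrite /factor /pre_factor; case E : (be l) => [[a v]|]; last first.
  by rewrite g1; exact: rmorph1.
have EX m : f (esum l ^+ m) = g (pre_esum l ^+ m).
  elim: m => [|m IH]; first by rewrite !expr0 g1; exact: rmorph1.
  by rewrite !exprS gM -IH -spec_esum; exact: rmorphM.
by rewrite gM -(spec_rho (Delta_neq0 (ok _ _ _ E))) -EX; exact: rmorphM.
Qed.

Lemma spec_sum (t : seq bindex) (c : bindex -> F) : {in t, forall be, admissible be} ->
  f ((\sum_(be <- t) scal (c be) * bmono be) * esums S) =
  g ((\sum_(be <- t) RVF_tens 1 (c be) * pre_mono be) * \prod_(l in S) pre_esum l).
Proof.
have [fC _ _] := fP; move=> ok.
rewrite rmorphM gM rmorph_sum (big_morph g gD g0) rmorph_prod (big_morph g gM g1).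
congr (_ * _); last by apply: eq_bigr => l _; exact: spec_esum.
rewrite big_seq [RHS]big_seq; apply: eq_bigr => be /ok okb.
by rewrite rmorphM gM /= fC spec_mono.
Qed.

(** Vanishing in the localization is vanishing in the ring after multiplication by some inverted
    elements. The list [ws] records them, because their Eisenstein series have known leading
    terms. *)
Lemma spec_eq0 z : g z = 0 -> exists2 ws : seq W, all (fun w => w != 0) ws &
  Rn_cls (\prod_(w <- ws) RVF_tens (RV_inv w) 1 * z) = 0.
Proof.
rewrite -g0 => /loc_frac_eq[u [us usP ->]].
rewrite !mulr1 [Rn_cls 0]rmorph0 mulr0 => E.
elim: us usP z E => [|x us IH] usP z E.
  by exists [::] => //; rewrite big_nil mul1r; rewrite big_nil mul1r in E.
have [w w0 xE] := usP x (mem_head _ _).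
have [||ws ws0 H] := IH _ (RVF_tens (RV_inv w) 1 * z).
- by move=> y yu; apply: usP; rewrite inE yu orbT.
- by rewrite rmorphM mulrCA mulrA; move: E; rewrite big_cons xE.
exists (w :: ws); first by rewrite /= w0.
rewrite big_cons -mulrA mulrCA; exact: H.
Qed.
End Specialization.

Variable B : nat.
Hypothesis B_gt1 : (1 < B)%N.
Local Notation M := (B ^ r)%N.
Local Notation wt := (@wt r B).
Local Notation wtS := (@wtS r B S).
Local Notation ev := (@ev k n r B S h).
Local Notation eisen N w := (@eisen k n s M N wtS w).
Variable sigma : {rmorphism F -> L}.
Hypothesis sigmaE : forall p, sigma p%:F = (p \Po 'X^M)%:F.
Variable phi : nat -> {rmorphism RVF k n s -> L}.
Hypothesis phiV : forall N w, w != 0 -> phi N (RVF_tens (RV_inv w) 1) = eisen N w.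
Hypothesis phiC : forall N a, phi N (RVF_tens 1 a) = sigma a.

Lemma phi_pre_tens N v : v != 0 -> phi N (pre_tens v) = ev N v.
Proof.
move=> v0; rewrite /pre_tens /ev.
have := preimageP S h v; case: (preimage S h v) => [w iw|vi]; last by rewrite rmorph0.
by rewrite phiV //; apply: contra v0 => /eqP E; rewrite -iw E raddf0.
Qed.

Lemma phi_pre_esum N l : l \in S -> res (tau ^+ wt l * phi N (pre_esum l)) 1.
Proof.
move=> lS; rewrite rmorph_sum mulr_sumr.
have D : h *m Xvec k n l \in Delta k n l by rewrite Ugrp_Delta // Xvec_Delta.
rewrite -[X in res _ X](_ : \sum_(v in Delta k n l) (v == h *m Xvec k n l)%:R = 1).
  by apply: res_sum => v vD; rewrite phi_pre_tens ?(Delta_neq0 vD) //; exact: ev_res.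
by rewrite (bigD1 _ D) /= eqxx big1 ?addr0 // => v /andP[_ /negPf->].
Qed.

Definition weight be : nat := \sum_l digit (be l) * wt l.
(** The coefficient of the evaluated monomial at the exponent [weight]: it tests whether its vectors
    are those singled out by h. *)
Definition matches be : k := \prod_l (if be l is Some (_, v) then (v == h *m Xvec k n l)%:R else 1).

Lemma phi_pre_mono N be : admissible be -> support be \subset S ->
  res (tau ^+ weight be * phi N (pre_mono be)) (matches be).
Proof.
move=> ok bS; rewrite rmorph_prod /weight -prodrXr -big_split /=.
apply: res_prod => l _; rewrite /pre_factor /digit; case E : (be l) => [[a v]|]; last first.
  by rewrite mul0n expr0 rmorph1 mulr1; exact: res1.
have lS : l \in S by apply: (subsetP bS); rewrite inE E.
have vD := ok _ _ _ E.
rewrite rmorphM rmorphXn /= phi_pre_tens ?(Delta_neq0 vD) // mulSn addnC mulnC exprD exprM.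
rewrite mulrACA -exprMn -[X in res _ X]mul1r -[X in res _ (X * _)](expr1n k a).
by apply: resM; [exact/resX/phi_pre_esum | exact: ev_res].
Qed.

Lemma phi_pre_mono_out N be : admissible be -> ~~ (support be \subset S) ->
  phi N (pre_mono be) = 0.
Proof.
move=> ok /subsetPn[l]; rewrite inE => bl lS; rewrite rmorph_prod (bigD1 l) //=.
case E : (be l) bl => [[a v]|//] _; have vD := ok _ _ _ E.
have e0 : ev N v = 0 by apply: ev_out lS vD.
by rewrite /pre_factor rmorphM /= phi_pre_tens ?(Delta_neq0 vD) // e0 mulr0 mul0r.
Qed.

(** Normalise by the exponent of [be0], which is maximal. Another monomial with this exponent has
    the same base-B digits, so it differs from [be0] in some vector and its [matches] is 0. Only the
    leading coefficient of [p be0] survives. *)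
Lemma leading_not_null (t : seq bindex) (p : bindex -> {poly k}) be0 (ws : seq W) :
  uniq t -> {in t, forall be, admissible be} -> {in t, forall be l, (digit (be l) < B)%N} ->
  all (fun w => w != 0) ws ->
  be0 \in t -> p be0 != 0 -> support be0 \subset S ->
  (forall l a v, be0 l = Some (a, v) -> h *m Xvec k n l = v) ->
  {in t, forall be, p be != 0 -> support be \subset S ->
    (M * (size (p be)).-1 + (M - weight be) <=
     M * (size (p be0)).-1 + (M - weight be0))%N} ->
  ~ null (fun N => phi N (\prod_(w <- ws) RVF_tens (RV_inv w) 1 *
     ((\sum_(be <- t) RVF_tens 1 (p be)%:F * pre_mono be) * \prod_(l in S) pre_esum l))).
Proof.
move=> ut ok tB ws0 b0t pb0 b0S hb0 bmax hnull.
have t0 d : tau ^+ d != 0 by rewrite expf_neq0 // tau_neq0.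
have wlt be : be \in t -> (weight be < M)%N.
  by move=> bt; apply: digits_lt; exact: tB.
(* The degree in tau of the term of [be], raised by M to remain a natural number. The weight is
   subtracted because monomials are products of inverses. *)
pose key be := (M * (size (p be)).-1 + (M - weight be))%N.
pose term N be := (p be \Po 'X^M)%:F * phi N (pre_mono be).
have term_res N be : be \in t -> p be != 0 -> support be \subset S ->
    res (tau ^+ M / tau ^+ key be * term N be) (lead_coef (p be) * matches be).
  move=> bt pb bS; have := resM (res_sigma (M_gt0 r B_gt1) pb) (phi_pre_mono N (ok _ bt) bS).
  have EM : tau ^+ M = tau ^+ (M - weight be) * tau ^+ weight be.
    by rewrite -exprD subnK // ltnW ?wlt.
  congr res; rewrite /term /key EM exprD.
  by apply: shift_term; exact: t0.
have term0 N : res (tau ^+ M / tau ^+ key be0 * term N be0) (lead_coef (p be0)).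
  have := term_res N _ b0t pb0 b0S; rewrite (_ : matches be0 = 1) ?mulr1 //.
  rewrite /matches big1 // => l _; case E : (be0 l) => [[a v]|] //.
  by rewrite (hb0 _ _ _ E) eqxx.
have term_other N be : be \in t -> be <> be0 -> res (tau ^+ M / tau ^+ key be0 * term N be) 0.
  move=> bt ne; have [pb|pb] := eqVneq (p be) 0.
    by rewrite /term pb comp_poly0 tofrac0 mul0r mulr0; exact: res0.
  have [bS|bS] := boolP (support be \subset S); last first.
    by rewrite /term (phi_pre_mono_out N (ok _ bt) bS) !mulr0; exact: res0.
  have H := term_res N _ bt pb bS; have := bmax _ bt pb bS.
  rewrite -/(key be) -/(key be0) leq_eqVlt => /orP[/eqP Ek|lt]; last first.
    have -> : tau ^+ M / tau ^+ key be0 =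
        (tau^-1) ^+ (key be0 - key be) * (tau ^+ M / tau ^+ key be).
      by rewrite -{1}(subnK (ltnW lt)) exprD invfM exprVn mulrCA.
    rewrite -mulrA -(mul0r (lead_coef (p be) * matches be)); apply: resM H.
    have := resX (key be0 - key be) (res_tauV k).
    by rewrite expr0n subn_eq0 leqNgt lt.
  rewrite -Ek; move: H; rewrite (_ : matches be = 0) ?mulr0 //.
  have Ew : weight be = weight be0.
    exact: (@base_shift_inj M (size (p be)).-1 (size (p be0)).-1 _ _ (wlt _ bt) (wlt _ b0t) Ek).
  have digE := digits_inj (tB _ bt) (tB _ b0t) Ew.
  have [l bl] : exists l, be l <> be0 l.
    apply: contrapT => H; apply: ne; apply/ffunP => l; apply: contrapT => nl.
    by apply: H; exists l.
  rewrite /matches (bigD1 l) //=; have := digE l; move: bl.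
  case E : (be l) => [[a v]|]; case E0 : (be0 l) => [[a0 v0]|] //= => bl [aE].
  rewrite (_ : (v == _) = false) ?mul0r //; apply/negP => /eqP vE; apply: bl.
  by rewrite aE vE (hb0 _ _ _ E0).
have sumE N : res (tau ^+ M / tau ^+ key be0 * phi N (\sum_(be <- t) RVF_tens 1 (p be)%:F * pre_mono be))
    (lead_coef (p be0)).
  rewrite (perm_big _ (perm_to_rem b0t)) /= big_cons rmorphD mulrDr -[X in res _ X]addr0.
  have phi_term be : phi N (RVF_tens 1 (p be)%:F * pre_mono be) = term N be.
    by rewrite rmorphM /= phiC sigmaE.
  apply: resD; first by rewrite phi_term; exact: term0.
  rewrite rmorph_sum mulr_sumr big_seq; apply: res_sum0 => be.
  rewrite (mem_rem_uniq _ ut) inE => /andP[/eqP ne bt].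
  by rewrite [X in _ * X]phi_term; exact: term_other.
have esumE N : res (tau ^+ (\sum_(l in S) wt l) * phi N (\prod_(l in S) pre_esum l)) 1.
  rewrite rmorph_prod -prodrXr -big_split -[X in res _ X](@big1_eq _ 1 *%R _ (index_enum 'I_r) (mem S)).
  by apply: res_prod => l lS; exact: phi_pre_esum.
(* The inverted elements contribute a fixed power of tau and a nonzero constant, uniformly in N. *)
have [e [y [y0 unitE]]] : exists e y, y != 0 /\
    forall N, res (tau ^+ e * phi N (\prod_(w <- ws) RVF_tens (RV_inv w) 1)) y.
  elim: (ws) ws0 => [_|w ws' IH /= /andP[w0 /IH[e [y [y0 H]]]]].
    exists 0%N, 1; rewrite oner_neq0; split=> // N.
    by rewrite big_nil rmorph1 mulr1; exact: res1.
  set zw := zvec M wtS w.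
  exists ((size zw).-1 + e)%N, ((lead_coef zw)^-1 * y); split.
    rewrite mulf_neq0 // invr_eq0 lead_coef_eq0.
    by apply: zvec_neq0 w0; [exact: wtS_inj | exact: wtS_lt].
  move=> N; rewrite big_cons rmorphM /= phiV // exprD mulrACA; apply: resM => //.
  exact: (eisen_lead N n_gt0 (@wtS_inj _ _ B_gt1 S) (@wtS_lt _ _ B_gt1 S)).
have [N0 /(_ N0 (leqnn _)) Hn] := hnull (e + (M + \sum_(l in S) wt l))%N.
have HK : res (tau ^+ key be0)^-1 (0 ^+ key be0).
  by rewrite -exprVn; apply/resX/res_tauV.
have R1 := resM HK Hn; rewrite mulr0 in R1.
have R2 := resM (unitE N0) (resM (sumE N0) (esumE N0)).
have EE : tau ^+ e * phi N0 (\prod_(w <- ws) RVF_tens (RV_inv w) 1) *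
  (tau ^+ M / tau ^+ key be0 * phi N0 (\sum_(be <- t) RVF_tens 1 (p be)%:F * pre_mono be) *
   (tau ^+ (\sum_(l in S) wt l) * phi N0 (\prod_(l in S) pre_esum l))) =
  (tau ^+ key be0)^-1 * (tau ^+ (e + (M + \sum_(l in S) wt l)) *
   phi N0 (\prod_(w <- ws) RVF_tens (RV_inv w) 1 *
     ((\sum_(be <- t) RVF_tens 1 (p be)%:F * pre_mono be) * \prod_(l in S) pre_esum l))).
  by rewrite !(rmorphM (phi N0)) !exprD; exact: shift_product.
rewrite EE in R2; have := res_uniq R1 R2; move/esym/eqP.
by rewrite mulr1 !mulf_eq0 (negPf y0) lead_coef_eq0 (negPf pb0).
Qed.
End Leading.
End Independence.

(** * From leading exponents to independence *)

Section IndependenceCriterion.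
Variables (k : finFieldType) (n r : nat).
Local Notation An := {poly %/ ('X^n : {poly k})}.
Local Notation V := 'cV[An]_r.
Local Notation F := {fraction {poly k}}.
Hypothesis n_gt0 : (0 < n)%N.
Local Notation scal := (@Rn_scal k n r).
Local Notation bmono := (@bmono k n r).
Local Notation bindex := (bindex k n r).
Implicit Types (v : V) (l : 'I_r) (be : bindex).

(** The vanishing is required for all translates h, since h is chosen only once the monomial with
    the largest leading exponent is known. *)
Lemma specialization_indep (S : {set 'I_r}) (t : seq bindex) (c : bindex -> F) :
  uniq t -> {in t, forall be, admissible be} ->
  (forall h, h \in Ugrp k n r -> exists2 f : {rmorphism Rn k n r -> RSn k n #|S|},
     is_tilde_pi (embedding S h) f &
     f ((\sum_(be <- t) scal (c be) * bmono be) * esums k n S) = 0) ->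
  {in t, forall be, support be \subset S -> c be = 0}.
Proof.
move=> ut ok H be1 b1t b1S; apply/eqP/negPn/negP => cb1.
have [D D0 [p pE]] := common_denominator t c.
have D0' : D%:F != 0 by rewrite tofrac_eq0.
have pb1 : p be1 != 0.
  by rewrite -tofrac_eq0 -(pE _ b1t); exact: mulf_neq0 cb1 D0'.
(* The total of the digits bounds each digit; adding 2 makes the bound strict and the base at least
   2. *)
pose B := (\sum_(be <- t) \sum_l digit (be l)).+2.
have tB : {in t, forall be l, (digit (be l) < B)%N}.
  move=> be bt l; rewrite /B ltnS (leq_trans _ (leqnSn _)) //.
  rewrite (perm_big _ (perm_to_rem bt)) /= big_cons (bigD1 l) //= -addnA.
  exact: leq_addr.
have B_gt1 : (1 < B)%N by [].
pose key be := (B ^ r * (size (p be)).-1 + (B ^ r - weight B be))%N.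
have b1f : be1 \in [seq be <- t | (p be != 0) && (support be \subset S)].
  by rewrite mem_filter pb1 b1S b1t.
have [be0] := seq_argmax key b1f.
rewrite mem_filter => /andP[/andP[pb0 b0S] b0t] bmax.
(* The columns of h: the vectors of [be0], and X_l as a default outside its support. *)
pose e l := if be0 l is Some (_, v) then v else Xvec k n l.
have eD l : e l \in Delta k n l.
  rewrite /e; case E : (be0 l) => [[a v]|]; last exact: Xvec_Delta.
  exact: ok b0t _ _ _ E.
pose h := mxcols e; have hU : h \in Ugrp k n r by exact: mxcols_Ugrp.
have [f fP fx] := H h hU.
have [sigma sigmaE] := sigma_ex k (M_gt0 r B_gt1).
have /choice[phi phiP] N := eval_ex n_gt0 (@wtS_inj r B B_gt1 S)
  (@wtS_lt r B B_gt1 S) sigmaE N.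
have phiV N w : w != 0 -> phi N (RVF_tens (RV_inv w) 1) = eisen (B ^ r) N (@wtS r B S) w.
  by have [pv _] := phiP N; exact: pv.
have phiC N a : phi N (RVF_tens 1 a) = sigma a by have [_ pc] := phiP N; exact: pc.
have := spec_sum fP (fun be => (p be)%:F) ok.
have -> : \sum_(be <- t) scal (p be)%:F * bmono be =
    scal D%:F * \sum_(be <- t) scal (c be) * bmono be.
  rewrite mulr_sumr; apply: eq_big_seq => be bt.
  rewrite -(pE _ bt) rmorphM [X in X * _]mulrC.
  exact/esym/mulrA.
rewrite -mulrA rmorphM fx mulr0 => /esym/(spec_eq0)[ws ws0].
move=> /(phi_null n_gt0 (M_gt0 r B_gt1) (@wtS_inj r B B_gt1 S) (@wtS_lt r B B_gt1 S) sigmaE phiV phiC).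
apply: (leading_not_null n_gt0 hU B_gt1 sigmaE phiV phiC ut ok tB ws0 b0t pb0 b0S).
  by move=> l a v E; rewrite mxcols_Xvec /e E.
move=> be bt pb bS; apply: bmax.
by rewrite mem_filter pb bS bt.
Qed.

Lemma tilde_pi_ex s (i : {linear 'cV[An]_s -> V}) : injective i ->
  exists f, is_tilde_pi i f /\
    forall t : seq V, has (fun v => v \notin codom i) t -> f (mono t) = 0.
Proof.
move=> i_inj; have [f0 [fC fV fN]] := tilde_pi_Rn n_gt0 i_inj.
exists (@RSn_inj k n s \o f0 : {rmorphism _ -> _}); split.
  split=> [a|w _|v vi]; rewrite [LHS]/=.
  - by rewrite fC.
  - by rewrite fV.
  - by rewrite fN // [LHS]rmorph0.
move=> t /hasP[v vt vi]; rewrite [LHS]/= /mono (perm_big _ (perm_to_rem vt)) big_cons.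
by rewrite rmorphM /= fN // mul0r [LHS]rmorph0.
Qed.

(* The factor f_1 ... f_r is carried along because it also yields that this product
   is not a zero divisor. *)
Lemma bmono_indep (t : seq bindex) (c : bindex -> F) :
  uniq t -> {in t, forall be, admissible be} ->
  (\sum_(be <- t) scal (c be) * bmono be) * esums k n setT = 0 ->
  {in t, forall be, c be = 0}.
Proof.
move=> ut ok E be bt; apply: (@specialization_indep setT t c ut ok _ be bt) => //.
move=> h hU; have [f [fP _]] := tilde_pi_ex (embedding_inj (S := setT) (Ugrp_unit hU)).
by exists f => //; rewrite E rmorph0.
Qed.

Lemma bmono_indep_family (I : eqType) (t : seq I) (u : I -> bindex) (c : I -> F) :
  uniq t -> {in t &, injective u} -> {in t, forall i, admissible (u i)} ->
  (\sum_(i <- t) scal (c i) * bmono (u i)) * esums k n setT = 0 ->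
  {in t, forall i, c i = 0}.
Proof.
move=> ut u_inj ok E.
pose c' be := \sum_(i <- t | u i == be) c i.
have c'E i : i \in t -> c' (u i) = c i.
  move=> it; rewrite /c' (perm_big _ (perm_to_rem it)) /= big_cons eqxx.
  rewrite big_seq_cond big1 ?addr0 // => j /andP[].
  rewrite (mem_rem_uniq _ ut) inE => /andP[ji jt] /eqP uE.
  by move: ji; rewrite (u_inj _ _ jt it uE) eqxx.
have uq : uniq (map u t) by rewrite map_inj_in_uniq.
have okm : {in map u t, forall be, admissible be}.
  by move=> _ /mapP[j jt ->]; exact: ok.
have E' : (\sum_(be <- map u t) scal (c' be) * bmono be) * esums k n setT = 0.
  have -> : \sum_(be <- map u t) scal (c' be) * bmono be = \sum_(i <- t) scal (c i) * bmono (u i).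
    by rewrite big_map; apply: eq_big_seq => j jt; rewrite c'E.
  exact: E.
move=> i it; rewrite -(c'E _ it).
exact: (bmono_indep uq okm E' (map_f u it)).
Qed.

Lemma bmono_span (x : Rn k n r) : fspan scal bmono (@admissible k n r) x.
Proof.
apply: fspan_trans (Rn_span x) => t _; case: t => [|v t].
  have -> : mono [::] = bmono [ffun=> None].
    rewrite /mono big_nil /bmono big1 // => l _; by rewrite ffunE.
  by apply: fspan_mem => l a v; rewrite ffunE.
have : fspan scal bmono (@good k n r) (mono (v :: t)) by exact: mono_span.
by apply: fspan_trans => be [ok _]; exact: fspan_mem.
Qed.

Lemma esums_regular (x : Rn k n r) : x * esums k n setT = 0 -> x = 0.
Proof.
have [t [c [ut ok ->]]] := fspan_uniq (bmono_span x); move=> E.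
have c0 := bmono_indep ut ok E.
apply: big1_seq => be /andP[_ bt]; rewrite (c0 _ bt) rmorph0.
exact: mul0r.
Qed.
End IndependenceCriterion.

(** * The ideal I_n *)

Lemma cancel_terms (S T : comPzRingType) (f : {rmorphism S -> T}) y z :
  (f 1 * y + (f (- 1) * y + 0)) * z = 0.
Proof. by rewrite addr0 rmorphN mulNr subrr mul0r. Qed.

Section CuspIdeal.
Variables (k : finFieldType) (n r : nat).
Local Notation An := {poly %/ ('X^n : {poly k})}.
Local Notation V := 'cV[An]_r.
Local Notation F := {fraction {poly k}}.
Hypotheses (n_gt0 : (0 < n)%N) (r_gt0 : (0 < r)%N).
Local Notation R := (Rn k n r).
Local Notation rho := (@Rn_inv k n r).
Local Notation scal := (@Rn_scal k n r).
Local Notation esum := (@esum k n r).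
Local Notation bmono := (@bmono k n r).
Local Notation bindex := (bindex k n r).
Local Notation fprod := (esums k n (setT : {set 'I_r})).
Local Notation U := {g : 'M[An]_r | g \in Ugrp k n r}.
Implicit Types (v : V) (l : 'I_r) (be : bindex) (x y : R).

Lemma act_scal g a : g \in Ugrp k n r -> GL_act g (scal a) = scal a.
Proof. by move=> /Ugrp_unit/(GL_actP n_gt0)[]. Qed.

Lemma act_rho g v : g \in Ugrp k n r -> GL_act g (rho v) = rho (g *m v).
Proof.
move=> gU; have [->|v0] := eqVneq v 0.
  by rewrite mulmx0 rho0 //; exact: rmorph0.
by have [_ ->] := GL_actP n_gt0 (Ugrp_unit gU).
Qed.

Lemma act_esum g l : g \in Ugrp k n r -> GL_act g (esum l) = esum l.
Proof.
move=> gU; rewrite rmorph_sum [RHS](reindex_inj (can_inj (mulKmx (Ugrp_unit gU)))) /=.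
apply: eq_big => [v|v _]; first by rewrite Ugrp_Delta.
exact: act_rho.
Qed.

(** Through the columns of g, [U] indexes the products in E_1 ... E_r and acts on the index by left
    multiplication. *)
Definition eprod (g : 'M[An]_r) : R := \prod_l rho (g *m Xvec k n l).
Definition epow (al : {ffun 'I_r -> nat}) : R := \prod_l esum l ^+ al l.

Lemma act_epow g al : g \in Ugrp k n r -> GL_act g (epow al) = epow al.
Proof.
move=> gU; rewrite rmorph_prod; apply: eq_bigr => l _.
transitivity (GL_act g (esum l) ^+ al l); first exact: rmorphXn.
by rewrite act_esum.
Qed.

Lemma act_eprod g h : h \in Ugrp k n r -> GL_act h (eprod g) = eprod (h *m g).
Proof.
move=> hU; rewrite rmorph_prod; apply: eq_bigr => l _.
by rewrite -mulmxA; exact: act_rho.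
Qed.

Definition full_index (al : {ffun 'I_r -> nat}) (g : 'M[An]_r) : bindex :=
  [ffun l => Some (al l, g *m Xvec k n l)].

Lemma bmono_full al g : bmono (full_index al g) = epow al * eprod g.
Proof.
rewrite -big_split; apply: eq_bigr => l _.
by rewrite ffunE.
Qed.

Lemma full_index_inj al g al' g' : full_index al g = full_index al' g' -> al = al' /\ g = g'.
Proof.
move=> /ffunP E; split.
  by apply/ffunP => l; have := E l; rewrite !ffunE => -[].
by apply: mx_Xvec_inj => l; have := E l; rewrite !ffunE => -[].
Qed.

Lemma full_index_admissible al g : g \in Ugrp k n r -> admissible (full_index al g).
Proof. by move=> /(UgrpP n_gt0) gU l a v; rewrite ffunE => -[_ <-]. Qed.

Lemma full_indexP be : admissible be -> (forall l, be l <> None) ->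
  exists al g, g \in Ugrp k n r /\ be = full_index al g.
Proof.
move=> ok full; pose e l := if be l is Some (_, v) then v else 0.
pose al := [ffun l => if be l is Some (a, _) then a else 0%N].
have beE l : be l = Some (al l, e l).
  by rewrite /al ffunE /e; case E : (be l) (full l) => [[a v]|].
exists al, (mxcols e); split; first by apply: mxcols_Ugrp => // l; exact: ok (beE l).
by apply/ffunP => l; rewrite ffunE mxcols_Xvec beE.
Qed.

Lemma EprodP x : Eprod x <-> exists2 g, g \in Ugrp k n r & x = eprod g.
Proof.
split=> [[e eE ->]|[g /(UgrpP n_gt0) gU ->]]; last first.
  exists (fun l => rho (g *m Xvec k n l)) => // l.
  exists (g *m Xvec k n l - Xvec k n l); last by rewrite addrC subrK.
  by apply/(VprimeP n_gt0); rewrite addrC subrK.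
have /choice[w wE] l : exists w, Xvec k n l + w \in Delta k n l /\ e l = rho (Xvec k n l + w).
  by have [w /(VprimeP n_gt0) wD E] := eE l; exists w.
exists (mxcols (fun l => Xvec k n l + w l)).
  by apply: mxcols_Ugrp => // l; have [] := wE l.
by apply: eq_bigr => l _; rewrite mxcols_Xvec; have [] := wE l.
Qed.

Lemma eprod_ideal g : g \in Ugrp k n r -> idealI (eprod g).
Proof.
move=> gU.
have eE : eprod g = mono [seq g *m Xvec k n l | l <- enum 'I_r].
  by rewrite /mono big_map big_enum.
split.
  rewrite eE; apply: mono_plus => // /(congr1 size).
  by rewrite size_map size_enum_ord => r0; move: r_gt0; rewrite r0.
move=> s i /andP[_ sr] i_inj; have [f [fP f0]] := tilde_pi_ex n_gt0 i_inj.
(* If all columns of g lay in the image of i, then i would be onto, which the cardinalities exclude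
   as s < r. *)
exists f => //; rewrite eE; apply: f0; apply/hasP; apply: contrapT => H.
have /choice[w wE] l : exists w, g *m Xvec k n l = i w.
  apply/codomP; apply: contrapT => /negP nc; apply: H.
  by exists (g *m Xvec k n l) => //; apply: map_f; rewrite mem_enum.
have surj v : v \in codom i.
  apply/codomP; exists (\sum_l (invmx g *m v) l 0 *: w l).
  rewrite linear_sum; rewrite -{1}[v](mulKVmx (Ugrp_unit gU)).
  move: (invmx g *m v) => u; apply/colP => a; rewrite summxE mxE; apply: eq_bigr => l _.
  by rewrite linearZ -wE -colE !mxE mulrC.
have : (#|V| <= #|'cV[An]_s|)%N.
  rewrite -(card_codom i_inj); apply/subset_leq_card/subsetP => v _; exact: surj.
have card_col m : #|{: 'cV[An]_m}| = (#|{: An}| ^ m)%N by rewrite card_mx muln1.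
have An2 : (1 < #|{: An}|)%N.
  by apply/card_gt1P; exists 0, 1; split=> //; rewrite eq_sym; exact: oner_neq0.
rewrite (card_col r) (card_col s); move: #|{: An}| An2 => m m1.
by rewrite leq_exp2l // leqNgt sr.
Qed.

Lemma ideal_mul x y : idealI x -> idealI (y * x).
Proof.
move=> [xp xf]; split; first by rewrite mulrC; exact: Rn_plusM.
move=> s i si i_inj; have [f fP f0] := xf s i si i_inj.
exists f => //; rewrite rmorphM /= f0; exact: mulr0.
Qed.

Definition invariants x := fspan scal epow (fun _ => True) x.

Lemma invariants_invU x : invariants x -> invU x.
Proof.
move=> [l _ ->] g gU; rewrite rmorph_sum; apply: eq_bigr => p _.
rewrite rmorphM; congr (_ * _); [exact: act_scal | exact: act_epow].
Qed.

Local Notation term := (fun p : {ffun 'I_r -> nat} * U => epow p.1 * eprod (val p.2)).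

Lemma ideal_fspan x : idealI x -> fspan scal term (fun _ => True) x.
Proof.
move=> [xp xI].
have /fspan_uniq[t [c [ut tg xE]]] : fspan scal bmono (@good k n r) x.
  by apply: fspan_trans (proj1 (Rn_plus_span n_gt0 x) xp) => t t0; exact: mono_span.
have ok : {in t, forall be, admissible be} by move=> be /tg[].
(* The support S is nonempty by [good] and proper by assumption, so x is killed by tilde pi for
   every translate of the coordinate subspace of S. *)
have c0 be : be \in t -> ~ (forall l, be l <> None) -> c be = 0.
  move=> bt nf; have [_ [l0 bl0]] := tg _ bt.
  apply: (@specialization_indep k n r n_gt0 (support be) t c ut ok _ be bt (subxx _)).
  move=> h hU; have [||f fP fx] := xI #|support be| (embedding (support be) h).
  - apply/andP; split; first by apply/card_gt0P; exists l0; rewrite inE; apply/eqP.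
    rewrite -[X in (_ < X)%N]card_ord; apply: proper_card; apply/properP; split=> //.
      by apply/subsetP.
    apply: contrapT => H; apply: nf => l bl; apply: H; exists l => //.
    by rewrite inE bl.
  - exact: embedding_inj (Ugrp_unit hU).
  by exists f => //; rewrite -xE rmorphM /= fx; exact: mul0r.
rewrite xE; apply: fspan_sum => be bt _.
have [full|nf] := pselect (forall l, be l <> None); last first.
  rewrite (c0 _ bt nf) rmorph0 (_ : 0 * _ = 0); [exact: fspan0 | exact: mul0r].
have [al [g [gU ->]]] := full_indexP (ok _ bt) full.
rewrite bmono_full; apply: fspanZ.
exact: (@fspan_mem _ _ _ _ term _ (al, exist _ g gU)).
Qed.

Lemma ideal_span x : idealI x -> exists P : U -> R,
  (forall u : U, invariants (P u)) /\ x = \sum_(g : U) P g * eprod (val g).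
Proof.
move=> /ideal_fspan[l _ ->].
exists (fun u : U => \sum_(p <- l | p.2.2 == u) scal p.1 * epow p.2.1); split=> [g|].
  by apply: fspan_sum => p _ _; apply: fspanZ; exact: fspan_mem.
under [RHS]eq_bigr do rewrite mulr_suml.
rewrite (exchange_big_dep xpredT) //=; apply: eq_bigr => p _.
rewrite (big_pred1 p.2.2) => [|g]; last by rewrite /= eq_sym.
by rewrite mulrA.
Qed.

Lemma Ugrp_mulr g h : g \in Ugrp k n r -> (h *m g \in Ugrp k n r) = (h \in Ugrp k n r).
Proof.
move=> gU; apply/idP/idP => [hgU|hU]; last exact: UgrpM.
apply/(UgrpP n_gt0) => l; rewrite -(mulKVmx (Ugrp_unit gU) (Xvec k n l)) [h *m _]mulmxA.
rewrite (Ugrp_Delta n_gt0 l _ hgU) -(Ugrp_Delta n_gt0 l _ gU) (mulKVmx (Ugrp_unit gU)).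
exact: Xvec_Delta.
Qed.

(** Expanding f_1 ... f_r chooses one vector in each [Delta l], that is, the columns of an element
    of [U]; right multiplication by g permutes [U]. *)
Lemma sum_eprod g : g \in Ugrp k n r -> \sum_(h in Ugrp k n r) eprod (h *m g) = fprod.
Proof.
move=> gU; have ginj : injective (mulmxr g : 'M[An]_r -> 'M[An]_r).
  exact: can_inj (mulmxK (Ugrp_unit gU)).
transitivity (\sum_(h in Ugrp k n r) eprod h).
  rewrite [RHS](reindex_inj ginj) /=; apply: eq_bigl => h.
  by rewrite Ugrp_mulr.
transitivity (\prod_l \sum_(v in Delta k n l) rho v); last first.
  by apply: eq_bigl => l; rewrite in_setT.
rewrite bigA_distr_big_dep (reindex (fun h : 'M[An]_r => [ffun l => h *m Xvec k n l])) /=; last first.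
  exists (fun e : {ffun 'I_r -> V} => mxcols e) => [h _|e _].
    by apply: mx_Xvec_inj => l; rewrite mxcols_Xvec ffunE.
  by apply/ffunP => l; rewrite ffunE mxcols_Xvec.
apply: eq_big => [h|h _].
  by apply/(UgrpP n_gt0)/familyP => H l; have := H l; rewrite ffunE.
by apply: eq_bigr => l _; rewrite ffunE.
Qed.

(* Sum the expansion of x * eprod 1 over its orbit under U. *)
Lemma invU_esums x : invU x -> exists2 p, invariants p & x * fprod = p * fprod.
Proof.
move=> xU; have oneU : 1%:M \in Ugrp k n r.
  by apply/(UgrpP n_gt0) => l; rewrite mul1mx Xvec_Delta.
have [P [PI E]] := ideal_span (ideal_mul x (eprod_ideal oneU)).
exists (\sum_g P g); first by apply: fspan_sum => g _ _; exact: PI.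
rewrite -{1}(sum_eprod oneU) mulr_sumr mulr_suml.
transitivity (\sum_(h in Ugrp k n r) GL_act h (x * eprod 1%:M)).
  apply: eq_bigr => h hU; rewrite rmorphM; congr (_ * _); first exact/esym/xU.
  exact/esym/act_eprod.
rewrite E; under eq_bigr => h hU do rewrite rmorph_sum.
rewrite exchange_big; apply: eq_bigr => g _ /=.
rewrite -(sum_eprod (valP g)) mulr_sumr; apply: eq_bigr => h hU.
rewrite rmorphM; congr (_ * _); first exact: invariants_invU (PI g) h hU.
exact: act_eprod.
Qed.

Lemma full_indep (I : eqType) (t : seq I) (u : I -> {ffun 'I_r -> nat} * U) (c : I -> F) :
  uniq t -> {in t &, injective u} ->
  (\sum_(i <- t) scal (c i) * term (u i)) * fprod = 0 ->
  {in t, forall i, c i = 0}.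
Proof.
move=> ut uinj E.
apply: (@bmono_indep_family k n r n_gt0 I t (fun i => full_index (u i).1 (val (u i).2)) c ut).
- move=> i j it jt /full_index_inj[E1 E2]; apply: uinj => //.
  by case: (u i) (u j) E1 E2 => [a g] [b h] /= -> /val_inj->.
- by move=> i _; apply: full_index_admissible; exact: valP.
apply: etrans E; apply: (congr1 (fun z => z * fprod)); apply: eq_bigr => i _.
exact: (congr1 (fun z => scal (c i) * z) (bmono_full _ _)).
Qed.

Lemma eprod_inj : {in Ugrp k n r &, injective eprod}.
Proof.
move=> g h gU hU E; apply/eqP/negPn/negP => gh.
pose gg : U := exist _ g gU; pose hh : U := exist _ h hU.
pose al : {ffun 'I_r -> nat} := [ffun=> 0%N].
have := @full_indep _ [:: gg; hh] (fun w => (al, w)) (fun i => if i == gg then 1 else -1).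
move=> /(_ _ _ _ gg (mem_head _ _)); rewrite eqxx => /(_ _ _ _)/eqP.
rewrite oner_eq0 => H; apply: notF; apply: H.
- by rewrite /= inE andbT; apply: contra gh => /eqP[->].
- by move=> i j _ _ [].
rewrite !big_cons big_nil /= eqxx (_ : hh == gg = false); last first.
  by apply: contraNF gh => /eqP[->].
rewrite E; exact: cancel_terms.
Qed.

Lemma ideal_basis : is_basis (@invU k n r) (fun a x : R => a * x) (@idealI k n r) (@Eprod k n r).
Proof.
split.
- by move=> x /EprodP[g gU ->]; exact: eprod_ideal.
- move=> x /ideal_span[P [PI ->]].
  (* In [is_basis] coefficients are functions of the basis element, so P is transported along the
     injective [eprod], with 0 as a default elsewhere. *)
  pose c y : R := if [pick g : U | eprod (val g) == y] is Some g then P g else 0.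
  exists [seq eprod (val g) | g <- enum {: U}], c; split.
  + move=> _ /mapP[g _ ->]; apply/EprodP; exists (val g) => //; exact: valP.
  + move=> y; rewrite /c; case: pickP => [g _|_]; first exact: invariants_invU.
    by apply: invariants_invU; exact: fspan0.
  rewrite big_map big_enum /=; apply: eq_bigr => g _; congr (_ * _).
  rewrite /c; case: pickP => [h /eqP E|/(_ g)]; last by rewrite eqxx.
  by congr P; apply/val_inj/esym/eprod_inj => //; exact: valP.
move=> s c us sE cU E.
have /choice[g gE] b : exists g : U, b \in s -> b = eprod (val g).
  have [bs|nb] := boolP (b \in s).
    by have /EprodP[g gU ->] := sE b bs; exists (exist _ g gU).
  have oneU : 1%:M \in Ugrp k n r.
    by apply/(UgrpP n_gt0) => l; rewrite mul1mx Xvec_Delta.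
  by exists (exist (fun g => g \in Ugrp k n r) _ oneU).
(* An invariant coefficient is known as a polynomial in the f_l only up to the factor f_1 ... f_r.
   The relation is multiplied by it, and [esums_regular] cancels it at the end. *)
have /choice[p pE] b : exists p, invariants p /\ c b * fprod = p * fprod.
  by have [p pI pE] := invU_esums (cU b); exact: (ex_intro _ p (conj pI pE)).
have /choice[T TE] b : exists T : seq {ffun 'I_r -> nat} * ({ffun 'I_r -> nat} -> F),
    uniq T.1 /\ p b = \sum_(al <- T.1) scal (T.2 al) * epow al.
  by have [pI _] := pE b; have [t [d [ut _ tE]]] := fspan_uniq pI;
    exact: (ex_intro _ (t, d) (conj ut tE)).
(* A common list of exponents, with coefficients padded by 0 in [d], turns the relation into one
   over a single family of full monomials. *)
pose A := undup (flatten [seq (T b).1 | b <- s]).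
pose d b al := if al \in (T b).1 then (T b).2 al else 0.
have pA b : b \in s -> p b = \sum_(al <- A) scal (d b al) * epow al.
  move=> bs; have [uT ->] := TE b.
  rewrite [RHS](bigID (mem (T b).1)) /= [X in _ + X]big1_seq ?addr0; last first.
    by move=> al /andP[/negPf nal _]; rewrite /d nal rmorph0; exact: mul0r.
  rewrite -[RHS]big_filter (eq_big_seq (fun al => scal (d b al) * epow al)).
    apply: perm_big.
    apply: uniq_perm => // [|al]; first by rewrite filter_uniq ?undup_uniq.
    rewrite mem_filter; case alT : (al \in (T b).1) => //=.
    by rewrite mem_undup; apply/esym/flattenP; exists (T b).1 => //; exact: map_f.
  by move=> al alT; rewrite /d alT.
have H := @full_indep _ [seq (b, al) | b <- s, al <- A] (fun q => (q.2, g q.1))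
  (fun q => d q.1 q.2).
have {}H : forall q, q \in [seq (b, al) | b <- s, al <- A] -> d q.1 q.2 = 0.
  apply: H.
  - by apply: allpairs_uniq; rewrite ?undup_uniq // => -[? ?] [? ?] _ _ [-> ->].
  - move=> _ _ /allpairsP[[b al] [/= bs _ ->]] /allpairsP[[b' al'] [/= bs' _ ->]] /= [-> gg].
    by congr (_, _); rewrite (gE b bs) (gE b' bs') gg.
  rewrite big_allpairs /= mulr_suml.
  transitivity (\sum_(b <- s) c b * b * fprod); last first.
    by rewrite -mulr_suml E; exact: mul0r.
  apply: eq_big_seq => b bs; have [_ pb] := pE b.
  rewrite [RHS]mulrAC pb (pA b bs) [RHS]mulrAC; congr (_ * _).
  rewrite mulr_suml; apply: eq_bigr => al _.
  by apply: etrans (mulrA _ _ _) _; congr (_ * _); exact/esym/gE.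
move=> b bs; apply: (esums_regular n_gt0); have [_ ->] := pE b.
rewrite (pA b bs) (_ : \sum_(al <- A) _ = 0); first exact: mul0r.
apply: big1_seq => al /andP[_ alA].
rewrite (H (b, al)) ?rmorph0; first exact: mul0r.
by apply/allpairsP; exists (b, al).
Qed.

(** The basis consists of the products of powers of the f_l with the single product given by the
    identity matrix; the translates of such an element are the spanning monomials with the same
    exponents, each once. *)
Lemma ideal_free : is_free (fun _ : FU k n r => True) (@FU_act k n r) (@idealI k n r).
Proof.
have oneU : 1%:M \in Ugrp k n r.
  by apply/(UgrpP n_gt0) => l; rewrite mul1mx Xvec_Delta.
have actE al (g : U) : GL_act (val g) (epow al * eprod 1%:M) = epow al * eprod (val g).
  rewrite rmorphM; congr (_ * _); first by apply: act_epow; exact: valP.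
  by rewrite -[in RHS](mulmx1 (val g)); apply: act_eprod; exact: valP.
exists (fun x => exists al, x = epow al * eprod 1%:M); split.
- by move=> _ [al ->]; apply: ideal_mul; exact: eprod_ideal.
- move=> x /ideal_fspan[l _ ->].
  pose A := undup [seq p.2.1 | p <- l].
  pose c al : FU k n r := [ffun g => \sum_(p <- l | p.2 == (al, g)) p.1].
  (* Coefficients are functions of the basis element, so its exponents must be recoverable from
     it. *)
  have epow_inj al al' : epow al * eprod 1%:M = epow al' * eprod 1%:M -> al = al'.
    move=> E; apply/eqP/negPn/negP => ne.
    pose g1 : U := exist (fun g => g \in Ugrp k n r) _ oneU.
    have := @full_indep _ [:: al; al'] (fun a => (a, g1)) (fun i => if i == al then 1 else -1).
    move=> /(_ _ _ _ al (mem_head _ _)); rewrite eqxx => /(_ _ _ _)/eqP.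
    rewrite oner_eq0 => H; apply: notF; apply: H.
    + by rewrite /= inE andbT.
    + by move=> i j _ _ [].
    rewrite !big_cons big_nil /= eqxx eq_sym (negPf ne).
    rewrite E; exact: cancel_terms.
  pose c' y : FU k n r := if pselect (exists al, y = epow al * eprod 1%:M) is left H
    then c (projT1 (cid H)) else 0.
  have c'E al : c' (epow al * eprod 1%:M) = c al.
    rewrite /c'; case: pselect => [H|[]]; last by exists al.
    by case: (cid H) => al' /= /epow_inj->.
  exists [seq epow al * eprod 1%:M | al <- A], c'; split=> //.
    by move=> _ /mapP[al _ ->]; exists al.
  have lA p : p \in l -> p.2 \in [seq (al, g) | al <- A, g <- enum {: U}].
    move=> pl; apply/allpairsP; exists p.2; split; last by case: (p.2).
      by rewrite mem_undup; exact: (map_f (fun p => p.2.1)).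
    by rewrite mem_enum.
  have uA : uniq [seq (al, g) | al <- A, g <- enum {: U}].
    by apply: allpairs_uniq; rewrite ?undup_uniq ?enum_uniq // => -[? ?] [? ?] _ _ [-> ->].
  rewrite (sum_collect scal (b := term) uA lA) big_allpairs big_map.
  apply: eq_bigr => al _; rewrite c'E big_enum; apply: eq_bigr => g _.
  by rewrite ffunE actE.
move=> s c us sB _ E b bs.
have /choice[al alE] y : exists al, y \in s -> y = epow al * eprod 1%:M.
  have [ys|ns] := boolP (y \in s); last by exists [ffun=> 0%N].
  by have [a ->] := sB y ys; exists a.
apply/ffunP => g; rewrite ffunE.
have H := @full_indep _ [seq (y, g) | y <- s, g <- enum {: U}] (fun q => (al q.1, q.2))
  (fun q => c q.1 q.2).
apply: (H _ _ _ (b, g)).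
- by apply: allpairs_uniq; rewrite ?enum_uniq // => -[? ?] [? ?] _ _ [-> ->].
- move=> _ _ /allpairsP[[y h] [/= ys _ ->]] /allpairsP[[y' h'] [/= ys' _ ->]] /= [aa ->].
  by congr (_, _); rewrite (alE y ys) (alE y' ys') aa.
- rewrite big_allpairs /= (_ : \sum_(y <- s) _ = 0); first exact: mul0r.
  rewrite -[RHS]E; apply: eq_big_seq => y ys; rewrite big_enum /=.
  apply: eq_bigr => h _; apply: (congr1 (fun z => scal (c y h) * z)).
  by rewrite -actE; apply: (congr1 (GL_act (val h))); exact/esym/alE.
by apply/allpairsP; exists (b, g); rewrite mem_enum.
Qed.
End CuspIdeal.

Theorem theorem3p4p1 (k : finFieldType) (n r : nat) (hn : (1 <= n)%N)
    (hr : (1 <= r)%N) :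
  is_basis (@invU k n r) (fun a x : Rn k n r => a * x) (@idealI k n r)
    (@Eprod k n r)
  /\ is_free (fun _ : FU k n r => True) (@FU_act k n r) (@idealI k n r).
Proof. by split; [exact: ideal_basis | exact: ideal_free]. Qed.
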